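(* Let $\sigma_1$ and $\sigma_2$ be two maximal prime cones in $\operatorname{Trop}(I_{2,n})$ that intersect in a facet. Then their associated Newton–Okounkov bodies $\Delta(\sigma_1)$ and $\Delta(\sigma_2)$ are, up to unimodular equivalence, related by a shear map obtained from tropicalizing a cluster mutation. That is, there exist a triangulation $T$ of the $n$-gon, a diagonal $\overline{ac}\in T$, and unimodular equivalences $\varphi_1,\varphi_2$ from $\Delta(\sigma_1),\Delta(\sigma_2)$ to polytopes in $\mathbb R^{T}$ such that $\zeta_{ac}(\varphi_1(\Delta(\sigma_1)))=\varphi_2(\Delta(\sigma_2))$.
   Context: $S=\mathbb C[p_{ij}:1\le i<j\le n]$; $I_{2,n}$ is the ideal generated by the Plücker relations $p_{ij}p_{kl}-p_{ik}p_{jl}+p_{il}p_{jk}$, $1\le i<j<k<l\le n$; $A_{2,n}=S/I_{2,n}$. For a weight $w\in\mathbb R^{\binom n2}$, $\operatorname{in}_w(f)$ is the sum of terms of $f$ of minimal $w$-weight, $\operatorname{in}_w(I)=\langle\operatorname{in}_w(f):f\in I\rangle$. $\operatorname{Trop}(I_{2,n})$ is the fan of weights $w$ such that $\operatorname{in}_w(I_{2,n})$ contains no monomial, with fan structure induced from the Gröbner fan ($u,w$ in the relative interior of the same cone iff their initial ideals coincide). Its maximal cones have dimension $2n-3$. A maximal prime cone is a maximal cone $\sigma$ of $\operatorname{Trop}(I_{2,n})$ whose initial ideal $\operatorname{in}_\sigma(I_{2,n})$ is binomial and prime. Newton–Okounkov body: for a maximal prime cone $\sigma$ choose linearly independent integral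 vectors $u_1=(1,\dots,1),u_2,\dots,u_{2n-3}$ in $\sigma$ whose linear span is that of $\sigma$, and let $M_\sigma$ be the matrix with these rows. There is an associated full-rank valuation $\mathfrak v_\sigma:A_{2,n}\setminus\{0\}\to\mathbb Z^{2n-3}$ (Kaveh–Manon), with $\mathfrak v_\sigma(\bar p_{ij})$ equal to the $ij$-th column of $M_\sigma$, value semigroup generated by these columns, and first entry equal to the degree on homogeneous elements. $\Delta(\sigma)=\operatorname{Cone}(\mathfrak v_\sigma(f):f\in A_{2,n}\setminus\{0\})\cap(\{1\}\times\mathbb R^{2n-4})$, which is the convex hull of the columns of $M_\sigma$. A unimodular equivalence from $\Delta(\sigma)$ to a polytope in $\mathbb R^T$ is the restriction of a linear isomorphism carrying the lattice generated by the image of $\mathfrak v_\sigma$ onto $\mathbb Z^T$. Triangulations: the $n$-gon has vertices $1,\dots,n$ clockwise; a triangulation $T$ is a maximal set of pairwise non-crossing arcs $\overline{ij}$ including the $n$ boundary edges (so $|T|=2n-3$); $\mathbb R^T$ has standard basis $\{f_{ij}:\overline{ij}\in T\}$ and $\mathbb Z^T$ is its standard lattice. For a diagonal $\overline{ac}\in T$ let $a,b,c,d$ (clockwise) be the vertices of the quadrilateral formed by the two triangles of $T$ adjacent to $\overline{ac}$, and put $v_{ac}=-f_{ab}-f_{cd}+f_{ad}+f_{bc}$. The shear map obtained by (Fock–Goncharov) tropicalization of the cluster mutation flipping $\overline{ac}$ is $\zeta_{ac}:\mathbb R^T\to\mathbb R^T$, $m=\sum m_{ij}f_{ij}\mapsto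 m$ if $m_{ac}\le0$, and $m\mapsto m+m_{ac}v_{ac}$ if $m_{ac}>0$. *)

(* Defs.v *)
From HB Require Import structures.
From mathcomp Require Import all_boot all_order all_algebra.
From mathcomp Require Import complex.
From mathcomp Require Import boolp classical_sets reals topology normedtype.
(* The notations of mpoly clash with those of topology. *)
From mathcomp Require Import -(notations) mpoly.

Set Implicit Arguments.
Unset Strict Implicit.
Unset Printing Implicit Defensive.

Import Order.TTheory GRing.Theory Num.Theory.
Import numFieldNormedType.Exports.

Local Open Scope classical_set_scope.
Local Open Scope ring_scope.

(* Vertices are numbered from 0. *)
Definition ngon_arc (n : nat) : finType := {e : 'I_n * 'I_n | (e.1 < e.2)%N}.

Definition ends (n : nat) (e : ngon_arc n) : {set 'I_n} :=
  [set (val e).1; (val e).2]%SET.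

Notation pring R n := (mpoly #|ngon_arc n| R[i]).

(* The Pluecker variable p_ij; the value 0 when j <= i is never used. *)
Definition pvar (R : realType) (n : nat) (i j : 'I_n) : pring R n :=
  oapp (fun e : ngon_arc n => mpolyX _ (mnm1 (enum_rank e))) 0 (insub (i, j)).

Definition ideal_gen (A : comNzRingType) (G : set A) : set A :=
  [set f | exists (k : nat) (a g : 'I_k -> A),
     (forall i, G (g i)) /\ f = \sum_i a i * g i].

Definition pluecker_relations (R : realType) (n : nat) : set (pring R n) :=
  [set f | exists i j k l : 'I_n, (i < j < k)%N /\ (k < l)%N /\
     f = pvar R i j * pvar R k l - pvar R i k * pvar R j l
         + pvar R i l * pvar R j k].

Definition I2 (R : realType) (n : nat) : set (pring R n) :=
  ideal_gen (@pluecker_relations R n).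
Arguments I2 R n : clear implicits.

Section InitialIdeals.
Variables (R : realType) (N : nat).
Implicit Types (w : 'rV[R]_N) (J : set (mpoly N R[i])).

Definition weight w (m : multinom N) : R := \sum_i w 0 i * (m i)%:R.

Definition init_form w (f : mpoly N R[i]) : mpoly N R[i] :=
  \sum_(m <- msupp f | all (fun m' => weight w m <= weight w m') (msupp f))
    mcoeff m f *: mpolyX _ m.

Definition init_ideal w J : set (mpoly N R[i]) :=
  ideal_gen [set init_form w f | f in J].

Definition Trop J : set 'rV[R]_N :=
  [set w | forall m : multinom N, ~ init_ideal w J (mpolyX _ m)].

(* The cone of the Groebner fan of J having w in its relative interior. *)
Definition groebner_cone J w : set 'rV[R]_N :=
  closure [set u | init_ideal u J = init_ideal w J].

Definition Trop_cone J (sigma : set 'rV[R]_N) : Prop :=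
  exists2 w, Trop J w & sigma = groebner_cone J w.

Definition maximal_Trop_cone J (sigma : set 'rV[R]_N) : Prop :=
  Trop_cone J sigma /\
  forall tau, Trop_cone J tau -> sigma `<=` tau -> tau = sigma.

Definition binomial_ideal J : Prop :=
  exists2 G : set (mpoly N R[i]),
    (forall g, G g -> size (msupp g) = 2%N) & J = ideal_gen G.

Definition prime_ideal J : Prop :=
  ~ J 1 /\ forall f g, J (f * g) -> J f \/ J g.

Definition maximal_prime_cone J (sigma : set 'rV[R]_N) : Prop :=
  maximal_Trop_cone J sigma /\
  exists2 w, Trop J w & [/\ sigma = groebner_cone J w,
    binomial_ideal (init_ideal w J) & prime_ideal (init_ideal w J)].

(* The rows of B lie in A and form a basis of the linear span of A. *)
Definition span_basis (d : nat) (A : set 'rV[R]_N) (B : 'M[R]_(d, N)) : Prop :=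
  [/\ row_free B, forall i, A (row i B) & forall x, A x -> (x <= B)%MS].

Definition has_dim (A : set 'rV[R]_N) (d : nat) : Prop :=
  exists B : 'M[R]_(d, N), span_basis A B.

Definition face (F sigma : set 'rV[R]_N) : Prop :=
  exists l : 'cV[R]_N, (forall x, sigma x -> 0 <= (x *m l) 0 0) /\
    F = [set x | sigma x /\ (x *m l) 0 0 = 0].

Definition facet (F sigma : set 'rV[R]_N) : Prop :=
  face F sigma /\ exists d, has_dim sigma d.+1 /\ has_dim F d.

End InitialIdeals.

(* Equal to 2n-3 for all n >= 2; the successor gives matrices a first row. *)
Notation rk n := (n.*2 - 4).+1.

Definition cone_matrix (R : realType) (n : nat)
    (sigma : set 'rV[R]_#|ngon_arc n|) (M : 'M[int]_(rk n, #|ngon_arc n|)) : Prop :=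
  row ord0 M = const_mx 1 /\ span_basis sigma (map_mx intr M).

Definition lex_le (d : nat) (a b : 'cV[int]_d) : bool :=
  (([tuple a i 0 | i < d] : d.-tuplelexi int) <= [tuple b i 0 | i < d])%O.

Section Valuation.
Variables (R : realType) (n : nat) (M : 'M[int]_(rk n, #|ngon_arc n|)).

Definition mon_value (m : multinom #|ngon_arc n|) : 'cV[int]_(rk n) :=
  M *m \col_i (m i)%:Z.

Definition is_min_value (F : pring R n) (a : 'cV[int]_(rk n)) : Prop :=
  (exists2 m, m \in msupp F & a = mon_value m) /\
  (forall m, m \in msupp F -> lex_le a (mon_value m)).

(* Elements of A_{2,n} are represented by polynomials modulo I_{2,n}.
   Following Kaveh and Manon, the value of the class of f is the
   lexicographic maximum, over all representatives F of this class, of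
   min {M m | m exponent of F}. *)
Definition valuation (f : pring R n) (a : 'cV[int]_(rk n)) : Prop :=
  (exists2 F, I2 R n (F - f) & is_min_value F a) /\
  (forall F b, I2 R n (F - f) -> is_min_value F b -> lex_le b a).

Definition values : set 'cV[R]_(rk n) :=
  [set map_mx intr a | a in
     [set a | exists2 f : pring R n, ~ I2 R n f & valuation f a]].

End Valuation.
Arguments values R {n} M.

Definition cone_hull (R : realType) (V : lmodType R) (A : set V) : set V :=
  [set x | exists (k : nat) (c : 'I_k -> R) (a : 'I_k -> V),
     (forall i, 0 <= c i /\ A (a i)) /\ x = \sum_i c i *: a i].

Definition lattice_hull (V : zmodType) (A : set V) : set V :=
  [set x | exists (k : nat) (c : 'I_k -> int) (a : 'I_k -> V),
     (forall i, A (a i)) /\ x = \sum_i a i *~ c i].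

Definition NO_body (R : realType) (n : nat) (M : 'M[int]_(rk n, #|ngon_arc n|)) :
    set 'cV[R]_(rk n) :=
  cone_hull (values R M) `&` [set x | x ord0 0 = 1].
Arguments NO_body R {n} M.

Definition crossing (n : nat) (e e' : ngon_arc n) : bool :=
  [&& (val e).1 < (val e').1, (val e').1 < (val e).2 & (val e).2 < (val e').2]%N.

Definition noncrossing (n : nat) (T : {set ngon_arc n}) : bool :=
  [forall e in T, forall e' in T, ~~ crossing e e'].

Definition boundary (n : nat) : {set ngon_arc n} :=
  [set e : ngon_arc n | ((val e).2 == ordS (val e).1) || ((val e).1 == ordS (val e).2)]%SET.

Definition triangulation (n : nat) (T : {set ngon_arc n}) : bool :=
  maxset (fun T' : {set ngon_arc n} => noncrossing T' && (boundary n \subset T')) T.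

Notation edge T := {e | e \in T}.

Definition joined (n : nat) (T : {set ngon_arc n}) (i j : 'I_n) : bool :=
  [exists e in T, ends e == [set i; j]%SET].

Definition clockwise (n : nat) (a b c d : 'I_n) : bool :=
  [|| [&& a < b, b < c & c < d], [&& b < c, c < d & d < a],
      [&& c < d, d < a & a < b] | [&& d < a, a < b & b < c]]%N.

(* Three vertices of T that are pairwise joined bound a triangle of T, so the
   triangles adjacent to the diagonal ac are abc and acd. *)
Definition quadrilateral (n : nat) (T : {set ngon_arc n}) (ac : edge T)
    (a b c d : 'I_n) : Prop :=
  clockwise a b c d /\ ends (val ac) = [set a; c]%SET /\
  [/\ joined T a b, joined T b c, joined T c d & joined T a d].

(* R^T; the regular module R^o makes it an lmodType over R. *)
Notation arc_space R T := {ffun edge T -> R^o}.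

Definition basis_vec (R : realType) (n : nat) (T : {set ngon_arc n}) (i j : 'I_n) :
    arc_space R T :=
  [ffun e : edge T => (ends (val e) == [set i; j]%SET)%:R].

Definition int_lattice (R : realType) (n : nat) (T : {set ngon_arc n}) :
    set (arc_space R T) :=
  [set m | forall e, m e \is a Num.int].
Arguments int_lattice R {n} T.

Definition shear (R : realType) (n : nat) (T : {set ngon_arc n}) (ac : edge T)
    (a b c d : 'I_n) (m : arc_space R T) : arc_space R T :=
  let f := @basis_vec R n T in
  if m ac <= 0 then m
  else m + (m ac : R) *: (- f a b - f c d + f a d + f b c).

Definition unimodular (R : realType) (n : nat) (T : {set ngon_arc n})
    (M : 'M[int]_(rk n, #|ngon_arc n|))
    (phi : {linear 'cV[R]_(rk n) -> arc_space R T}) : Prop :=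
  bijective phi /\ phi @` lattice_hull (values R M) = int_lattice R T.

(* Main.v *)
Require Import Defs.
From HB Require Import structures.
From mathcomp Require Import all_boot all_order all_algebra.
From mathcomp Require Import complex.
From mathcomp Require Import boolp classical_sets reals topology normedtype.
From mathcomp Require Import -(notations) mpoly.
From mathcomp Require Import zify ring lra.

Set Implicit Arguments.
Unset Strict Implicit.
Unset Printing Implicit Defensive.

Import Order.TTheory GRing.Theory Num.Theory.
Import numFieldNormedType.Exports.

Local Open Scope classical_set_scope.
Local Open Scope ring_scope.

Local Notation "m1 +m m2" := (mnm_add m1 m2) (at level 50, left associativity).

(** Fix the vertex [o] numbered 0. In a Pluecker relation that involves [o], the
    minimum of the three weights is attained twice when the initial ideal contains
    no monomial; hence a weight [w] of the tropical variety makes the numbers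
    [delta o w i j] an ultrametric on the other leaves, that is, a rooted tree
    (Trop_ultrametric), and the closed cone of [w] consists of metrics of
    contractions of this tree (groebner_cone_tree_cone). By a count of branching
    points, the metrics of one tree span a space of dimension at most [2n-3], and
    the tree is trivalent when they span that many (kruskal, Delta_resolved). The
    trees of two cones that share a facet thus have a common contraction along
    one edge.

    If the two trees resolve all triples of leaves in the same way, the two initial
    ideals contain the same binomials; being prime, they coincide (same_tree_sub),
    and the cones are equal. This contradicts that the intersection is a facet. So
    some triple [p], [q], [s] is resolved as [pq] against [s] by one tree, and as
    [qs] against [p] by the other. The contracted edge ends up at the branching
    point of this triple, whose four branches are numbered 0 (towards the root),
    1, 2, 3 (towards [p], [q], [s]). The two trees are the two planar ways to
    resolve this point, so that they differ as two triangulations that differ by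
    a flip. This is made explicit on the columns of the two matrices: there are a
    matrix [Psi] and a vector [v] such that the column of [M2] at a pair of leaves
    is [Psi] times that of [M1], plus [v] if the pair lies in the opposite
    branches 0 and 2 (flip_matrix), and there is a linear form [ell] with value 1
    on the columns of [M2] for the opposite branches 0 and 2, with value -1 for 1
    and 3, and with value 0 elsewhere (flip_functional).

    The value semigroup is generated by the columns of the matrix, hence the body
    is the section at height 1 of the cone over these columns. For a variable,
    one has to show that no representative of its class has only terms of higher
    value: a point of the Grassmannian over the polynomials in one variable, with
    coordinates whose orders of vanishing are prescribed by the tree, detects a
    term of low weight (congruent_term, column_value).

    Both bodies become conic combinations of two families of vectors. Take a
    combination of the columns of [Psi M1], where [ell] is the mass on the
    branches 02 minus the mass on the branches 13. Passing to the columns of [M2]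
    adds the mass on 02 times [v]. A pair of columns for 02 and 13 can be exchanged
    for another pair of columns with sum smaller by [v], so that the smaller of the
    two masses can be subtracted again, and altogether the positive part of [ell]
    times [v] has been added (pl_shear_cone). This is the shear map once a basis of
    the lattice is chosen for which [ell] is the coordinate of the diagonal and
    [v] the combination of the sides of the quadrilateral; such a basis can be
    indexed by the arcs of the triangulation of the polygon by the diagonals at
    vertex 0 (fan_basis). *)

(** * Initial ideals and their homogeneous components *)

Section IdealGen.
Variables (A : comNzRingType) (G : set A).

Lemma ideal_gen0 : ideal_gen G 0.
Proof.
by exists 0%N, (fun i => 0), (fun i => 0); split; [case | rewrite big_ord0].
Qed.

Lemma ideal_gen_mem g : G g -> ideal_gen G g.
Proof.
move=> Gg; exists 1%N, (fun=> 1), (fun=> g); split=> //.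
by rewrite big_ord1 mul1r.
Qed.

Lemma ideal_genD f g : ideal_gen G f -> ideal_gen G g -> ideal_gen G (f + g).
Proof.
move=> [k [a [x [Gx ->]]]] [l [b [y [Gy ->]]]].
exists (k + l)%N, (fun i => match split i with inl u => a u | inr v => b v end),
  (fun i => match split i with inl u => x u | inr v => y v end).
split; first by move=> i; case: (split i).
rewrite big_split_ord /=; congr (_ + _); apply: eq_bigr => i _.
  by rewrite (unsplitK (inl i)).
by rewrite (unsplitK (inr i)).
Qed.

Lemma ideal_genM c f : ideal_gen G f -> ideal_gen G (c * f).
Proof.
move=> [k [a [x [Gx ->]]]]; exists k, (fun i => c * a i), x; split=> //.
by rewrite mulr_sumr; apply: eq_bigr => i _; rewrite mulrA.
Qed.

Lemma ideal_genB f g : ideal_gen G f -> ideal_gen G g -> ideal_gen G (f - g).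
Proof. by move=> Gf Gg; rewrite -mulN1r; apply/ideal_genD/ideal_genM. Qed.

End IdealGen.

Section InitialIdeals.
Variables (R : realType) (N : nat).
Local Notation S := (mpoly N R[i]).
Implicit Types (w u : 'rV[R]_N) (f g : S) (m : multinom N) (J : set S).

Lemma weightD w m1 m2 : weight w (m1 +m m2) = weight w m1 + weight w m2.
Proof.
by rewrite -big_split /=; apply: eq_bigr => i _; rewrite mnmDE natrD mulrDr.
Qed.

Definition restrict (P : pred (multinom N)) f : S :=
  \sum_(m <- msupp f | P m) mcoeff m f *: mpolyX _ m.

Lemma mcoeff_restrict P f m :
  mcoeff m (restrict P f) = if P m then mcoeff m f else 0.
Proof.
rewrite /restrict raddf_sum /=.
have [mf|mf] := boolP (m \in msupp f); last first.
  rewrite big1_seq ?(memN_msupp_eq0 mf) ?if_same// => m' /andP[_ m'f].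
  rewrite mcoeffZ mcoeffX; case: eqP => [m'm|_]; last by rewrite mulr0.
  by rewrite m'm in m'f; rewrite m'f in mf.
rewrite big_mkcond (bigD1_seq m) ?msupp_uniq//= big1 => [|m' /negPf m'm].
  by case: ifP => _; rewrite addr0// mcoeffZ mcoeffX eqxx mulr1.
by case: ifP => // _; rewrite mcoeffZ mcoeffX m'm mulr0.
Qed.

Lemma msupp_restrict P f m : (m \in msupp (restrict P f)) = P m && (m \in msupp f).
Proof. by rewrite !mcoeff_msupp mcoeff_restrict; case: (P m); rewrite ?eqxx. Qed.

Lemma restrict_sum P (I : Type) (r : seq I) (F : I -> S) :
  restrict P (\sum_(i <- r) F i) = \sum_(i <- r) restrict P (F i).
Proof.
apply/mpolyP => m; rewrite mcoeff_restrict !raddf_sum/=.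
under [RHS]eq_bigr do rewrite mcoeff_restrict.
by case: (P m); rewrite // big1.
Qed.

Definition component w (c : R) f := restrict (fun m => weight w m == c) f.

Lemma component_mul w c d f g : (forall m, m \in msupp g -> weight w m = c) ->
  component w d (f * g) = component w (d - c) f * g.
Proof.
move=> gc; have monE (a : R[i]) m1 (m2 : multinom N) : m2 \in msupp g ->
    component w d ((a *: mpolyX _ m1) * (mcoeff m2 g *: mpolyX _ m2)) =
    component w (d - c) (a *: mpolyX _ m1) * (mcoeff m2 g *: mpolyX _ m2).
  move=> m2g; rewrite -scalerAl -scalerAr scalerA -mpolyXD.
  have compX e (b : R[i]) m : component w e (b *: mpolyX _ m) =
      if weight w m == e then b *: mpolyX _ m else 0.
    apply/mpolyP => m'; rewrite mcoeff_restrict (fun_if (mcoeff m')) mcoeff0.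
    rewrite mcoeffZ mcoeffX; have [->|_] := eqVneq m m'; first by [].
    by rewrite mulr0 !if_same.
  rewrite !compX weightD (gc _ m2g) -(inj_eq (addIr c) _ (d - c)) subrK.
  by case: ifP => _; rewrite ?mul0r// -scalerAl -scalerAr scalerA -mpolyXD.
rewrite [f in LHS]mpolyE [g in LHS]mpolyE mulr_suml /component restrict_sum.
rewrite [f in RHS]mpolyE restrict_sum mulr_suml; apply: eq_bigr => m1 _.
rewrite mulr_sumr restrict_sum [g in RHS]mpolyE mulr_sumr.
by rewrite !big_seq; apply: eq_bigr => m2 m2g; apply: monE.
Qed.

Lemma init_form_restrict w f : init_form w f =
  restrict (fun m => all (fun m' => weight w m <= weight w m') (msupp f)) f.
Proof. by []. Qed.

Lemma init_formP w f m : (m \in msupp (init_form w f)) <->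
  m \in msupp f /\ forall m', m' \in msupp f -> weight w m <= weight w m'.
Proof.
rewrite init_form_restrict msupp_restrict andbC; split.
  by move=> /andP[mf /allP mm].
by move=> [-> mm]; apply/allP.
Qed.

(** The generators are homogeneous for [w], so that taking a component only
    truncates their coefficients. *)
Lemma init_ideal_component w J c f :
  init_ideal w J f -> init_ideal w J (component w c f).
Proof.
move=> [k [a [g [Jg ->]]]]; rewrite /component restrict_sum.
have /choice[e ge] i : exists e, forall m, m \in msupp (g i) -> weight w m = e.
  have [h Jh <-] := Jg i; case: (pselect (exists m, m \in msupp (init_form w h))).
    move=> [m /init_formP[mh mm]]; exists (weight w m) => m' /init_formP[m'h m'm].
    by apply/eqP; rewrite eq_le mm ?m'm.
  by move=> no; exists 0 => m mh; case: no; exists m.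
exists k, (fun i => component w (c - e i) (a i)), g; split=> //.
by apply: eq_bigr => i _; exact: (component_mul _ _ (ge i)).
Qed.

(** An ideal that is initial for every weight of [U] is spanned by polynomials
    homogeneous for all of them; when it contains no monomial, such a
    homogeneous component of one of its elements has at least two terms. *)
Lemma monomial_partner J (U : set 'rV[R]_N) f m0 :
  (forall u, U u -> exists J', J = init_ideal u J') ->
  (forall m, ~ J (mpolyX _ m)) -> (exists G, J = ideal_gen G) ->
  J f -> m0 \in msupp f ->
  exists m1, [/\ m1 \in msupp f, m1 != m0 & forall u, U u -> weight u m1 = weight u m0].
Proof.
move=> JU Jmon [G JG] Jf m0f; apply: contrapT => no.
have sep m : m \in msupp f -> m != m0 -> exists2 u, U u & weight u m != weight u m0.
  move=> mf mm0; apply: contrapT => nosep; apply: no; exists m; split=> // u Uu.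
  by apply/eqP; apply: contrapT => /negP neq; apply: nosep; exists u.
suff filt (s : seq (multinom N)) : {subset s <= msupp f} -> exists g,
    [/\ J g, mcoeff m0 g = mcoeff m0 f, {subset msupp g <= msupp f}
      & forall m, m \in s -> m \in msupp g -> m = m0].
  have [g [Jg gm0 gf gs]] := filt (msupp f) (fun=> id).
  have gE : g = mcoeff m0 f *: mpolyX _ m0.
    apply/mpolyP => m; rewrite mcoeffZ mcoeffX; have [<-|m0m] := eqVneq m0 m.
      by rewrite mulr1.
    rewrite mulr0; apply: memN_msupp_eq0; apply: contra m0m => mg.
    by rewrite (gs m (gf _ mg) mg).
  apply: (Jmon m0); rewrite JG in Jg *.
  have -> : mpolyX R[i] m0 = mpolyC N (mcoeff m0 f)^-1 * g.
    rewrite gE mul_mpolyC scalerA mulVf ?scale1r//.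
    by rewrite -mcoeff_msupp.
  exact: ideal_genM.
elim: s => [|m s IHs] ms; first by exists f; split.
have [g [Jg gm0 gf gs]] := IHs (fun m' m's => ms m' (mem_behead (s := m :: s) m's)).
have [->|mm0] := eqVneq m m0.
  exists g; split=> // m'; rewrite inE => /predU1P[->//|m's]; exact: gs.
have [u Uu um] := sep m (ms m (mem_head _ _)) mm0.
exists (component u (weight u m0) g); split.
- by have [J' JJ'] := JU u Uu; rewrite JJ' in Jg *; apply: init_ideal_component.
- by rewrite mcoeff_restrict eqxx.
- by move=> m'; rewrite msupp_restrict => /andP[_ /gf].
- move=> m'; rewrite inE msupp_restrict => /predU1P[->|m's].
    by rewrite (negPf um).
  by move=> /andP[_ /(gs _ m's)].
Qed.

End InitialIdeals.

(** * Pairs of leaves, and weights seen as tree metrics *)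

Section PairMonomials.
Variable n : nat.
Local Notation N := #|ngon_arc n|.

Definition pair_mnm (i j : 'I_n) : multinom N :=
  oapp (fun e : ngon_arc n => mnm1 (enum_rank e)) (@mnm0 N)
    (insub (if (i < j)%N then (i, j) else (j, i))).

Lemma pair_mnmC i j : pair_mnm i j = pair_mnm j i.
Proof.
rewrite /pair_mnm; case: (ltngtP i j) => // ij.
by rewrite (val_inj ij : i = j).
Qed.

Lemma pair_mnm_lt (i j : 'I_n) (ij : (i < j)%N) :
  pair_mnm i j = mnm1 (enum_rank (exist _ (i, j) ij : ngon_arc n)).
Proof.
rewrite /pair_mnm ij; case: insubP => [u _ uij|]; last by rewrite /= ij.
by congr (mnm1 (enum_rank _)); apply: val_inj.
Qed.

Lemma mnm1_pair (e : 'I_N) : exists i j, i != j /\ mnm1 e = pair_mnm i j.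
Proof.
case E : (enum_val e) => [[i j] /= ij]; exists i, j; split.
  by move: (ij); apply: contraTneq => ->; rewrite ltnn.
by rewrite pair_mnm_lt -[e]enum_valK E.
Qed.

Lemma pair_mnmE i j : i != j -> exists2 e : 'I_N, pair_mnm i j = mnm1 e &
  ends (enum_val e) = [set i; j]%SET.
Proof.
case: (ltngtP i j) => [ij|ji|/val_inj->]; last by rewrite eqxx.
  by exists (enum_rank (exist _ (i, j) ij : ngon_arc n)); rewrite ?pair_mnm_lt ?enum_rankK.
exists (enum_rank (exist _ (j, i) ji : ngon_arc n)); first by rewrite pair_mnmC pair_mnm_lt.
by rewrite enum_rankK /ends /= finset.setUC.
Qed.

Lemma pair_mnm_cross i j k l : uniq [:: i; j; k; l] ->
  mnm_add (pair_mnm i j) (pair_mnm k l) != mnm_add (pair_mnm i k) (pair_mnm j l).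
Proof.
rewrite /= !inE !negb_or -!andbA => /and5P[ij ik il jk /and3P[jl kl _]].
have [e1 -> E1] := pair_mnmE ij; have [e2 -> E2] := pair_mnmE kl.
have [e3 -> E3] := pair_mnmE ik; have [e4 -> E4] := pair_mnmE jl.
apply/eqP => /mnmP /(_ e1); rewrite !mnmDE !mnm1E eqxx.
have neq (e e' : 'I_N) x : ends (enum_val e) = [set i; j]%SET -> x \in ends (enum_val e') ->
    x != i -> x != j -> (e' == e) = false.
  move=> Ee xe xi xj; apply/eqP => ee; rewrite ee Ee !inE in xe.
  by rewrite (negPf xi) (negPf xj) in xe.
rewrite (neq _ e3 k)// ?E3 ?inE ?eqxx ?orbT//; [|by rewrite eq_sym|by rewrite eq_sym].
by rewrite (neq _ e4 l)// ?E4 ?inE ?eqxx ?orbT// eq_sym.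
Qed.

End PairMonomials.

Section TreeMetrics.
Variables (R : realType) (n : nat) (o : 'I_n).
Local Notation N := #|ngon_arc n|.
Local Notation pm := (@pair_mnm n).
Implicit Types (w u x : 'rV[R]_N) (i j k l : 'I_n).

(** When [w] is minus a tree metric, this is twice the distance of the root [o]
    from the point where the paths from [o] to [i] and to [j] separate, that is,
    twice a Gromov product. *)
Definition delta w i j := weight w (pm i j) - weight w (pm o i) - weight w (pm o j).

Lemma deltaC w i j : delta w i j = delta w j i.
Proof. by rewrite /delta pair_mnmC addrAC. Qed.

Definition triple i j k := [&& i != o, j != o, k != o, i != j, i != k & j != k].

Lemma tripleP i j k : triple i j k ->
  [/\ [/\ i != o, j != o & k != o], i != j, i != k & j != k].
Proof. by move=> /and5P[-> -> -> -> /andP[-> ->]]. Qed.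

Lemma tripleC12 i j k : triple i j k = triple j i k.
Proof.
rewrite /triple [j == i]eq_sym.
by case: (i == o); case: (j == o); case: (k == o); case: (i == j); case: (i == k); case: (j == k).
Qed.

Lemma tripleC23 i j k : triple i j k = triple i k j.
Proof.
rewrite /triple [k == j]eq_sym.
by case: (i == o); case: (j == o); case: (k == o); case: (i == j); case: (i == k); case: (j == k).
Qed.

(** The leaves [i] and [j] branch off the root together before [k] does; the
    three may also branch at the same point. *)
Definition cherry w i j k := delta w i k = delta w j k /\ delta w i k <= delta w i j.

Lemma cherryC w i j k : cherry w i j k -> cherry w j i k.
Proof. by move=> [e l]; split; rewrite -e// [delta w j i]deltaC. Qed.

Definition ultrametric w := forall i j k, triple i j k ->
  [\/ cherry w i j k, cherry w i k j | cherry w j k i].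

(** When [w] is an ultrametric, these are the metrics of the contractions of its
    tree. *)
Definition tree_cone w x := forall i j k, triple i j k -> cherry w i j k -> cherry x i j k.

(** For an ultrametric [w], these are the equations of the linear span of
    [tree_cone w]: the value at a pair of leaves
    depends only on the point where
    the two branch. *)
Definition adapted w x := forall i j k, triple i j k ->
  cherry w i j k -> delta x i k = delta x j k.

Lemma tree_cone_adapted w x : tree_cone w x -> adapted w x.
Proof. by move=> wx i j k t /(wx _ _ _ t)[]. Qed.

Lemma tree_cone_ultrametric w x : ultrametric w -> tree_cone w x -> ultrametric x.
Proof.
move=> uw wx i j k t; have [c|c|c] := uw i j k t.
- exact/Or31/wx.
- by apply/Or32/wx => //; rewrite tripleC23.
- by apply/Or33/wx => //; rewrite tripleC23 tripleC12.
Qed.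

Lemma ultrametric_min w i j k : ultrametric w -> triple i j k ->
  Num.min (delta w i j) (delta w j k) <= delta w i k.
Proof.
move=> uw t; rewrite ge_min; have [[e l]|[e l]|[e l]] := uw i j k t.
- by rewrite e lexx orbT.
- by rewrite l.
- by rewrite [delta w i j]deltaC e (deltaC w k i) lexx.
Qed.

Lemma weight_pair_add w i j k : weight w (mnm_add (pm o k) (pm i j)) = delta w i j +
  (weight w (pm o i) + weight w (pm o j) + weight w (pm o k)).
Proof. by rewrite weightD /delta; ring. Qed.

End TreeMetrics.

(** * The weights with a given initial ideal *)

Section InitialWeights.
Variables (R : realType) (n : nat) (o : 'I_n).
Hypothesis o0 : o = 0%N :> nat.
Local Notation N := #|ngon_arc n|.
Local Notation pm := (@pair_mnm n).
Local Notation I := (I2 R n).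
Implicit Types (w u x : 'rV[R]_N) (i j k l : 'I_n).

Lemma pvar_pair i j : (i < j)%N -> pvar R i j = mpolyX _ (pm i j).
Proof. by move=> ij; rewrite /pvar /pair_mnm ij; case: insubP => //=; rewrite ij. Qed.

Definition triple_mnms i j k : seq (multinom N) :=
  [:: mnm_add (pm o k) (pm i j); mnm_add (pm o j) (pm i k); mnm_add (pm o i) (pm j k)].

Lemma triple_mnms_uniq i j k : triple o i j k -> uniq (triple_mnms i j k).
Proof.
move=> /tripleP[[io jo ko] ij ik jk]; rewrite /= !inE negb_or.
have dist a b c : a != o -> b != o -> c != o -> a != b -> a != c -> b != c ->
    mnm_add (pm o a) (pm b c) != mnm_add (pm o b) (pm a c).
  move=> ao bo co ab ac bc; apply: pair_mnm_cross.
  by rewrite /= !inE !negb_or !(eq_sym o) ao bo co ab ac bc.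
have d12 := dist k j i ko jo io; rewrite (eq_sym k j) (eq_sym k i) (eq_sym j i) in d12.
have d13 := dist k i j ko io jo; rewrite (eq_sym k i) (eq_sym k j) in d13.
have d23 := dist j i k jo io ko; rewrite (eq_sym j i) in d23.
rewrite (pair_mnmC j i) (pair_mnmC k i) in d12; rewrite (pair_mnmC k j) in d13.
by rewrite d12 ?d13 ?d23.
Qed.

Lemma pluecker_trinomial i j k : triple o i j k ->
  exists2 f, I f & msupp f =i triple_mnms i j k.
Proof.
wlog lt : i j k / (i < j < k)%N => [W t|].
  have [[io jo ko] ij ik jk] := tripleP t.
  have WW (a b c : 'I_n) : (a < b < c)%N -> triple o a b c ->
      triple_mnms a b c =i triple_mnms i j k ->
      exists2 f, I f & msupp f =i triple_mnms i j k.
    move=> abc tabc p; have [f If fE] := W a b c abc tabc.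
    by exists f => // m; rewrite fE p.
  have t' (a b c : 'I_n) : a != o -> b != o -> c != o -> a != b -> a != c -> b != c -> triple o a b c.
    by rewrite /triple => -> -> -> -> -> ->.
  have eqs := (pair_mnmC j i, pair_mnmC k i, pair_mnmC k j).
  have [lij|lij|lij] := ltngtP i j; last by rewrite (val_inj lij) eqxx in ij.
  - have [ljk|ljk|ljk] := ltngtP j k; last by rewrite (val_inj ljk) eqxx in jk.
      by apply: (WW i j k) => //; rewrite lij.
    have [lik|lik|lik] := ltngtP i k; last by rewrite (val_inj lik) eqxx in ik.
      apply: (WW i k j); [by rewrite lik|by apply: t'; rewrite // eq_sym|].
      by move=> m; rewrite !inE !eqs; do 3 case: (m == _).
    apply: (WW k i j); [by rewrite lik|by apply: t'; rewrite // eq_sym|].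
    by move=> m; rewrite !inE !eqs; do 3 case: (m == _).
  - have [lik|lik|lik] := ltngtP i k; last by rewrite (val_inj lik) eqxx in ik.
      apply: (WW j i k); [by rewrite lij|by apply: t'; rewrite // eq_sym|].
      by move=> m; rewrite !inE !eqs; do 3 case: (m == _).
    have [ljk|ljk|ljk] := ltngtP j k; last by rewrite (val_inj ljk) eqxx in jk.
      apply: (WW j k i); [by rewrite ljk|by apply: t'; rewrite // eq_sym|].
      by move=> m; rewrite !inE !eqs; do 3 case: (m == _).
    apply: (WW k j i); [by rewrite ljk|by apply: t'; rewrite // eq_sym|].
    by move=> m; rewrite !inE !eqs; do 3 case: (m == _).
move=> t; have /andP[ij jk] := lt; have [[io jo ko] _ _ _] := tripleP t.
have oi : (o < i)%N by rewrite o0 lt0n; apply: contra io => /eqP i0; apply/eqP/val_inj; rewrite /= o0.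
have := triple_mnms_uniq t.
rewrite /= !inE negb_or => /and3P[/andP[m12 m13] m23 _].
exists (pvar R o i * pvar R j k - pvar R o j * pvar R i k + pvar R o k * pvar R i j).
  apply: ideal_gen_mem; exists o, i, j, k; split; first by rewrite oi.
  by [].
have [oj ik] := (ltn_trans oi ij, ltn_trans ij jk).
have ok := ltn_trans oj jk; move=> m; rewrite !pvar_pair //.
rewrite -!mpolyXD mcoeff_msupp mcoeffD mcoeffB !mcoeffX !inE ![m == _]eq_sym.
have [<-|n3] := eqVneq (mnm_add (pm o i) (pm j k)) m.
  by rewrite (negPf m13) (negPf m23) subr0 addr0 oner_eq0 !orbT.
have [<-|n2] := eqVneq (mnm_add (pm o j) (pm i k)) m.
  by rewrite (negPf m12) sub0r addr0 oppr_eq0 oner_eq0 !orbT.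
by rewrite subrr add0r pnatr_eq0; case: (_ == m).
Qed.

Lemma delta_sum w i j k :
  (weight w (mnm_add (pm o k) (pm i j)) = delta o w i j + (weight w (pm o i) + weight w (pm o j) + weight w (pm o k))) *
  (weight w (mnm_add (pm o j) (pm i k)) = delta o w i k + (weight w (pm o i) + weight w (pm o j) + weight w (pm o k))) *
  (weight w (mnm_add (pm o i) (pm j k)) = delta o w j k + (weight w (pm o i) + weight w (pm o j) + weight w (pm o k))).
Proof. by split; [split|]; rewrite weight_pair_add; ring. Qed.

Section SameInitialIdeal.
Variables (w u : 'rV[R]_N).
Hypotheses (Tw : Trop I w) (uw : init_ideal u I = init_ideal w I).

Lemma same_init_partner v i j k : v = w \/ v = u -> triple o i j k ->
  forall m0, m0 \in triple_mnms i j k ->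
    (forall m, m \in triple_mnms i j k -> weight v m0 <= weight v m) ->
  exists m1, [/\ m1 \in triple_mnms i j k, m1 != m0, weight v m1 = weight v m0
    & weight u m1 = weight u m0].
Proof.
move=> vwu t m0 m0f m0min; have [f If fE] := pluecker_trinomial t.
have vI : init_ideal v I = init_ideal w I by case: vwu => ->.
have [|||||m1 [m1f m10 eqs]] := @monomial_partner _ _ (init_ideal v I)
  [set x | x = v \/ x = u] (init_form v f) m0.
- by move=> x [->|->]; exists I; rewrite ?vI ?uw.
- by rewrite vI; apply: Tw.
- by eexists.
- by apply: ideal_gen_mem; exists f.
- by apply/init_formP; split=> [|m]; rewrite fE//; apply: m0min.
move: m1f => /init_formP[]; rewrite fE => m1f _.
by exists m1; split=> //; apply: eqs; [left|right].
Qed.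

(** The initial form of a Pluecker relation lies in an ideal that contains no
    monomial and is homogeneous for both weights, so that a term of minimal
    weight has a partner of equal weight for [v] and for [u]. *)
Lemma same_init_min v i j k : v = w \/ v = u -> triple o i j k ->
  [/\ delta o v i j <= delta o v i k -> delta o v i j <= delta o v j k ->
    delta o v i k = delta o v i j /\ delta o u i k = delta o u i j \/
    delta o v j k = delta o v i j /\ delta o u j k = delta o u i j,
    delta o v i k <= delta o v i j -> delta o v i k <= delta o v j k ->
    delta o v i j = delta o v i k /\ delta o u i j = delta o u i k \/
    delta o v j k = delta o v i k /\ delta o u j k = delta o u i k &
    delta o v j k <= delta o v i k -> delta o v j k <= delta o v i j ->
    delta o v i k = delta o v j k /\ delta o u i k = delta o u j k \/
    delta o v i j = delta o v j k /\ delta o u i j = delta o u j k].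
Proof.
move=> vwu t; have P := same_init_partner vwu t.
have [[v1 v2] v3] := delta_sum v i j k; have [[u1 u2] u3] := delta_sum u i j k.
have eqc (a b c : R) : a + c = b + c -> a = b by move/addIr.
split=> l1 l2.
- case: (P (mnm_add (pm o k) (pm i j))); rewrite ?inE ?eqxx ?orbT//.
    by move=> m; rewrite !inE => /or3P[] /eqP->; rewrite ?v1 ?v2 ?v3 lerD2r.
  move=> m1; rewrite !inE => -[/or3P[] /eqP->]; rewrite ?eqxx ?u1 ?u2 ?u3 ?v1 ?v2 ?v3//.
    by move=> _ /eqc-> /eqc->; left.
  by move=> _ /eqc-> /eqc->; right.
- case: (P (mnm_add (pm o j) (pm i k))); rewrite ?inE ?eqxx ?orbT//.
    by move=> m; rewrite !inE => /or3P[] /eqP->; rewrite ?v1 ?v2 ?v3 lerD2r.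
  move=> m1; rewrite !inE => -[/or3P[] /eqP->]; rewrite ?eqxx ?u1 ?u2 ?u3 ?v1 ?v2 ?v3//.
    by move=> _ /eqc-> /eqc->; left.
  by move=> _ /eqc-> /eqc->; right.
- case: (P (mnm_add (pm o i) (pm j k))); rewrite ?inE ?eqxx ?orbT//.
    by move=> m; rewrite !inE => /or3P[] /eqP->; rewrite ?v1 ?v2 ?v3 lerD2r.
  move=> m1; rewrite !inE => -[/or3P[] /eqP->]; rewrite ?eqxx ?u1 ?u2 ?u3 ?v1 ?v2 ?v3//.
    by move=> _ /eqc-> /eqc->; right.
  by move=> _ /eqc-> /eqc->; left.
Qed.

Lemma same_init_tree_cone : tree_cone o w u.
Proof.
move=> i j k t [wik wij].
have [_ w2 w3] := same_init_min (or_introl erefl) t.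
have [u1 u2 u3] := same_init_min (or_intror erefl) t.
rewrite /cherry; move: (delta o w i j) (delta o w i k) (delta o w j k) wik wij w2 w3.
move: (delta o u i j) (delta o u i k) (delta o u j k) u1 u2 u3.
move=> a b c u1 u2 u3 A B C wik wij w2 w3.
suff bc : b = c.
  split=> //; rewrite leNgt; apply/negP => ab.
  by case: u1; rewrite -?bc ?(ltW ab)// => -[e _]; rewrite e ltxx in ab.
(* If the partner of the term [ik] is the term [ij], all three are tied for [w],
   and the partner of the term [jk] is used. *)
have : B <= C by rewrite wik.
case/w2 => // [[AB ab]|[]//].
case: w3; rewrite -?wik// ?AB// => -[_]; first by [].
by rewrite -ab => ->.
Qed.

End SameInitialIdeal.

(** The relations that involve [o] give the four-point condition of a tree. *)
Lemma Trop_ultrametric w : Trop I w -> ultrametric o w.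
Proof.
move=> Tw i j k t; have [h1 h2 h3] := same_init_min Tw erefl (or_introl erefl) t.
rewrite /cherry ![delta o w k _]deltaC ![delta o w j i]deltaC.
move: (delta o w i j) (delta o w i k) (delta o w j k) h1 h2 h3 => a b c h1 h2 h3.
have [ab|ba] := orP (le_total a b).
  have [ac|ca] := orP (le_total a c).
    by case: (h1 ab ac) => -[e _]; rewrite e; [apply: Or33|apply: Or32].
  have cb := le_trans ca ab; by case: (h3 cb ca) => -[e _]; rewrite e; [apply: Or31|apply: Or32].
have [bc|cb] := orP (le_total b c).
  by case: (h2 ba bc) => -[e _]; rewrite e; [apply: Or33|apply: Or31].
have ca := le_trans cb ba; by case: (h3 cb ca) => -[e _]; rewrite e; [apply: Or31|apply: Or32].
Qed.

Lemma weight_continuous m : continuous (fun u : 'rV[R]_N => weight u m).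
Proof.
move=> u; apply: (@cvg_big _ _ +%R 0 xpredT); [exact: add_continuous|exact: nbhs_filter|].
move=> i _; apply: cvgM; first exact: nbhs_filter.
  exact: coord_continuous.
exact: (@cvg_cst _ _ _ _ (nbhs_filter u)).
Qed.

Lemma closure_ge0 (U : set 'rV[R]_N) (phi : 'rV[R]_N -> R) x : continuous phi ->
  (forall u, U u -> 0 <= phi u) -> closure U x -> 0 <= phi x.
Proof.
move=> phic phiU Ux; have /continuous_closedP/(_ _ (@closed_ge R 0)) := phic.
by move=> /closure_id cl; have := closure_subset phiU Ux; rewrite -cl.
Qed.

Lemma closure_eq (U : set 'rV[R]_N) (phi psi : 'rV[R]_N -> R) x :
  continuous phi -> continuous psi ->
  (forall u, U u -> phi u = psi u) -> closure U x -> phi x = psi x.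
Proof.
move=> phic psic e Ux; apply/eqP; rewrite eq_le -subr_ge0 -[X in _ && X]subr_ge0.
apply/andP; split.
  apply: (closure_ge0 (phi := fun u => psi u - phi u) _ _ Ux) => [u|u /e->].
    exact: (cvgB (psic u) (phic u)).
  by rewrite subrr.
apply: (closure_ge0 (phi := fun u => phi u - psi u) _ _ Ux) => [u|u /e->].
  exact: (cvgB (phic u) (psic u)).
by rewrite subrr.
Qed.

Lemma groebner_cone_tree_cone w x : Trop I w -> groebner_cone I w x -> tree_cone o w x.
Proof.
move=> Tw wx; have cw := weight_continuous.
have cd i j : continuous (fun u : 'rV[R]_N => delta o u i j).
  by move=> u; exact: (cvgB (cvgB (cw _ u) (cw _ u)) (cw _ u)).
move=> i j k t c; split.
  by apply: (closure_eq (cd i k) (cd j k) _ wx) => u uw; have [] := same_init_tree_cone Tw uw t c.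
rewrite -subr_ge0; apply: (closure_ge0 (phi := fun u => delta o u i j - delta o u i k) _ _ wx).
  by move=> u; exact: (cvgB (cd _ _ u) (cd _ _ u)).
by move=> u uw; have [_] := same_init_tree_cone Tw uw t c; rewrite subr_ge0.
Qed.

End InitialWeights.

(** * Lattices spanned by finite families *)

Section LatticeHull.
Variables (V : zmodType) (A : set V).

Lemma lattice_hull_mem x : A x -> lattice_hull A x.
Proof.
by move=> Ax; exists 1%N, (fun=> 1), (fun=> x); split=> //; rewrite big_ord1 mulr1z.
Qed.

Lemma lattice_hull0 : lattice_hull A 0.
Proof. by exists 0%N, (fun=> 0), (fun=> 0); split; [case | rewrite big_ord0]. Qed.

Lemma lattice_hullD x y : lattice_hull A x -> lattice_hull A y -> lattice_hull A (x + y).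
Proof.
move=> [k [a [u [Au ->]]]] [l [b [v [Av ->]]]].
exists (k + l)%N, (fun i => match split i with inl j => a j | inr j => b j end),
  (fun i => match split i with inl j => u j | inr j => v j end).
split; first by move=> i; case: (split i).
rewrite big_split_ord /=; congr (_ + _); apply: eq_bigr => i _.
  by rewrite (unsplitK (inl i)).
by rewrite (unsplitK (inr i)).
Qed.

Lemma lattice_hullN x : lattice_hull A x -> lattice_hull A (- x).
Proof.
move=> [k [a [u [Au ->]]]]; exists k, (fun i => - a i), u; split=> //.
by rewrite -sumrN; apply: eq_bigr => i _; rewrite mulrNz.
Qed.

Lemma lattice_hullB x y : lattice_hull A x -> lattice_hull A y -> lattice_hull A (x - y).
Proof. by move=> hx hy; apply/lattice_hullD/lattice_hullN. Qed.

Lemma lattice_hull_ind (P : V -> Prop) x :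
  P 0 -> (forall y z, P y -> P z -> P (y - z)) -> (forall a, A a -> P a) ->
  lattice_hull A x -> P x.
Proof.
move=> P0 PB PA; have PN y : P y -> P (- y) by move=> Py; rewrite -sub0r; apply: PB.
have PD y z : P y -> P z -> P (y + z) by move=> Py Pz; rewrite -[z]opprK; apply/PB/PN.
move=> [k [c [u [Au ->]]]]; apply: (big_ind P) => // i _.
have Pn m : P (u i *+ m).
  by elim: m => // m IHm; rewrite mulrS; apply: PD => //; apply: PA.
by case: (c i) => m; rewrite ?NegzE ?mulrNz; [|apply: PN]; apply: Pn.
Qed.

End LatticeHull.

Section SeqMatrix.
Variables (R : realType) (d : nat).
Implicit Types (t : seq 'cV[R]_d).

Definition seq_mx t : 'M[R]_(d, size t) := \matrix_(i, r) nth 0 t r i 0.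

Lemma seq_mx_mul t (a : 'cV[R]_(size t)) :
  seq_mx t *m a = \sum_r a r 0 *: nth 0 t r.
Proof.
apply/colP => i; rewrite !mxE summxE; apply: eq_bigr => r _.
by rewrite !mxE mulrC.
Qed.

Lemma lattice_hull_seq t x : lattice_hull [set y | y \in t] x ->
  exists a : 'cV[int]_(size t), x = seq_mx t *m map_mx intr a.
Proof.
elim/lattice_hull_ind => [|_ _ [a ->] [b ->]|y yt].
- by exists 0; rewrite map_mx0 mulmx0.
- by exists (a - b); rewrite map_mxB mulmxBr.
have r_lt : (index y t < size t)%N by rewrite index_mem; exact: yt.
exists (delta_mx (Ordinal r_lt) 0).
rewrite seq_mx_mul (bigD1 (Ordinal r_lt))//= big1 => [|r /negPf rr].
  by rewrite !mxE !eqxx addr0 nth_index ?scale1r//; exact: yt.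
by rewrite !mxE rr scale0r.
Qed.

End SeqMatrix.

(** * Classes of pairs of leaves *)

Section Kruskal.
Variables (R : realType) (n : nat) (o : 'I_n).
Local Notation N := #|ngon_arc n|.

Definition covers (E : 'I_n * 'I_n -> 'I_n * 'I_n -> Prop)
    (s : seq ('I_n * 'I_n)) (Y : {set 'I_n}) :=
  forall i j, i \in Y -> j \in Y -> i != j -> exists2 p, p \in s & E (i, j) p.

(** One leaf after another is joined to the leaf already present with which it
    branches off latest. Each step creates at most one new branching point, so
    that the pairs of leaves fall into few classes. *)
Lemma kruskal (w : 'rV[R]_N) (E : 'I_n * 'I_n -> 'I_n * 'I_n -> Prop) :
  ultrametric o w ->
  (forall p, E p p) -> (forall p q, E p q -> E q p) ->
  (forall q p r, E p q -> E q r -> E p r) ->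
  (forall i j, E (i, j) (j, i)) ->
  (forall i j k, triple o i j k -> cherry o w i j k -> E (i, k) (j, k)) ->
  forall (Y : {set 'I_n}) s, o \notin Y -> Y != finset.set0 -> covers E s Y ->
  exists s', [/\ size s' = (n.-1 - #|Y|)%N,
    forall p, p \in s' -> [/\ p.1 != o, p.2 != o & p.1 != p.2]
    & covers E (s ++ s') [set~ o]%SET].
Proof.
move=> uw Er Es Er3 Ec Ew Y s oY Y0 cY.
have cX : #|[set~ o]%SET| = n.-1 by rewrite cardsC1 card_ord.
have YX (Z : {set 'I_n}) : o \notin Z -> Z \subset [set~ o]%SET.
  by move=> oZ; apply/fintype.subsetP => i iZ; rewrite !inE; apply: contraNneq oZ => <-.
have [r] := ubnP (n.-1 - #|Y|); elim: r => // r IHr in Y s oY Y0 cY *.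
rewrite ltnS => lr; have [XY|] := boolP ([set~ o]%SET \subset Y).
  have XE : Y = [set~ o]%SET by apply/eqP; rewrite finset.eqEsubset XY YX.
  by exists [::]; split=> //; [rewrite XE cX subnn | rewrite cats0 -XE].
move=> /fintype.subsetPn[j]; rewrite !inE => jo jY.
have [i0 i0Y] := finset.set0Pn _ Y0.
have [i iY imax] := @arg_maxP _ _ _ i0 (mem Y) (fun i => delta o w i j) i0Y.
have ij : i != j by apply: contraNneq jY => <-.
have nroot k : k \in Y -> k != o by move=> kY; apply: contraNneq oY => <-.
have cov k : k \in Y -> exists2 p, p \in rcons s (i, j) & E (k, j) p.
  move=> kY; have [->|ki] := eqVneq k i.
    by exists (i, j); rewrite ?mem_rcons ?mem_head.
  have kj : k != j by apply: contraNneq jY => <-.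
  have t : triple o i k j by rewrite /triple (nroot i iY) (nroot k kY) jo eq_sym ki ij kj.
  have late : cherry o w i k j -> exists2 p, p \in rcons s (i, j) & E (k, j) p.
    by move=> c; exists (i, j); rewrite ?mem_rcons ?mem_head//; apply/Es/Ew.
  have [c|c|[e l]] := uw i k j t; first exact: late.
    have [p ps Ep] := cY i k iY kY (introN eqP (fun ik => elimN eqP ki (esym ik))).
    exists p; first by rewrite mem_rcons inE ps orbT.
    apply: (Er3 _ _ _ (Ec _ _)); apply: (Er3 _ _ _ _ Ep); apply/Es/Ew => //.
    by rewrite tripleC23.
  apply: late; split; last by rewrite (deltaC o w i j) -e deltaC.
  by apply/eqP; rewrite eq_le [X in _ && X]imax// andbT (deltaC o w i j) -e.
have lt : (#|Y| < n.-1)%N.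
  rewrite -cX proper_card// finset.properEneq YX// andbT.
  by apply: contraNneq jY => ->; rewrite !inE.
have [s' [ss' s'o s'X]] : exists s', [/\ size s' = (n.-1 - #|j |: Y|)%N,
    forall p, p \in s' -> [/\ p.1 != o, p.2 != o & p.1 != p.2]
    & covers E (rcons s (i, j) ++ s') [set~ o]%SET].
  apply: IHr.
  - by rewrite !inE negb_or eq_sym jo.
  - by apply/finset.set0Pn; exists j; rewrite !inE eqxx.
  - move=> a b; rewrite !inE => /predU1P[->|aY] /predU1P[->|bY]; rewrite ?eqxx// => ab.
    + by have [p ps Ep] := cov b bY; exists p => //; apply: (Er3 _ _ _ (Ec _ _) Ep).
    + exact: cov.
    + by have [p ps Ep] := cY a b aY bY ab; exists p => //; rewrite mem_rcons inE ps orbT.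
  - by rewrite cardsU1 jY add1n; move: lr lt; lia.
exists ((i, j) :: s'); rewrite -cat_rcons; split=> //.
  by rewrite /= ss' cardsU1 jY add1n subnS prednK ?subn_gt0.
by move=> p; rewrite inE => /predU1P[->/=|/s'o//]; split=> //; exact: nroot.
Qed.

End Kruskal.

Section Classes.
Variables (R : realType) (n : nat) (o : 'I_n).
Local Notation N := #|ngon_arc n|.
Local Notation pm := (@pair_mnm n).

Section Columns.
Variables (d : nat) (M : 'M[R]_(d, N)).

Definition mval (m : multinom N) : 'cV[R]_d := M *m \col_i (m i)%:R.

Lemma mvalD m1 m2 : mval (mnm_add m1 m2) = mval m1 + mval m2.
Proof.
rewrite -mulmxDr; congr (_ *m _); apply/colP => i.
by rewrite !mxE mnmDE natrD.
Qed.

Lemma mvalE m k : mval m k 0 = weight (row k M) m.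
Proof. by rewrite mxE; apply: eq_bigr => i _; rewrite !mxE. Qed.

Lemma mval_mnm1 e : mval (mnm1 e) = col e M.
Proof.
apply/colP => i; rewrite !mxE (bigD1 e)//= big1 => [|k /negPf ke].
  by rewrite !mxE mnm1E eqxx mulr1 addr0.
by rewrite !mxE mnm1E eq_sym ke mulr0.
Qed.

Lemma mval_sum m : mval m = \sum_e mval (mnm1 e) *+ m e.
Proof.
apply/colP => i; rewrite summxE mxE; apply: eq_bigr => e _.
by rewrite mval_mnm1 mulmxnE !mxE mulr_natr.
Qed.

Definition Delta i j := mval (pm i j) - mval (pm o i) - mval (pm o j).

Lemma DeltaC i j : Delta i j = Delta j i.
Proof. by rewrite /Delta pair_mnmC addrAC. Qed.

Lemma DeltaE i j k : Delta i j k 0 = delta o (row k M) i j.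
Proof. by rewrite /delta -!mvalE /Delta; move: (mval _) (mval _) (mval _) => x y z; rewrite !mxE. Qed.

Definition rows_adapted (w : 'rV[R]_N) := forall k, adapted o w (row k M).

Lemma cherry_Delta w i j k : rows_adapted w -> triple o i j k -> cherry o w i j k ->
  Delta i k = Delta j k.
Proof. by move=> ad t c; apply/colP => r; rewrite !DeltaE; apply: ad c. Qed.

Definition Delta_in (t : seq 'cV[R]_d) (Y : {set 'I_n}) :=
  forall i j, i \in Y -> j \in Y -> i != j -> Delta i j \in t.

(** The leaves of [Y] have their branching points in [t]; each further leaf
    contributes at most one more. *)
Lemma Delta_cover w (Y : {set 'I_n}) t : ultrametric o w -> rows_adapted w ->
  o \notin Y -> Y != finset.set0 -> Delta_in t Y ->
  exists t', [/\ size t' = (n.-1 - #|Y|)%N,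
    forall y, y \in t' -> exists i j, [/\ i != o, j != o, i != j & y = Delta i j]
    & Delta_in (t ++ t') [set~ o]%SET].
Proof.
move=> uw ad oY Y0 tY.
pose E (p q : 'I_n * 'I_n) := Delta p.1 p.2 = Delta q.1 q.2.
have [||||| |s' [ss' s'o s'X]] := kruskal (E := E) (s := enum [pred p | Delta p.1 p.2 \in t]) uw _ _ _ _ _ oY Y0.
- by [].
- by move=> p q; rewrite /E => ->.
- by move=> p q r; rewrite /E => ->.
- by move=> i j; rewrite /E /= DeltaC.
- by move=> i j k tr c; apply: cherry_Delta ad tr c.
- move=> i j iY jY ij; by exists (i, j); rewrite // mem_enum inE tY.
exists [seq Delta p.1 p.2 | p <- s']; split; first by rewrite size_map.
  by move=> y /mapP[p /s'o[p1 p2 p12] ->]; exists p.1, p.2.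
move=> i j iX jX ij; have [p] := s'X i j iX jX ij; rewrite /E /= => ps ->.
move: ps; rewrite !mem_cat mem_enum inE => /orP[->//|ps'].
by apply/orP; right; apply/mapP; exists p.
Qed.

Definition root_cols := [seq mval (pm o i) | i <- enum [set~ o]%SET].

Lemma size_root_cols : size root_cols = n.-1.
Proof. by rewrite size_map -cardE cardsC1 card_ord. Qed.

Lemma root_colsP y : y \in root_cols -> exists2 i, i != o & y = mval (pm o i).
Proof. by move=> /mapP[i io ->]; exists i => //; move: io; rewrite mem_enum !inE. Qed.

Lemma mval_lattice t : Delta_in t [set~ o]%SET ->
  forall m, lattice_hull [set y | y \in t ++ root_cols] (mval m).
Proof.
move=> tX; have rootP i : i != o -> lattice_hull [set y | y \in t ++ root_cols] (mval (pm o i)).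
  move=> io; apply: lattice_hull_mem; rewrite /= mem_cat; apply/orP; right.
  by apply: map_f; rewrite mem_enum !inE.
move=> m; rewrite mval_sum; elim/big_rec: _ => [|e y _ Py]; first exact: lattice_hull0.
apply: lattice_hullD Py; elim: (m e) => [|k IHk]; first exact: lattice_hull0.
rewrite mulrS; apply: lattice_hullD IHk; have [i [j [ij ->]]] := mnm1_pair e.
have [io|io] := eqVneq i o; first by rewrite io; apply: rootP; rewrite -io eq_sym.
have [jo|jo] := eqVneq j o; first by rewrite jo pair_mnmC; apply: rootP.
have -> : mval (pm i j) = Delta i j + mval (pm o j) + mval (pm o i) by rewrite !subrK.
do 2 (apply: lattice_hullD; last exact: rootP).
by apply: lattice_hull_mem; rewrite /= mem_cat tX// !inE.
Qed.

Lemma seq_mx_factor t :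
  (forall m, lattice_hull [set y | y \in t] (mval m)) -> exists A, M = seq_mx t *m A.
Proof.
move=> tM; have /choice[a aE] e := lattice_hull_seq (tM (mnm1 e)).
exists (\matrix_(i, e) (a e i 0)%:~R); apply/matrixP => i e.
have := congr1 (fun v : 'cV_d => v i 0) (aE e); rewrite mval_mnm1 !mxE => ->.
by apply: eq_bigr => k _; rewrite !mxE.
Qed.

Lemma rank_Delta_in t : Delta_in t [set~ o]%SET -> (\rank M <= size t + n.-1)%N.
Proof.
move=> tX; have [A ->] := seq_mx_factor (mval_lattice tX).
apply: leq_trans (mxrankM_maxl _ _) _; apply: leq_trans (rank_leq_col _) _.
by rewrite size_cat size_root_cols.
Qed.

Lemma rank_Delta_cover w (Y : {set 'I_n}) t : ultrametric o w -> rows_adapted w ->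
  o \notin Y -> Y != finset.set0 -> Delta_in t Y ->
  (\rank M <= size t + (n.-1 - #|Y|) + n.-1)%N.
Proof.
move=> uw ad oY Y0 tY; have [t' [st' _ t'X]] := Delta_cover uw ad oY Y0 tY.
by have := rank_Delta_in t'X; rewrite size_cat st'.
Qed.

End Columns.
End Classes.

(** * Contracting an edge of a tree *)

Lemma card_set_seq (T : finType) (s : seq T) : uniq s -> #|[set x in s]%SET| = size s.
Proof. by rewrite cardsE => /card_uniqP. Qed.

Section Full.
Variables (R : realType) (n : nat) (o : 'I_n).
Local Notation N := #|ngon_arc n|.
Implicit Types (w x z : 'rV[R]_N) (i j k : 'I_n).

Lemma weight_lin (I : Type) (r : seq I) (c : I -> R) (F : I -> 'rV[R]_N) m :
  weight (\sum_(i <- r) c i *: F i) m = \sum_(i <- r) c i * weight (F i) m.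
Proof.
rewrite /weight; under [RHS]eq_bigr do rewrite mulr_sumr.
rewrite exchange_big /=; apply: eq_bigr => e _; rewrite summxE mulr_suml.
by apply: eq_bigr => i _; rewrite mxE mulrA.
Qed.

Lemma delta_lin (I : Type) (r : seq I) (c : I -> R) (F : I -> 'rV[R]_N) i j :
  delta o (\sum_(k <- r) c k *: F k) i j = \sum_(k <- r) c k * delta o (F k) i j.
Proof.
rewrite /delta !weight_lin -!sumrB.
by apply: eq_bigr => k _; rewrite !mulrBr.
Qed.

Lemma mval_mul d e (C : 'M[R]_(e, d)) (M : 'M[R]_(d, N)) m : mval (C *m M) m = C *m mval M m.
Proof. by rewrite /mval mulmxA. Qed.

Lemma Delta_mul d e (C : 'M[R]_(e, d)) (M : 'M[R]_(d, N)) i j :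
  Delta o (C *m M) i j = C *m Delta o M i j.
Proof. by rewrite /Delta !mval_mul !mulmxBr. Qed.

Lemma Delta_row (x : 'rV[R]_N) i j : Delta o x i j 0 0 = delta o x i j.
Proof. by rewrite DeltaE; congr delta; apply/rowP => k; rewrite mxE. Qed.

Lemma delta_submx d (M : 'M[R]_(d, N)) x i j k l : (x <= M)%MS ->
  Delta o M i j = Delta o M k l -> delta o x i j = delta o x k l.
Proof. by move=> /submxP[C ->] e; rewrite -!Delta_row !Delta_mul e. Qed.

Lemma triple_card i j k : triple o i j k -> (3 < n)%N.
Proof.
move=> /tripleP[[io jo ko] ij ik jk].
have : (#|[set x in [:: o; i; j; k]]%SET| <= n)%N by rewrite -[X in (_ <= X)%N]card_ord max_card.
by rewrite card_set_seq//= !inE !negb_or !(eq_sym o) io jo ko ij ik jk.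
Qed.

Section FullRank.
Variables (d : nat) (w : 'rV[R]_N) (M : 'M[R]_(d, N)).
Hypotheses (uw : ultrametric o w) (ad : rows_adapted o M w).
Hypothesis (rM : \rank M = (n.-1 + n.-2)%N).

(** A tree whose metrics span a space of dimension [2n-3] is trivalent, as three
    leaves with a single branching point leave at most [n-3] of them in all. *)
Lemma Delta_resolved i j k : triple o i j k ->
  Delta o M i j = Delta o M i k -> Delta o M i k = Delta o M j k -> False.
Proof.
move=> t e1 e2; have n3 := triple_card t; have [[io jo ko] ij ik jk] := tripleP t.
pose Y := [set x in [:: i; j; k]]%SET.
have cY : #|Y| = 3%N by rewrite card_set_seq//= !inE negb_or ij ik jk.
have : (\rank M <= 1 + (n.-1 - #|Y|) + n.-1)%N.
  apply: (rank_Delta_cover (t := [:: Delta o M i j]) uw ad).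
  - by rewrite !inE !(eq_sym o) !negb_or io jo ko.
  - by apply/finset.set0Pn; exists i; rewrite !inE eqxx.
  - have es := (DeltaC o M j i, DeltaC o M k i, DeltaC o M k j).
    by move=> a b; rewrite !inE => /or3P[] /eqP-> /or3P[] /eqP->;
      rewrite ?eqxx// ?es ?e1 ?e2.
by rewrite rM cY; lia.
Qed.

(** Appending [x] keeps the rows adapted to the tree, hence the rank cannot grow
    beyond the bound [2n-3], which [M] attains. *)
Lemma adapted_submx x : (1 < n)%N -> adapted o w x -> (x <= M)%MS.
Proof.
move=> n1 adx; have [l lo] : exists l : 'I_n, l != o.
  have : (0 < #|[set~ o]%SET|)%N by rewrite cardsC1 card_ord; lia.
  by rewrite card_gt0 => /finset.set0Pn[l]; rewrite !inE; exists l.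
have adc : rows_adapted o (col_mx M x) w.
  move=> r; have [k ->] : exists k : 'I_d + 'I_1, r = unsplit k by exists (split r); rewrite splitK.
  case: k => k /=; first by rewrite rowKu.
  by rewrite rowKd; have -> : row k x = x by apply/rowP => e; rewrite mxE ord1.
have : (\rank (col_mx M x) <= 0 + (n.-1 - #|[set l]%SET|) + n.-1)%N.
  apply: (rank_Delta_cover (t := [::]) uw adc).
  - by rewrite inE eq_sym.
  - by apply/finset.set0Pn; exists l; rewrite inE.
  - by move=> a b; rewrite !inE => /eqP-> /eqP->; rewrite eqxx.
rewrite cards1 => le; have le' : (\rank (M + x)%MS <= \rank M)%N.
  by rewrite addsmxE rM; apply: leq_trans le _; lia.
have [_ eqr] := mxrank_leqif_sup (addsmxSl M x).
by apply: (submx_trans (addsmxSr M x)); rewrite -eqr eqn_leq le' mxrankS ?addsmxSl.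
Qed.

End FullRank.
End Full.

Section Contraction.
Variables (R : realType) (n : nat) (o : 'I_n).
Local Notation N := #|ngon_arc n|.
Implicit Types (w x : 'rV[R]_N) (i j k : 'I_n).

Section RowSum.
Variables (d : nat) (B : 'M[R]_(d, N)) (w : 'rV[R]_N).
Hypotheses (uw : ultrametric o w) (wB : forall r, tree_cone o w (row r B)).

(** An interior point of the cone over the rows, whose tree is the coarsest that
    carries all rows. *)
Definition row_sum : 'rV[R]_N := \sum_r 1 *: row r B.

Lemma row_sum_submx e (M : 'M[R]_(e, N)) : (B <= M)%MS -> (row_sum <= M)%MS.
Proof.
move=> BM; apply: summx_sub => r _; apply: scalemx_sub.
exact: submx_trans (row_sub r B) BM.
Qed.

Lemma row_sum_delta i j : delta o row_sum i j = \sum_r delta o (row r B) i j.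
Proof. by rewrite delta_lin; apply: eq_bigr => r _; rewrite mul1r. Qed.

Lemma row_sum_tree_cone : tree_cone o w row_sum.
Proof.
move=> i j k t c; rewrite /cherry !row_sum_delta; split.
  by apply: eq_bigr => r _; have [] := wB r t c.
by apply: ler_sum => r _; have [] := wB r t c.
Qed.

(** The rows lie in one closed cone of metrics, so that an equality that holds
    for their sum holds for each of them. *)
Lemma row_sum_adapted : rows_adapted o B row_sum.
Proof.
have sum_eq (F G : 'I_d -> R) : (forall r, F r <= G r) ->
    \sum_r F r = \sum_r G r -> forall r, F r = G r.
  move=> FG /esym/eqP; rewrite -subr_eq0 -sumrB => /eqP.
  have ge r : true -> 0 <= G r - F r by rewrite subr_ge0.
  by move=> /(psumr_eq0P ge) H r; apply/esym/eqP; rewrite -subr_eq0 H.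
move=> r i j k t [e l]; rewrite !row_sum_delta in e.
have [c|c|c] := uw t; first by have [] := wB r t c.
  have cr s : cherry o (row s B) i k j by apply: wB => //; rewrite tripleC23.
  apply/esym/(sum_eq (fun r => delta o (row r B) j k) (fun r => delta o (row r B) i k)) => // s.
  by have [e1 l1] := cr s; rewrite [leLHS]deltaC -e1.
have cr s : cherry o (row s B) j k i by apply: wB => //; rewrite tripleC23 tripleC12.
apply: (sum_eq (fun r => delta o (row r B) i k) (fun r => delta o (row r B) j k)) => // s.
by have [e1 l1] := cr s; rewrite [leLHS]deltaC -e1.
Qed.

End RowSum.

(** Where a weight [z] in the cone of [w] separates three leaves strictly, the
    tree of [w] separates them in the same way. *)
Lemma strict_cherry w z i j k : ultrametric o w -> tree_cone o w z -> triple o i j k ->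
  delta o z i k = delta o z j k -> delta o z i k < delta o z i j -> cherry o w i j k.
Proof.
move=> uw wz t e l; have [//|c|c] := uw i j k t.
  have [e1 _] : cherry o z i k j by apply: wz => //; rewrite tripleC23.
  by rewrite e (deltaC o z j) -e1 ltxx in l.
have [e1 _] : cherry o z j k i by apply: wz => //; rewrite tripleC23 tripleC12.
by rewrite (deltaC o z i k) -e1 (deltaC o z i) ltxx in l.
Qed.

Section Labels.
Variables (z : 'rV[R]_N) (b c d : 'I_n).
Hypotheses (uz : ultrametric o z) (tbcd : triple o b c d).
Let h := delta o z b c.
Hypotheses (hbd : delta o z b d = h) (hcd : delta o z c d = h).

(** Leaves on the four branches at the branching point of [b], [c] and [d]; the
    branch numbered 0 contains the root. *)
Definition rep (l : nat) := nth o [:: o; b; c; d] l.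

Definition near i l := (i != o) && ((i == rep l) || (h < delta o z i (rep l))).

Definition label i := if near i 1 then 1%N else if near i 2 then 2%N
  else if near i 3 then 3%N else 0%N.

Variant label_spec i : nat -> Type :=
| LabelRoot of (forall l, (0 < l < 4)%N -> ~~ near i l) : label_spec i 0
| LabelNear l of (0 < l < 4)%N & near i l : label_spec i l.

Lemma labelP i : label_spec i (label i).
Proof.
rewrite /label; case E1 : (near i 1); first exact: LabelNear.
case E2 : (near i 2); first exact: LabelNear.
case E3 : (near i 3); first exact: LabelNear.
by constructor => -[|[|[|[|l]]]]//; rewrite ?E1 ?E2 ?E3.
Qed.

Lemma label_lt i : (label i < 4)%N.
Proof. by case: labelP => // l /andP[]. Qed.

Lemma label_near i : label i != 0%N -> near i (label i).
Proof. by case: labelP. Qed.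

Lemma label_far i l : label i = 0%N -> (0 < l < 4)%N -> ~~ near i l.
Proof. by case: labelP => [H _|l' /andP[+ _] _ l0]; [apply: H | rewrite l0]. Qed.

Lemma label_o : label o = 0%N.
Proof. by rewrite /label /near eqxx. Qed.

Lemma rep_neq_o l : (0 < l < 4)%N -> rep l != o.
Proof. by have [[bo co d_o] _ _ _] := tripleP tbcd; case: l => [|[|[|[|l]]]]. Qed.

Lemma rep_inj l l' : (0 < l < 4)%N -> (0 < l' < 4)%N -> l != l' -> rep l != rep l'.
Proof.
have [_ bc bd cd] := tripleP tbcd.
by case: l => [|[|[|[|l]]]]//; case: l' => [|[|[|[|l']]]]//; rewrite /rep /= // eq_sym.
Qed.

Lemma delta_rep l l' : (0 < l < 4)%N -> (0 < l' < 4)%N -> l != l' ->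
  delta o z (rep l) (rep l') = h.
Proof.
have dC := deltaC o z.
by case: l => [|[|[|[|l]]]]//; case: l' => [|[|[|[|l']]]]//; rewrite /rep /= // dC.
Qed.

Lemma ultra_lt i j k : triple o i j k -> delta o z j k < delta o z i j ->
  delta o z i k = delta o z j k.
Proof.
move=> t l; have t' : triple o i k j by rewrite tripleC23.
have t2 : triple o j i k by rewrite tripleC12.
have := ultrametric_min uz t; have := ultrametric_min uz t'.
have := ultrametric_min uz t2; rewrite !ge_min !(deltaC o z k j) (deltaC o z j i).
by move: l; move: (delta o z i j) (delta o z i k) (delta o z j k) => x y u *; lra.
Qed.

Lemma near_rep l : (0 < l < 4)%N -> near (rep l) l.
Proof. by move=> l4; rewrite /near rep_neq_o// eqxx. Qed.

Lemma near_delta_rep i l l' : (0 < l < 4)%N -> (0 < l' < 4)%N -> l != l' ->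
  near i l -> i != rep l' /\ delta o z i (rep l') = h.
Proof.
move=> l4 l4' ll /andP[io /predU1P[->|hi]]; first by rewrite delta_rep// rep_inj.
have il : i != rep l'.
  by apply: contraTneq hi => ->; rewrite delta_rep// 1?eq_sym// ltxx.
have [ir|ir] := eqVneq i (rep l); first by rewrite ir delta_rep// rep_inj.
split=> //; rewrite (@ultra_lt i (rep l)) ?delta_rep//.
by rewrite /triple io !rep_neq_o// ir il rep_inj.
Qed.

Lemma near_neq i j l l' : (0 < l < 4)%N -> (0 < l' < 4)%N -> l != l' ->
  near i l -> near j l' -> i != j /\ delta o z i j = h.
Proof.
move=> l4 l4' ll il jl'.
have [ir' e] := near_delta_rep l4 l4' ll il.
have [jr e'] : j != rep l /\ delta o z j (rep l) = h by apply: (near_delta_rep l4' l4); rewrite // eq_sym.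
have [io jo] : i != o /\ j != o by move: il jl' => /andP[-> _] /andP[-> _].
have /andP[_ /predU1P[jE|hj]] := jl'; first by rewrite jE.
have ij : i != j by apply: contraTneq hj => <-; rewrite e ltxx.
split=> //; have [jr'|jr'] := eqVneq j (rep l'); first by rewrite jr'.
rewrite deltaC (@ultra_lt j (rep l') i) ?[delta o z (rep l') i]deltaC ?e//.
by rewrite /triple jo io rep_neq_o// jr' eq_sym ij eq_sym ir'.
Qed.

Lemma near_same i j l : (0 < l < 4)%N -> near i l -> near j l -> i != j ->
  h < delta o z i j.
Proof.
move=> l4 /andP[io /predU1P[->|hi]] /andP[jo /predU1P[->|hj]] ij.
- by rewrite eqxx in ij.
- by rewrite deltaC.
- by [].
have [ir|ir] := eqVneq i (rep l); first by rewrite ir deltaC.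
have [jr|jr] := eqVneq j (rep l); first by rewrite jr.
have t : triple o i (rep l) j by rewrite /triple io jo rep_neq_o// ir ij eq_sym jr.
by apply: lt_le_trans (ultrametric_min uz t); rewrite lt_min hi deltaC.
Qed.

(** This holds when the tree of [M] refines that of [z]. *)
Definition Delta_coherent (e : nat) (M : 'M[R]_(e, N)) :=
  forall i j k, triple o i j k -> delta o z i k = delta o z j k ->
    delta o z i k < delta o z i j -> Delta o M i k = Delta o M j k.

Lemma Delta_rep e (M : 'M[R]_(e, N)) i j : Delta_coherent M ->
  label i != 0%N -> label j != 0%N -> label i != label j ->
  Delta o M i j = Delta o M (rep (label i)) (rep (label j)).
Proof.
move=> coh i0 j0 ij; have [i4 j4] := (label_lt i, label_lt j).
have step (x y : 'I_n) l : near x l -> (0 < l < 4)%N -> y != x -> y != rep l -> y != o ->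
    delta o z x y = h -> delta o z (rep l) y = h -> Delta o M x y = Delta o M (rep l) y.
  move=> /andP[xo /predU1P[->//|hx]] l4 yx yl yo xy ly.
  have [->//|xl] := eqVneq x (rep l).
  by apply: coh; rewrite ?xy ?ly// /triple xo yo rep_neq_o// xl eq_sym yx eq_sym yl.
have [ni nj] := (label_near i0, label_near j0).
have li : (0 < label i < 4)%N by rewrite lt0n i0.
have lj : (0 < label j < 4)%N by rewrite lt0n j0.
have [io jo] : i != o /\ j != o by move: ni nj => /andP[-> _] /andP[-> _].
have [nij dij] := near_neq li lj ij ni nj.
have [nir dir] := near_delta_rep li lj ij ni.
have [njr djr] : j != rep (label i) /\ delta o z j (rep (label i)) = h.
  by apply: (near_delta_rep lj li) => //; rewrite eq_sym.
rewrite (step i j (label i))//; last by rewrite deltaC.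
  rewrite DeltaC (step j (rep (label i)) (label j))// 1?DeltaC// ?rep_neq_o//.
  - by rewrite eq_sym.
  - by rewrite rep_inj.
  - by rewrite deltaC delta_rep.
by rewrite eq_sym.
Qed.

End Labels.
End Contraction.

(** * Two trivalent trees sharing a contraction *)

Section PairFunctions.
Variables (R : realType) (n : nat) (o : 'I_n).
Local Notation N := #|ngon_arc n|.

Definition pair_row (g : 'I_n -> 'I_n -> R) : 'rV[R]_N :=
  \row_e g (val (enum_val e)).1 (val (enum_val e)).2.

Lemma weight_mnm1 (x : 'rV[R]_N) e : weight x (mnm1 e) = x 0 e.
Proof.
rewrite /weight (bigD1 e)//= big1 => [|k /negPf ke]; last by rewrite mnm1E eq_sym ke mulr0.
by rewrite mnm1E eqxx mulr1 addr0.
Qed.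

Lemma weight_pair_row g i j : (forall i j, g i j = g j i) -> i != j ->
  weight (pair_row g) (pair_mnm i j) = g i j.
Proof.
move=> gC; case: (ltngtP i j) => [ij|ji|/val_inj->]; last by rewrite eqxx.
  by rewrite pair_mnm_lt weight_mnm1 mxE enum_rankK.
by rewrite pair_mnmC gC pair_mnm_lt weight_mnm1 mxE enum_rankK.
Qed.

End PairFunctions.

Section Flip.
Variables (R : realType) (n : nat) (o : 'I_n).
Local Notation N := #|ngon_arc n|.
Local Notation pm := (@pair_mnm n).
Variables (d e : nat) (w1 w2 : 'rV[R]_N) (M1 M2 : 'M[R]_(d, N)) (B : 'M[R]_(e, N)).
Hypotheses (uw1 : ultrametric o w1) (uw2 : ultrametric o w2).
Hypotheses (ad1 : rows_adapted o M1 w1) (ad2 : rows_adapted o M2 w2).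
Hypotheses (rM1 : \rank M1 = (n.-1 + n.-2)%N) (rM2 : \rank M2 = (n.-1 + n.-2)%N).
Hypothesis BM1 : (B <= M1)%MS.
Hypothesis rB : (\rank B).+1 = (n.-1 + n.-2)%N.
Hypothesis w1B : forall r, tree_cone o w1 (row r B).
Hypothesis w2B : forall r, tree_cone o w2 (row r B).
Variables (p q s : 'I_n).
Hypotheses (tpqs : triple o p q s) (ch1 : cherry o w1 p q s) (ch2 : cherry o w2 q s p).

(* The tree of [z] is the common contraction of the trees of [w1] and [w2]. *)
Let z := row_sum B.
Let h := delta o z p q.
Local Notation lab := (label o z p q s).
Local Notation rp := (rep o p q s).

Let wz1 : tree_cone o w1 z. Proof. exact: row_sum_tree_cone. Qed.
Let wz2 : tree_cone o w2 z. Proof. exact: row_sum_tree_cone. Qed.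
Let uz : ultrametric o z. Proof. exact: tree_cone_ultrametric wz1. Qed.

Let n3 : (3 < n)%N. Proof. exact: triple_card tpqs. Qed.

Let tie : delta o z p s = h /\ delta o z q s = h.
Proof.
have [e1 l1] := wz1 tpqs ch1.
have [e2 l2] : cherry o z q s p by apply: wz2 => //; rewrite tripleC23 tripleC12.
by rewrite -e1 (deltaC o z p s) -e2 deltaC.
Qed.
Let hps := tie.1.
Let hqs := tie.2.

Lemma Delta_coherent1 : Delta_coherent o z M1.
Proof. by move=> i j k t eq lt; apply: (cherry_Delta ad1 t); apply: strict_cherry lt. Qed.

Lemma Delta_coherent2 : Delta_coherent o z M2.
Proof. by move=> i j k t eq lt; apply: (cherry_Delta ad2 t); apply: strict_cherry lt. Qed.

(** A point where several leaves branch in the tree of [z] is not resolved by any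
    row of [B], since the rows are adapted to [z]. *)
Lemma Delta_star (Y : {set 'I_n}) (c : R) i j : o \notin Y -> i \in Y -> j \in Y -> i != j ->
  (forall x y, x \in Y -> y \in Y -> x != y -> delta o z x y = c) ->
  forall x y, x \in Y -> y \in Y -> x != y -> Delta o B x y = Delta o B i j.
Proof.
move=> oY iY jY ij Yc.
have swap x y u : x \in Y -> y \in Y -> u \in Y -> x != y -> x != u -> y != u ->
    Delta o B x u = Delta o B y u.
  move=> xY yY uY xy xu yu; have nroot k : k \in Y -> k != o by apply: contraTneq => ->.
  apply: (cherry_Delta (row_sum_adapted uw1 w1B)); last by split; rewrite !Yc.
  by rewrite /triple (nroot x) ?(nroot y) ?(nroot u) ?xy ?xu ?yu.
have swapi y : y \in Y -> i != y -> Delta o B i y = Delta o B i j.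
  move=> yY iy; have [->//|yj] := eqVneq y j.
  by rewrite DeltaC (swap y j)// 1?eq_sym// DeltaC.
move=> x y xY yY xy; have [xi|xi] := eqVneq x i; first by rewrite xi in xy *; apply: swapi.
have [->|yi] := eqVneq y i; first by rewrite DeltaC swapi// eq_sym.
by rewrite (swap x i)// ?swapi// eq_sym.
Qed.

(** A fifth branch at the branching point of [p], [q] and [s] would give four
    leaves with a single branching point, and the rank of [B] would drop by one
    more. *)
Lemma root_label_rep i l : i != o -> lab i = 0%N -> (0 < l < 4)%N ->
  delta o z i (rp l) < h.
Proof.
move=> io i0 l4; have far l' : (0 < l' < 4)%N -> i != rp l' /\ delta o z i (rp l') <= h.
  by move=> /(label_far i0); rewrite /near io /= negb_or -leNgt => /andP[].
have rpo := rep_neq_o tpqs.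
have tri l1 l2 : (0 < l1 < 4)%N -> (0 < l2 < 4)%N -> l1 != l2 -> triple o i (rp l1) (rp l2).
  by move=> ? ? ?; rewrite /triple io !rpo// !(far _ _).1// (rep_inj tpqs).
have drep := delta_rep hps hqs.
have eqh l1 l2 : (0 < l1 < 4)%N -> (0 < l2 < 4)%N -> delta o z i (rp l1) = h ->
    delta o z i (rp l2) = h.
  move=> l14 l24 e1; have [<-//|l12] := eqVneq l1 l2.
  apply/eqP; rewrite eq_le (far _ _).2//= -{1}e1.
  have := ultrametric_min uz (tri _ _ l14 l24 l12).
  by rewrite drep// e1 ge_min orbb.
rewrite lt_neqAle (far _ _).2// andbT; apply/eqP => il.
have ih l' : (0 < l' < 4)%N -> delta o z i (rp l') = h by move=> ?; apply: eqh il.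
have [[po qo so] pq ps qs] := tripleP tpqs.
pose Y := [set x in [:: i; p; q; s]]%SET.
have [ip iq is_] : [/\ i != p, i != q & i != s].
  by split; [have [] := far 1%N isT|have [] := far 2%N isT|have [] := far 3%N isT].
have cY : #|Y| = 4%N by rewrite card_set_seq//= !inE !negb_or ip iq is_ pq ps qs.
have YP x : x \in Y -> x = i \/ exists2 l, (0 < l < 4)%N & x = rp l.
  rewrite !inE => /or4P[] /eqP->; [by left|right..]; first by exists 1%N.
    by exists 2%N.
  by exists 3%N.
have Yh x y : x \in Y -> y \in Y -> x != y -> delta o z x y = h.
  move=> /YP[->|[l1 l14 ->]] /YP[->|[l2 l24 ->]]; first by rewrite eqxx.
  - by move=> _; apply: ih.
  - by move=> _; rewrite deltaC; apply: ih.
  - by move=> l12; apply: drep => //; apply: contraNneq l12 => ->.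
have oY : o \notin Y by rewrite !inE !(eq_sym o) !negb_or io po qo so.
have [pY qY] : p \in Y /\ q \in Y by rewrite !inE !eqxx !orbT.
have : (\rank B <= 1 + (n.-1 - #|Y|) + n.-1)%N.
  apply: (rank_Delta_cover (t := [:: Delta o B p q]) uz (row_sum_adapted uw1 w1B) oY).
    by apply/finset.set0Pn; exists p.
  by move=> x y xY yY xy; rewrite inE (Delta_star oY pY qY pq Yh xY yY xy).
have : (#|Y| <= n.-1)%N.
  rewrite -[n in n.-1]card_ord -(cardsC1 o) subset_leq_card//.
  by apply/fintype.subsetP => x xY; rewrite !inE; apply: contraNneq oY => <-.
by move: rB; rewrite cY; clear; lia.
Qed.

Lemma label0_lt i j : i != o -> lab i = 0%N -> lab j != 0%N -> delta o z i j < h.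
Proof.
move=> io i0 j0; have lj : (0 < lab j < 4)%N by rewrite lt0n j0 label_lt.
have := label_near j0; rewrite /near => /andP[jo /predU1P[->|hj]]; first exact: root_label_rep.
have ij : i != j by apply: contraNneq j0 => <-; rewrite i0.
have [jr|jr] := eqVneq j (rp (lab j)); first by rewrite jr; apply: root_label_rep.
have ir : i != rp (lab j).
  by apply/eqP => ir; have := label_far i0 lj; rewrite ir near_rep.
rewrite ltNge; apply/negP => hij; have := root_label_rep io i0 lj; rewrite ltNge => /negP; apply.
have t : triple o i j (rp (lab j)) by rewrite /triple io jo rep_neq_o ?ij ?ir.
by apply: le_trans (ultrametric_min uz t); rewrite le_min hij ltW.
Qed.

Lemma label_neq i j : lab i != 0%N -> lab j != 0%N -> lab i != lab j -> delta o z i j = h.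
Proof.
move=> i0 j0 ij; have [] := near_neq uz tpqs hps hqs _ _ ij (label_near i0) (label_near j0) => //.
  by rewrite lt0n i0 label_lt.
by rewrite lt0n j0 label_lt.
Qed.

Lemma label_eq i j : i != j -> lab i != 0%N -> lab i = lab j -> h < delta o z i j.
Proof.
move=> nij i0 ij; apply: (near_same uz tpqs _ (label_near i0)) => //.
  by rewrite lt0n i0 label_lt.
by rewrite ij; apply: label_near; rewrite -ij.
Qed.

Lemma label_ge i j : i != j -> lab i != 0%N -> lab j != 0%N -> h <= delta o z i j.
Proof.
move=> ij i0 j0; have [l|l] := eqVneq (lab i) (lab j); first exact/ltW/label_eq.
by rewrite label_neq.
Qed.

(** The branches 1, 2 and 3 part at one height, so that only a leaf in the branch
    of the root can leave before two leaves of different branches part. *)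
Lemma strict_label i j k : triple o i j k -> delta o z i k = delta o z j k ->
  delta o z i k < delta o z i j -> lab i = lab j \/ lab k = 0%N.
Proof.
move=> /tripleP[[io jo ko] ij ik jk] e1 l1.
have [|k0] := eqVneq (lab k) 0%N; first by right.
have [|lij] := eqVneq (lab i) (lab j); first by left.
have [i0|i0] := eqVneq (lab i) 0%N.
  have j0 : lab j != 0%N by rewrite -i0 eq_sym.
  have := label_ge jk j0 k0; rewrite -e1 => /le_lt_trans/(_ l1).
  by rewrite ltNge ltW// label0_lt.
have ik_h := label_ge ik i0 k0.
have [j0|j0] := eqVneq (lab j) 0%N.
  have lt_ij : delta o z i j < h by rewrite deltaC label0_lt.
  by have := lt_trans (le_lt_trans ik_h l1) lt_ij; rewrite ltxx.
by have := le_lt_trans ik_h l1; rewrite label_neq// ltxx.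
Qed.

Lemma Delta_root_label f (M : 'M[R]_(f, N)) i j k : Delta_coherent o z M ->
  i != o -> lab i = 0%N -> lab j != 0%N -> lab k != 0%N ->
  Delta o M i j = Delta o M i k.
Proof.
move=> coh io i0 j0 k0; have [->//|jk] := eqVneq j k.
have hjk := label_ge jk j0 k0; have lj := label0_lt io i0 j0; have lk := label0_lt io i0 k0.
have [jo ko] : j != o /\ k != o.
  by split; [apply: contraNneq j0|apply: contraNneq k0] => ->; rewrite label_o.
have [ij ik] : i != j /\ i != k.
  by split; [apply: contraNneq j0|apply: contraNneq k0] => <-; rewrite i0.
have t : triple o j k i by rewrite /triple io jo ko jk eq_sym ij eq_sym ik.
have eji : delta o z j i = delta o z k i.
  by apply: (ultra_lt uz t); rewrite (deltaC o z k); apply: lt_le_trans hjk.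
rewrite DeltaC [RHS]DeltaC; apply: coh => //.
by rewrite deltaC; apply: lt_le_trans hjk.
Qed.

(** As the rank of [B] is only one less than that of [M1], a single pair of
    branching points of the tree of [M1] is identified by the contraction. *)
Lemma merge_unique x y u v (Y : {set 'I_n}) :
  o \notin Y -> #|Y| = 3%N -> Delta_in o M1 [:: x; y] Y ->
  (forall C, B = C *m M1 -> C *m x = C *m y /\ C *m u = C *m v) -> u != v ->
  (exists2 i, i != o & exists2 j, j != o & i != j /\ u = Delta o M1 i j) ->
  (exists2 i, i != o & exists2 j, j != o & i != j /\ v = Delta o M1 i j) ->
  u \in [:: x; y].
Proof.
move=> oY cY xyY CC uv uM vM; have Y0 : Y != finset.set0 by rewrite -card_gt0 cY.
have /submxP[C BC] := BM1; have [Cxy Cuv] := CC C BC.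
have [t [st _ tX]] := Delta_cover uw1 ad1 oY Y0 xyY.
have inT w : (exists2 i, i != o & exists2 j, j != o & i != j /\ w = Delta o M1 i j) ->
    w \in [:: x; y] ++ t.
  by move=> [i io [j jo [ij ->]]]; apply: tX; rewrite ?inE.
have [uT vT] := (inT _ uM, inT _ vM).
have key a c : a \in [:: x; y] ++ t -> c \in t -> a != c -> C *m a = C *m c -> False.
  move=> aT ct ac Cac.
  have : (\rank B <= size (map (mulmx C) (y :: rem c t)) + n.-1)%N.
    apply: (@rank_Delta_in _ _ o) => i j iX jX ij; rewrite BC Delta_mul.
    have xyin g : g \in [:: x; y] -> C *m g \in map (mulmx C) (y :: rem c t).
      move=> gxy; have -> : C *m g = C *m y by move: gxy; rewrite !inE => /orP[]/eqP->.
      by apply: map_f; apply: mem_head.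
    have tin g : g \in t -> g != c -> C *m g \in map (mulmx C) (y :: rem c t).
      move=> gt gc; apply: map_f; rewrite inE; apply/orP; right.
      by move: gt; rewrite (perm_mem (perm_to_rem ct)) inE (negPf gc).
    have := tX i j iX jX ij; rewrite mem_cat => /orP[/xyin//|gt].
    have [gc|gc] := eqVneq (Delta o M1 i j) c; last exact: tin.
    rewrite gc -Cac; move: aT; rewrite mem_cat => /orP[/xyin//|/tin]; exact.
  rewrite size_map /= size_rem// st cY.
  have : (0 < size t)%N by case: (t) ct.
  by move: rB; rewrite st cY; clear; move: (\rank B) => r; lia.
move: uT; rewrite mem_cat => /orP[//|ut]; exfalso.
by apply: (key v u vT ut); rewrite // eq_sym.
Qed.

Let pq_neq : Delta o M1 p q != Delta o M1 p s.
Proof.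
apply/eqP => pq; apply: (Delta_resolved uw1 ad1 rM1 tpqs pq).
exact: (cherry_Delta ad1 tpqs ch1).
Qed.

Lemma label_reps : [/\ lab p = 1, lab q = 2 & lab s = 3]%N.
Proof.
have [[po qo so] pq ps qs] := tripleP tpqs; have dC := deltaC o z.
rewrite /label /near /= po qo so !eqxx /= eq_sym (negPf pq) eq_sym (negPf ps).
by rewrite eq_sym (negPf qs) !(dC q p) !(dC s) hps hqs /h !ltxx.
Qed.

(** If [a] and [b] were in the branch of the root, the four leaves [a], [b], [p]
    and [q] would have only two branching points in the trivalent tree of [M1]. *)
Lemma merged_label a b : a != o -> b != o -> a != b ->
  Delta o M1 a b = Delta o M1 p q -> lab a != 0%N.
Proof.
move=> ao bo ab Dab; have [lp lq ls] := label_reps.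
have hab : delta o z a b = h by apply: delta_submx Dab; apply: row_sum_submx.
apply/eqP => a0; have [b0|b0] := eqVneq (lab b) 0%N; last first.
  by have := label0_lt ao a0 b0; rewrite hab ltxx.
have [[po qo so] pq ps qs] := tripleP tpqs.
have [lp0 lq0] : lab p != 0%N /\ lab q != 0%N by rewrite lp lq.
have [[ap aq] [bp bq]] : (a != p /\ a != q) /\ (b != p /\ b != q).
  by split; split; apply/eqP => E; [move: a0|move: a0|move: b0|move: b0]; rewrite E ?lp ?lq.
pose Y := [set x in [:: a; b; p; q]]%SET.
have cY : #|Y| = 4%N by rewrite card_set_seq//= !inE !negb_or ab ap aq bp bq pq.
have oY : o \notin Y by rewrite !inE !(eq_sym o) !negb_or ao bo po qo.
have Da := Delta_root_label Delta_coherent1 ao a0 lp0 lq0.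
have Db := Delta_root_label Delta_coherent1 bo b0 lp0 lq0.
have tabp : triple o a b p by rewrite /triple ao bo po ab ap bp.
have lbp : delta o z b p < delta o z a b by rewrite hab label0_lt.
have eabp := ultra_lt uz tabp lbp.
have Dabp : Delta o M1 a p = Delta o M1 b p by apply: (Delta_coherent1 tabp eabp); rewrite eabp.
have : (\rank M1 <= 2 + (n.-1 - #|Y|) + n.-1)%N.
  apply: (rank_Delta_cover (t := [:: Delta o M1 p q; Delta o M1 a p]) uw1 ad1 oY).
    by apply/finset.set0Pn; exists p; rewrite !inE eqxx !orbT.
  have DC := DeltaC o M1; move=> x y; rewrite !inE.
  by move=> /or4P[]/eqP-> /or4P[]/eqP->; rewrite ?eqxx//= ?(DC b a) ?(DC p a) ?(DC q a) ?(DC p b)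
    ?(DC q b) ?(DC q p) -?Da -?Db -?Dabp ?Dab ?eqxx ?orbT.
have : (#|Y| <= n.-1)%N.
  rewrite -[n in n.-1]card_ord -(cardsC1 o) subset_leq_card//.
  by apply/fintype.subsetP => x xY; rewrite !inE; apply: contraNneq oY => <-.
by rewrite rM1 cY; clear; lia.
Qed.

(** The tree of [M1] is trivalent and resolves the three leaves; by
    [merge_unique], the contracted edge ends at the branching point of [p], [q]
    and [s], which is therefore also that of these leaves. *)
Lemma tie_labels i j k : triple o i j k ->
  delta o z i j = delta o z i k -> delta o z i k = delta o z j k ->
  [/\ lab i != 0, lab j != 0, lab k != 0 & uniq [:: lab i; lab j; lab k]]%N.
Proof.
move=> t e1 e2; have [[io jo ko] ij ik jk] := tripleP t; have dC := deltaC o z.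
suff [a [b [aS bS ab Dab]]] : exists a b, [/\ a \in [:: i; j; k], b \in [:: i; j; k], a != b
    & Delta o M1 a b = Delta o M1 p q].
  have no x : x \in [:: i; j; k] -> x != o by rewrite !inE => /or3P[]/eqP->.
  have hab : delta o z a b = h by apply: delta_submx Dab; apply: row_sum_submx.
  have a0 := merged_label (no _ aS) (no _ bS) ab Dab.
  have hall x y : x \in [:: i; j; k] -> y \in [:: i; j; k] -> x != y -> delta o z x y = h.
    have all_eq u v : u \in [:: i; j; k] -> v \in [:: i; j; k] -> u != v ->
        delta o z u v = delta o z i j.
      rewrite !inE => /or3P[]/eqP-> /or3P[]/eqP->; rewrite ?eqxx// ?(dC j i) ?(dC k i) ?(dC k j) -?e2 -?e1 //.
    by move=> xS yS xy; rewrite (all_eq _ _ xS yS xy) -(all_eq _ _ aS bS ab).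
  have l0 x : x \in [:: i; j; k] -> lab x != 0%N.
    move=> xS; have [->//|xa] := eqVneq x a; apply/eqP => x0.
    by have := label0_lt (no _ xS) x0 a0; rewrite hall// ltxx.
  have ldiff x y : x \in [:: i; j; k] -> y \in [:: i; j; k] -> x != y -> lab x != lab y.
    move=> xS yS xy; apply/eqP => lxy; have := label_eq xy (l0 _ xS) lxy.
    by rewrite hall// ltxx.
  by rewrite /= !inE negb_or !l0 ?ldiff ?inE ?eqxx ?orbT.
clear io jo ko ij ik jk; wlog c : i j k t e1 e2 / cherry o w1 i j k.
  move=> W; have perm x y u : (forall v, v \in [:: x; y; u] -> v \in [:: i; j; k]) ->
      (exists a b, [/\ a \in [:: x; y; u], b \in [:: x; y; u], a != b
        & Delta o M1 a b = Delta o M1 p q]) ->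
      exists a b, [/\ a \in [:: i; j; k], b \in [:: i; j; k], a != b
        & Delta o M1 a b = Delta o M1 p q].
    by move=> sub [a [b [aS bS ab Dab]]]; exists a, b; split=> //; apply: sub.
  have [c|c|c] := uw1 t; first exact: W.
    apply: (perm i k j); first by move=> v; rewrite !inE => /or3P[]->; rewrite ?orbT.
    by apply: W c; rewrite ?[triple _ i k j]tripleC23// e1// e2 dC.
  apply: (perm j k i); first by move=> v; rewrite !inE => /or3P[]->; rewrite ?orbT.
  by apply: W c; rewrite ?[triple _ j k i]tripleC23 1?tripleC12// (dC j i) e1// dC.
have [[io jo ko] ij ik jk] := tripleP t.
pose Y := [set x in [:: i; j; k]]%SET.
have cY : #|Y| = 3%N by rewrite card_set_seq//= !inE negb_or ij ik jk.
have oY : o \notin Y by rewrite !inE !(eq_sym o) !negb_or io jo ko.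
have Dijk := cherry_Delta ad1 t c; have DC := DeltaC o M1.
have /= := @merge_unique (Delta o M1 i k) (Delta o M1 i j) (Delta o M1 p q) (Delta o M1 p s) Y oY cY _ _ pq_neq.
have [[po qo so] pq ps qs] := tripleP tpqs.
have H1 : Delta_in o M1 [:: Delta o M1 i k; Delta o M1 i j] Y.
  move=> x y; rewrite !inE => /or3P[]/eqP-> /or3P[]/eqP->; rewrite ?eqxx// => _;
  by rewrite ?(DC j i) ?(DC k i) ?(DC k j) -?Dijk ?eqxx ?orbT.
have H2 C : B = C *m M1 -> C *m Delta o M1 i k = C *m Delta o M1 i j /\
    C *m Delta o M1 p q = C *m Delta o M1 p s.
  move=> BC; rewrite -!Delta_mul -BC; have adB := row_sum_adapted uw1 w1B.
  rewrite !(DeltaC o B _ k) !(DeltaC o B _ j) !(DeltaC o B p).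
  split; [apply: (cherry_Delta adB)|apply: (cherry_Delta adB)].
  - by rewrite /triple ko jo io eq_sym jk eq_sym ik eq_sym ij.
  - by split; rewrite (dC k i) ?(dC j i) ?(dC k j) ?e1// -e2.
  - by rewrite /triple po qo so qs eq_sym pq eq_sym ps.
  - by split; rewrite (dC q p) ?(dC s p) ?hps ?hqs.
move=> /(_ H1 H2).
have H3 a b : a != o -> b != o -> a != b ->
    exists2 i0, i0 != o & exists2 j0, j0 != o & i0 != j0 /\ Delta o M1 a b = Delta o M1 i0 j0.
  by move=> ao bo ab; exists a => //; exists b.
move=> /(_ (H3 _ _ po qo pq) (H3 _ _ po so ps)); rewrite !inE => /orP[]/eqP E.
  by exists i, k; rewrite !inE !eqxx !orbT.
by exists i, j; rewrite !inE !eqxx !orbT.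
Qed.

(** The branches are numbered in a cyclic order for which the two trees resolve
    the branching point as 12 against 30 and as 23 against 01; the opposite
    branches are then 0 and 2, and 1 and 3. *)
Definition opp02 (l m : nat) := ((l == 0) && (m == 2) || (l == 2) && (m == 0))%N.
Definition opp13 (l m : nat) := ((l == 1) && (m == 3) || (l == 3) && (m == 1))%N.

Lemma opp02C l m : opp02 l m = opp02 m l.
Proof. by rewrite /opp02 orbC andbC [X in _ || X]andbC. Qed.

Lemma opp13C l m : opp13 l m = opp13 m l.
Proof. by rewrite /opp13 orbC andbC [X in _ || X]andbC. Qed.

Let g02 i j : R := (opp02 (lab i) (lab j))%:R.
Let gell i j : R := g02 i j - (opp13 (lab i) (lab j))%:R.

Let g02C i j : g02 i j = g02 j i. Proof. by rewrite /g02 opp02C. Qed.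
Let gellC i j : gell i j = gell j i. Proof. by rewrite /gell g02C opp13C. Qed.

Let delta02 i j : i != o -> j != o -> i != j -> delta o (pair_row g02) i j =
  (opp02 (lab i) (lab j))%:R - (lab i == 2%N)%:R - (lab j == 2%N)%:R.
Proof.
move=> io jo ij; rewrite /delta !weight_pair_row ?[o == _]eq_sym//.
by rewrite /g02 !label_o /opp02 /= !orbF.
Qed.

Let delta_ell i j : i != o -> j != o -> i != j -> delta o (pair_row gell) i j =
  (opp02 (lab i) (lab j))%:R - (opp13 (lab i) (lab j))%:R - (lab i == 2%N)%:R - (lab j == 2%N)%:R.
Proof.
move=> io jo ij; rewrite /delta !weight_pair_row ?[o == _]eq_sym//.
by rewrite /gell /g02 !label_o /opp02 /opp13 /= !orbF !subr0.
Qed.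

Lemma deltaB (x y : 'rV[R]_N) a i j : delta o (x - a *: y) i j = delta o x i j - a * delta o y i j.
Proof.
have -> : x - a *: y = \sum_(k < 2) (if k == 0 then 1 else - a) *: (if k == 0 then x else y).
  by rewrite !big_ord_recl big_ord0 /= addr0 scale1r scaleNr.
by rewrite delta_lin !big_ord_recl big_ord0 /= addr0 mul1r mulNr.
Qed.

Lemma label_123 l : l != 0%N -> (l < 4)%N -> [\/ l = 1%N, l = 2%N | l = 3%N].
Proof. by case: l => [|[|[|[|l]]]]// _ _; [apply: Or31|apply: Or32|apply: Or33]. Qed.

(** Flipping the edge between the two trees adds a multiple of the indicator
    function of the pairs in the opposite branches 0 and 2. *)
Lemma flip_adapted x : (x <= M2)%MS ->
  adapted o w1 (x - (delta o x p q - delta o x q s) *: pair_row g02).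
Proof.
move=> xM2 i j k t c; have [[io jo ko] ij ik jk] := tripleP t.
rewrite !deltaB !delta02//; have [e1 l1] := wz1 t c.
have [lt|] := ltP (delta o z i k) (delta o z i j).
  rewrite (delta_submx xM2 (Delta_coherent2 t e1 lt)).
  have [->//|->] := strict_label t e1 lt.
  by rewrite /opp02; case: (lab i) (lab j) => [|[|[|l]]] [|[|[|l']]]; rewrite /= ?subr0 ?subrr.
move=> l2; have e2 : delta o z i j = delta o z i k by apply/eqP; rewrite eq_le l1 l2.
have [i0 j0 k0] := tie_labels t e2 e1.
rewrite /= !inE !negb_or -!andbA => /and3P[lij lik /andP[ljk _]].
have D1 : Delta o M1 i k = Delta o M1 j k := cherry_Delta ad1 t c.
have Dps := cherry_Delta ad1 tpqs ch1.
have tqsp : triple o q s p by rewrite tripleC23 tripleC12.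
have Dqp := delta_submx xM2 (cherry_Delta ad2 tqsp ch2).
have rp1 (M : 'M[R]_(d, N)) a a' : Delta_coherent o z M -> lab a != 0%N -> lab a' != 0%N -> lab a != lab a' ->
    Delta o M a a' = Delta o M (rp (lab a)) (rp (lab a')).
  by move=> coh a0 a0' aa'; apply: (Delta_rep uz tpqs hps hqs coh).
rewrite (rp1 M1 i k)// ?(rp1 M1 j k)// in D1; try exact: Delta_coherent1.
have := delta_submx xM2 (rp1 M2 _ _ Delta_coherent2 i0 k0 lik).
have := delta_submx xM2 (rp1 M2 _ _ Delta_coherent2 j0 k0 ljk) => -> ->.
have DC := DeltaC o M1; have dC := deltaC o x.
have pqn := pq_neq; rewrite (dC q p) (dC s p) in Dqp; move: D1 lij lik ljk.
have [->|->|->] := label_123 i0 (label_lt _ _ _ _ _ _);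
  have [->|->|->] := label_123 j0 (label_lt _ _ _ _ _ _);
  have [->|->|->] := label_123 k0 (label_lt _ _ _ _ _ _) => //=; rewrite /rep /= => D1 _ _ _.
all: rewrite ?(dC q p) ?(dC s p) ?(dC s q) -?Dqp /opp02 /=; try ring.
all: by move: pqn; rewrite ?(DC q p) ?(DC s p) ?(DC s q) -?Dps ?eqxx in D1 *; rewrite ?D1 -?D1 ?eqxx.
Qed.

Lemma ell_adapted : adapted o w2 (pair_row gell).
Proof.
move=> i j k t c; have [[io jo ko] ij ik jk] := tripleP t.
rewrite !delta_ell//; have [e1 l1] := wz2 t c.
have [lt|] := ltP (delta o z i k) (delta o z i j).
  have [->//|->] := strict_label t e1 lt.
  by rewrite /opp02 /opp13; case: (lab i) (lab j) => [|[|[|l]]] [|[|[|l']]];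
    rewrite /= ?andbF ?subr0 ?subrr.
move=> l2; have e2 : delta o z i j = delta o z i k by apply/eqP; rewrite eq_le l1 l2.
have [i0 j0 k0] := tie_labels t e2 e1.
rewrite /= !inE !negb_or -!andbA => /and3P[lij lik /andP[ljk _]].
move: lij lik ljk.
have [->|->|->] := label_123 i0 (label_lt _ _ _ _ _ _);
  have [->|->|->] := label_123 j0 (label_lt _ _ _ _ _ _);
  have [->|->|->] := label_123 k0 (label_lt _ _ _ _ _ _) => //= _ _ _.
all: by rewrite /opp02 /opp13 /=; ring.
Qed.

Definition flip_vec (M : 'M[R]_(d, N)) := Delta o M p q - Delta o M q s.

Lemma mval_rank1 (u : 'cV[R]_d) (x : 'rV[R]_N) m : mval (u *m x) m = weight x m *: u.
Proof.
rewrite mval_mul; apply/colP => i; rewrite !mxE big_ord1 mvalE mulrC; congr (weight _ _ * _).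
by apply/rowP => k; rewrite mxE.
Qed.

Lemma Delta_rank1 (u : 'cV[R]_d) (x : 'rV[R]_N) i j : Delta o (u *m x) i j = delta o x i j *: u.
Proof. by rewrite /Delta !mval_rank1 -!scalerBl. Qed.

Lemma mvalB (M M' : 'M[R]_(d, N)) m : mval (M - M') m = mval M m - mval M' m.
Proof. by rewrite /mval mulmxBl. Qed.

Lemma DeltaB (M M' : 'M[R]_(d, N)) i j : Delta o (M - M') i j = Delta o M i j - Delta o M' i j.
Proof. by rewrite /Delta !mvalB !opprB !addrA; apply/colP => r; rewrite !mxE; ring. Qed.

(** The linear map that carries the columns of [M1] to those of [M2], but for
    the pairs in the opposite branches 0 and 2. *)
Lemma flip_matrix : exists Psi : 'M[R]_d,
  Psi *m flip_vec M1 = flip_vec M2 /\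
  forall i j, i != j -> mval M2 (pm i j) =
    Psi *m mval M1 (pm i j) + (opp02 (lab i) (lab j))%:R *: flip_vec M2.
Proof.
have /submxP[Psi PsiE] : (M2 - flip_vec M2 *m pair_row g02 <= M1)%MS.
  apply/row_subP => r; apply: (adapted_submx uw1 ad1 rM1); first exact: ltn_trans n3.
  have -> : row r (M2 - flip_vec M2 *m pair_row g02) = row r M2 -
      (delta o (row r M2) p q - delta o (row r M2) q s) *: pair_row g02.
    have <- : flip_vec M2 r 0 = delta o (row r M2) p q - delta o (row r M2) q s.
      by rewrite -!DeltaE /flip_vec; move: (Delta _ _ _ _) (Delta _ _ _ _) => x y; rewrite !mxE.
    rewrite linearB /=; congr (_ - _); move: (flip_vec M2) (pair_row g02) => x y.
    by apply/rowP => e'; rewrite !mxE big_ord1.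
  exact/flip_adapted/row_sub.
exists Psi; split=> [|i j ij].
  have [lp lq ls] := label_reps; have [[po qo so] pq ps qs] := tripleP tpqs.
  rewrite {1}/flip_vec mulmxBr -!Delta_mul -PsiE !DeltaB !Delta_rank1 !delta02//.
  by rewrite lp lq ls /opp02 /= !subr0 !sub0r opprD addrACA opprK addNr addr0.
have := congr1 (fun M => mval M (pm i j)) PsiE.
rewrite /= mvalB mval_rank1 mval_mul weight_pair_row// => /eqP.
by rewrite subr_eq => /eqP.
Qed.

(** The form on whose sign the shear depends; it is adapted to the second tree,
    so that it is a combination of the rows of [M2]. *)
Lemma flip_functional : exists ell : 'rV[R]_d, forall i j, i != j ->
  (ell *m mval M2 (pm i j)) 0 0 = (opp02 (lab i) (lab j))%:R - (opp13 (lab i) (lab j))%:R.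
Proof.
have n1 : (1 < n)%N by exact: ltn_trans n3.
have /submxP[ell ellE] := adapted_submx uw2 ad2 rM2 n1 ell_adapted.
exists ell => i j ij; rewrite -mval_mul -ellE mvalE.
have -> : row 0 (pair_row gell) = pair_row gell by apply/rowP => k; rewrite mxE.
by rewrite weight_pair_row.
Qed.

(** Two pairs of opposite branches cross, and there are two ways to uncross them;
    the second tree carries the four-point condition for its edge, which makes
    one of the two exchanges exact and the other one off by the length vector of
    this edge. *)
Lemma flip_exchange i j k l : lab i = 0%N -> lab j = 2%N -> lab k = 1%N -> lab l = 3%N ->
  mval M2 (pm i j) + mval M2 (pm k l) = mval M2 (pm i l) + mval M2 (pm j k) /\
  mval M2 (pm i j) + mval M2 (pm k l) = mval M2 (pm i k) + mval M2 (pm j l) + flip_vec M2.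
Proof.
move=> i0 j2 k1 l3; have coh := Delta_coherent2.
have rp1 a a' : lab a != 0%N -> lab a' != 0%N -> lab a != lab a' ->
    Delta o M2 a a' = Delta o M2 (rp (lab a)) (rp (lab a')).
  by move=> a0 a0' aa'; apply: (Delta_rep uz tpqs hps hqs coh).
have tqsp : triple o q s p by rewrite tripleC23 tripleC12.
have Dqp := cherry_Delta ad2 tqsp ch2.
have Djk : Delta o M2 j k = Delta o M2 q p by rewrite rp1 ?j2 ?k1.
have Dkl : Delta o M2 k l = Delta o M2 q p by rewrite rp1 ?k1 ?l3 //= Dqp DeltaC.
have Djl : Delta o M2 j l = Delta o M2 q s by rewrite rp1 ?j2 ?l3.
have root a b : mval M2 (pm a b) = Delta o M2 a b + mval M2 (pm o a) + mval M2 (pm o b).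
  by rewrite /Delta -[_ - _ - _ + _ + _]addrA [mval _ (pm o a) + _]addrC addrA !subrK.
rewrite /flip_vec (DeltaC _ _ p) (root j k) (root k l) (root j l) Djk Dkl Djl.
have [->|io] := eqVneq i o.
  by split; apply/colP => r; rewrite !mxE; ring.
have [Dij Dik] : Delta o M2 i j = Delta o M2 i l /\ Delta o M2 i k = Delta o M2 i l.
  by split; apply: (Delta_root_label coh io i0); rewrite ?j2 ?k1 ?l3.
rewrite (root i j) (root i k) (root i l) Dij Dik.
by split; apply/colP => r; rewrite !mxE; ring.
Qed.

End Flip.

(** * Piecewise linear images of cones *)

Section Cones.
Variables (R : realType) (V : lmodType R) (I : finType).
Implicit Types (m : I -> V) (c : I -> R) (P Q : pred I).

Definition in_cone m x := exists2 c, (forall i, 0 <= c i) & x = \sum_i c i *: m i.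

Lemma in_cone0 m : in_cone m 0.
Proof. by exists (fun=> 0) => //; rewrite big1// => i _; rewrite scale0r. Qed.

Lemma in_coneD m x y : in_cone m x -> in_cone m y -> in_cone m (x + y).
Proof.
move=> [a a0 ->] [b b0 ->]; exists (fun i => a i + b i) => [i|]; first by rewrite addr_ge0.
by rewrite -big_split /=; apply: eq_bigr => i _; rewrite scalerDl.
Qed.

Lemma in_coneZ m t x : 0 <= t -> in_cone m x -> in_cone m (t *: x).
Proof.
move=> t0 [a a0 ->]; exists (fun i => t * a i) => [i|]; first by rewrite mulr_ge0.
by rewrite scaler_sumr; apply: eq_bigr => i _; rewrite scalerA.
Qed.

Lemma in_cone_mem m i : in_cone m (m i).
Proof.
exists (fun j => (j == i)%:R) => [j|]; first by rewrite ler0n.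
rewrite (bigD1 i)//= eqxx scale1r big1 ?addr0// => j /negPf->.
by rewrite scale0r.
Qed.

Lemma in_cone_sum (J : Type) (r : seq J) (D : pred J) (F : J -> V) m :
  (forall j, D j -> in_cone m (F j)) -> in_cone m (\sum_(j <- r | D j) F j).
Proof. by move=> H; elim/big_ind: _ => //; [apply: in_cone0|move=> x y; apply: in_coneD]. Qed.

(** The masses that a conic combination puts on [P] and on [Q] are coupled by
    the product coupling; a coupled pair gains [u] when it is exchanged. *)
Lemma exchange_in_cone m P Q u c :
  (forall i, ~~ (P i && Q i)) -> (forall i, 0 <= c i) ->
  (forall i j, P i -> Q j -> exists k l, m i + m j + u = m k + m l) ->
  in_cone m (\sum_i c i *: m i +
    Num.min (\sum_(i | P i) c i) (\sum_(i | Q i) c i) *: u).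
Proof.
move=> PQ c0 ex; set a := \sum_(i | P i) c i; set b := \sum_(i | Q i) c i.
have a0 : 0 <= a by apply: sumr_ge0.
have b0 : 0 <= b by apply: sumr_ge0.
have [t [t0 ta tb tab]] : exists t, [/\ 0 <= t, t * a <= 1, t * b <= 1 & t * a * b = Num.min a b].
  have [ab|/ltW ba] := lerP a b.
    have [b00|bn0] := eqVneq b 0.
      by exists 0; rewrite !mul0r ler01; split=> //; apply/esym/eqP; rewrite eq_le a0 -b00 ab.
    by exists b^-1; rewrite invr_ge0 b0 mulVf// mulrAC mulVf// mul1r ler_pdivrMl ?lt_neqAle 1?eq_sym ?bn0// mulr1.
  have [a00|an0] := eqVneq a 0.
    by exists 0; rewrite !mul0r ler01; split=> //; apply/esym/eqP; rewrite eq_le b0 -a00 ba.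
  by exists a^-1; rewrite invr_ge0 a0 mulVf// mul1r ler_pdivrMl ?lt_neqAle 1?eq_sym ?an0// mulr1.
pose c' i := c i - (P i)%:R * (c i * (t * b)) - (Q i)%:R * (c i * (t * a)).
have -> : \sum_i c i *: m i + Num.min a b *: u =
    \sum_i c' i *: m i + \sum_(i | P i) \sum_(j | Q j) (t * c i * c j) *: (m i + m j + u).
  have -> : \sum_(i | P i) \sum_(j | Q j) (t * c i * c j) *: (m i + m j + u) =
      \sum_(i | P i) (c i * (t * b)) *: m i + \sum_(j | Q j) (c j * (t * a)) *: m j +
      (t * a * b) *: u.
    under eq_bigr => i _.
      under eq_bigr do rewrite !scalerDr.
      rewrite !big_split /= -!scaler_suml -!mulr_sumr -/b.
      over.
    rewrite !big_split /= exchange_big /=; congr (_ + _ + _).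
    - by apply: eq_bigr => i _; congr (_ *: _); ring.
    - apply: eq_bigr => j _; rewrite -scaler_suml -mulr_suml -mulr_sumr -/a.
      by congr (_ *: _); ring.
    - by rewrite -scaler_suml -mulr_suml -mulr_sumr -/a.
  rewrite tab addrA; congr (_ + _).
  rewrite [X in _ = _ + (X + _)]big_mkcond [X in _ = _ + (_ + X)]big_mkcond -!big_split /=.
  apply: eq_bigr => i _; rewrite /c'.
  by case: (P i) (Q i) => [] []; rewrite ?mul1r ?mul0r ?subr0 ?addr0 ?add0r -?scalerDl//; congr (_ *: _); ring.
apply: in_coneD; last first.
  apply: in_cone_sum => i Pi; apply: in_cone_sum => j Qj; apply: in_coneZ.
    by rewrite !mulr_ge0.
  by have [k [l ->]] := ex i j Pi Qj; apply: in_coneD; apply: in_cone_mem.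
exists c' => // i; rewrite /c'; have := PQ i.
have ci t' : t' <= 1 -> 0 <= c i - c i * t' by move=> ?; rewrite subr_ge0 ler_piMr.
case: (P i) (Q i) => [] []//= _; rewrite ?mul1r ?mul0r ?subr0 ?c0//.
  exact: ci.
exact: ci.
Qed.

End Cones.

Section ConeShear.
Variables (R : realType) (V : lmodType R) (I : finType).
Variables (m1 m2 : I -> V) (v : V) (P Q : pred I) (ell : {linear V -> R^o}).
Hypothesis PQ : forall i, ~~ (P i && Q i).
Hypothesis m12 : forall i, m2 i = m1 i + (P i)%:R *: v.
Hypothesis ell2 : forall i, ell (m2 i) = (P i)%:R - (Q i)%:R.
Hypothesis ellv : ell v = 0.
Hypothesis ex1 : forall i j, P i -> Q j -> exists k l, m1 i + m1 j + v = m1 k + m1 l.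
Hypothesis ex2 : forall i j, P i -> Q j -> exists k l, m2 i + m2 j - v = m2 k + m2 l.

Definition pl_shear (x : V) : V := x + Num.max (ell x : R) 0 *: v.

Let ell1 i : ell (m1 i) = (P i)%:R - (Q i)%:R.
Proof. by rewrite -ell2 m12 linearD linearZ /= ellv scaler0 addr0. Qed.

Let ell_sum m c : (forall i, ell (m i) = (P i)%:R - (Q i)%:R) ->
  ell (\sum_i c i *: m i) = (\sum_(i | P i) c i) - \sum_(i | Q i) c i.
Proof.
move=> em; rewrite linear_sum /= [X in _ = X - _]big_mkcond [X in _ = _ - X]big_mkcond -sumrB.
apply: eq_bigr => i _; rewrite linearZ /= em /GRing.scale /=.
by case: (P i) (Q i) => [] []; rewrite ?subrr ?mulr0 ?sub0r ?subr0 ?mulr1 ?mulrN1.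
Qed.

Let sum12 c : \sum_i c i *: m2 i = \sum_i c i *: m1 i + (\sum_(i | P i) c i) *: v.
Proof.
rewrite scaler_suml [X in _ = _ + X]big_mkcond -big_split /=; apply: eq_bigr => i _.
by rewrite m12 scalerDr scalerA; case: (P i); rewrite ?mulr1// mulr0 scale0r.
Qed.

Let max_min (a b : R) : Num.max (a - b) 0 = a - Num.min a b.
Proof.
have [ab|/ltW ba] := lerP a b; first by rewrite subrr max_r// subr_le0.
by rewrite max_l// subr_ge0.
Qed.

(** On a combination of the [m1 i], the form [ell] is the mass on [P] minus the
    mass on [Q]. Replacing [m1] by [m2] adds the mass on [P] times [v], of which
    the exchanges take the smaller mass away again. *)
Lemma pl_shear_cone x : in_cone m1 x -> in_cone m2 (pl_shear x).
Proof.
move=> [c c0 ->]; have := exchange_in_cone PQ c0 ex2.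
rewrite sum12 /pl_shear ell_sum// max_min scalerBl scalerN.
by rewrite addrA.
Qed.

Lemma pl_unshear_cone y : in_cone m2 y -> in_cone m1 (y - Num.max (ell y : R) 0 *: v).
Proof.
move=> [c c0 ->]; have := exchange_in_cone PQ c0 ex1.
by rewrite ell_sum// sum12 max_min scalerBl opprB -addrA
  (addrC (_ *: v)) subrK.
Qed.

End ConeShear.

(** * The fan triangulation and coordinates indexed by its arcs *)

Section Fan.
Variables (n : nat).
Hypothesis n3 : (3 < n)%N.

Definition vertex (k : nat) (kn : (k < n)%N) : 'I_n := Ordinal kn.

Definition fan : {set ngon_arc n} :=
  [set e : ngon_arc n | ((val e).1 == 0 :> nat) || ((val e).2 == (val e).1.+1 :> nat)]%SET.

Lemma fan_triangulation : triangulation fan.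
Proof.
apply/maxsetP; split.
  apply/andP; split.
    apply/'forall_implyP => e; rewrite inE => fe; apply/'forall_implyP => e'; rewrite inE => fe'.
    rewrite /crossing; move: fe fe'; case: e e' => [[i j] /= ij] [[k l] /= kl].
    move=> fe fe'; apply/negP => /and3P[]; move: fe fe'; clear; lia.
  apply/fintype.subsetP => -[[i j] /= ij]; rewrite !inE /= => /orP[]/eqP/(congr1 val) /=.
    case: n i j ij n3 => // n' i j ij n3'.
    have [ji|ji] := ltnP i.+1 n'.+1; first by rewrite modn_small// => ->; rewrite eqxx orbT.
    by have := ltn_ord j; move: ij ji; clear; lia.
  case: n i j ij n3 => // n' i j ij n3'.
  have [ji|ji] := ltnP j.+1 n'.+1; first by rewrite modn_small// => e; move: ij; rewrite e; clear; lia.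
  have -> : j.+1 = n'.+1 by have := ltn_ord j; move: ji; clear; lia.
  by rewrite modnn => ->.
move=> T /andP[/'forall_implyP nc _] fT; apply/eqP; rewrite finset.eqEsubset fT andbT.
apply/fintype.subsetP => e eT; rewrite inE; apply: contraT; rewrite negb_or => /andP[e0 e1].
have i1 : ((val e).1.+1 < n)%N.
  by case: e eT e0 e1 => [[i j] /= ij] _ _ _; apply: leq_ltn_trans ij (ltn_ord j).
have n0 : (0 < n)%N by exact: ltn_trans i1.
pose e' : ngon_arc n := exist _ (vertex n0, vertex i1) isT.
have e'T : e' \in T by apply: (fintype.subsetP fT); rewrite inE eqxx.
have /'forall_implyP/(_ e eT)/negP[] := nc e' e'T.
rewrite /crossing /= lt0n e0 ltnSn /=; move: e0 e1.
by case: (e) => [[i j] /= ij] _; rewrite ltn_neqAle eq_sym => ->.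
Qed.

Lemma ends_inj : injective (@ends n).
Proof.
move=> [[i j] /= ij] [[k l] /= kl]; rewrite /ends /= => E; apply: val_inj => /=.
have := finset.set21 i j; have := finset.set22 i j; rewrite E !inE.
have := finset.set21 k l; have := finset.set22 k l; rewrite -E !inE.
move=> /orP[]/eqP A /orP[]/eqP C /orP[]/eqP D /orP[]/eqP F; subst=> //.
all: try by move: ij kl; rewrite ?ltnn //.
all: by have := ltn_trans ij kl; rewrite ltnn.
Qed.

Lemma fan_mem (i j : nat) (lin : (i < n)%N) (ljn : (j < n)%N) (ij : (i < j)%N) :
  (i == 0)%N || (j == i.+1)%N ->
  (exist _ (vertex lin, vertex ljn) ij : ngon_arc n) \in fan.
Proof. by move=> h; rewrite inE. Qed.

End Fan.

Lemma card_fan n : #|{: edge (fan n.+2)}| = (n.+1 + n)%N.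
Proof.
have lt1 (k : 'I_n) : (k.+1 < n.+2)%N by rewrite !ltnS ltnW.
have lt2 (k : 'I_n) : (k.+2 < n.+2)%N by rewrite !ltnS ltn_ord.
pose g (x : 'I_n.+1 + 'I_n) : ngon_arc n.+2 := match x with
  | inl k => exist _ (ord0, lift ord0 k) isT
  | inr k => exist _ (vertex (lt1 k), vertex (lt2 k)) (ltnSn k.+1) end.
have g_inj : injective g.
  move=> x y /(congr1 (fun e => (nat_of_ord (val e).1, nat_of_ord (val e).2))).
  case: x y => [k|k] [l|l] //= [E]; first by rewrite (val_inj E).
  by rewrite (val_inj E).
rewrite card_sig; have -> : #|[pred x in fan n.+2]| = #|finset.imset g (mem [set: 'I_n.+1 + 'I_n]%SET)|.
  apply: eq_card => e; apply/idP/finset.imsetP; last first.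
    by move=> [[k|k] _ ->]; rewrite !inE //= eqxx orbT.
  rewrite !inE; case: e => -[i j] /= ij /orP[/eqP i0|/eqP ji].
    have jn : (j.-1 < n.+1)%N by have := ltn_ord j; move: ij; rewrite i0; case: (nat_of_ord j).
    exists (inl (Ordinal jn)); rewrite ?inE//; apply: val_inj; congr (_, _); apply: val_inj => //=.
    by rewrite /bump /=; move: ij; clear; lia.
  have [i0|i0] := posnP i.
    exists (inl ord0); rewrite ?inE//; apply: val_inj; congr (_, _); apply: val_inj => //=.
    by rewrite ji i0.
  have jn : (i.-1 < n)%N by have := ltn_ord j; rewrite ji -(prednK i0) !ltnS.
  exists (inr (Ordinal jn)); rewrite ?inE//; apply: val_inj; congr (_, _); apply: val_inj => /=.
    by rewrite prednK.
  by rewrite ji prednK.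
by rewrite card_imset// cardsT card_sum !card_ord.
Qed.

Section FanCoordinates.
Variables (R : realType) (n : nat).
Hypothesis n3 : (3 < n)%N.
Local Notation K := (edge (fan n)).

Let l0 : (0 < n)%N := @ltn_trans 3 0 n isT n3.
Let l1 : (1 < n)%N := @ltn_trans 3 1 n isT n3.
Let l2 : (2 < n)%N := @ltn_trans 3 2 n isT n3.

Definition arc01 : K := exist (fun e => e \in fan n) _ (@fan_mem n 0 1 l0 l1 isT isT).
Definition arc02 : K := exist (fun e => e \in fan n) _ (@fan_mem n 0 2 l0 l2 isT isT).
Definition arc03 : K := exist (fun e => e \in fan n) _ (@fan_mem n 0 3 l0 n3 isT isT).
Definition arc12 : K := exist (fun e => e \in fan n) _ (@fan_mem n 1 2 l1 l2 isT isT).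
Definition arc23 : K := exist (fun e => e \in fan n) _ (@fan_mem n 2 3 l2 n3 isT isT).

Lemma fan_quadrilateral : quadrilateral arc02 (vertex l0) (vertex l1) (vertex l2) (vertex n3).
Proof.
split; first by [].
split; first by [].
have J (k : K) i j : ends (val k) = [set i; j]%SET -> joined (fan n) i j.
  by move=> E; apply/exists_inP; exists (val k); [exact: valP|rewrite E].
split; [apply: (J arc01)|apply: (J arc12)|apply: (J arc23)|apply: (J arc03)] => //.
Qed.

Lemma basis_vecE (k : K) i j : ends (val k) = [set i; j]%SET ->
  basis_vec R (fan n) i j = [ffun e => (e == k)%:R].
Proof.
move=> E; apply/ffunP => e; rewrite !ffunE -E (inj_eq (@ends_inj n)).
by rewrite (inj_eq val_inj).
Qed.

End FanCoordinates.

Definition arc_map (R : realType) (K : finType) d (A : 'M[R]_(#|K|, d)) (x : 'cV[R]_d) :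
  {ffun K -> R^o} := [ffun e => (A *m x) (enum_rank e) 0].

Lemma arc_map_is_linear (R : realType) (K : finType) d (A : 'M[R]_(#|K|, d)) :
  linear (arc_map A).
Proof.
by move=> a x y; apply/ffunP => e; rewrite !ffunE mulmxDr -scalemxAr !mxE.
Qed.

HB.instance Definition _ (R : realType) (K : finType) d (A : 'M[R]_(#|K|, d)) :=
  GRing.isLinear.Build R 'cV[R]_d {ffun K -> R^o} _ (arc_map A) (arc_map_is_linear A).

Lemma arc_map_bij (R : realType) (K : finType) d (A : 'M[R]_(#|K|, d)) G :
  A *m G = 1%:M -> G *m A = 1%:M -> bijective (arc_map A).
Proof.
move=> AG GA; exists (fun y : {ffun K -> R^o} => G *m \col_r y (enum_val r)) => [x|y].
  rewrite -[RHS]mul1mx -GA -mulmxA; congr (_ *m _); apply/colP => r.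
  by rewrite mxE ffunE enum_valK.
by apply/ffunP => e; rewrite ffunE mulmxA AG mul1mx mxE enum_rankK.
Qed.

Lemma enumerate_seq (K : finType) (V : eqType) (x0 : V) (S : pred K) (s : seq V) :
  (size s <= #|S|)%N -> exists beta : K -> V,
    (forall k, beta k = x0 \/ beta k \in s) /\
    forall y, y \in s -> exists2 k, S k & beta k = y.
Proof.
move=> sS; exists (fun k => nth x0 s (index k (enum S))); split=> [k|y ys].
  have [lt|ge] := ltnP (index k (enum S)) (size s); first by right; apply: mem_nth.
  by left; apply: nth_default.
have lt : (index y s < size (enum S))%N.
  by rewrite -cardE; apply: leq_trans sS; rewrite index_mem.
have [k0 k0S] : exists k0, k0 \in S.
  by move: lt; rewrite -cardE; case: (pickP S) => [k Sk|/eq_card0->]; [exists k|].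
exists (nth k0 (enum S) (index y s)).
  by have := mem_nth k0 lt; rewrite mem_enum.
by rewrite index_uniq ?enum_uniq// nth_index.
Qed.

Section LatticeCoordinates.
Variables (R : realType) (n : nat).
Hypothesis n3 : (3 < n)%N.
Local Notation K := (edge (fan n)).
Variables (d N : nat) (M : 'M[R]_(d, N)) (L : set 'cV[R]_d) (ell : 'rV[R]_d).
Variables (D1 D2 : 'cV[R]_d) (s : seq 'cV[R]_d).
Hypotheses (dK : #|{: K}| = d) (rM : \rank M = d) (ML : forall e, L (col e M)).
Hypotheses (L0 : L 0) (LB : forall x y, L x -> L y -> L (x - y)).
Hypotheses (LD1 : L D1) (LD2 : L D2) (Ls : forall x, x \in s -> L x).
Hypothesis genL : forall x, L x -> lattice_hull [set y | y \in D1 :: D2 :: s] x.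
Hypothesis sz : ((size s).+2 <= d)%N.
Hypothesis ellL : forall x, L x -> (ell *m x) 0 0 \is a Num.int.
Hypotheses (ell1 : (ell *m D1) 0 0 = - 1) (ell2 : (ell *m D2) 0 0 = - 1).

Local Notation ab := (arc01 n3).
Local Notation bc := (arc12 n3).
Local Notation cd := (arc23 n3).
Local Notation ad := (arc03 n3).
Local Notation ac := (arc02 n3).
Local Notation v := (D1 - D2).

Let LN x : L x -> L (- x). Proof. by move=> Lx; rewrite -sub0r; apply: LB. Qed.
Let LD x y : L x -> L y -> L (x + y).
Proof. by move=> Lx Ly; rewrite -[y]opprK; apply/LB/LN. Qed.
Let LZ (a : R) x : a \is a Num.int -> L x -> L (a *: x).
Proof.
move=> /intrP[z ->] Lx; have LMn k : L (x *+ k) by elim: k => // k IHk; rewrite mulrS; apply: LD.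
by rewrite scaler_int; case: z => k; rewrite ?NegzE ?mulrNz; [|apply: LN]; apply: LMn.
Qed.

(** A basis of the lattice for which the coordinate of the diagonal [ac] is
    [ell] and whose vectors at the sides of the quadrilateral make [v] the
    direction of the shear. *)
Lemma fan_basis : exists gamma : K -> 'cV[R]_d,
  [/\ forall k, L (gamma k),
    forall x, L x -> lattice_hull [set gamma k | k in setT] x,
    v = - gamma ab - gamma cd + gamma ad + gamma bc &
    forall k, (ell *m gamma k) 0 0 = (k == ac)%:R].
Proof.
have [|beta [betaP betas]] := @enumerate_seq K _ 0 [pred k | (k != ac) && (k != ad)] s.
  have -> : #|[pred k : K | (k != ac) && (k != ad)]| = #|(~: [set ac; ad])%SET|.
    by apply: eq_card => k; rewrite !inE negb_or.
  rewrite cardsCs finset.setCK cards2 dK (_ : ac != ad)//; move: sz.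
  by move: (size s) => k; clear; lia.
have Lbeta k : L (beta k) by case: (betaP k) => [->//|/Ls].
(* Adding multiples of [D1], where [ell] is -1, makes [ell] vanish outside [ac];
   the vector at [ad] is the one determined by the formula for [v]. *)
pose g0 k := beta k + (ell *m beta k) 0 0 *: D1.
pose gamma k := if k == ac then - D1 else if k == ad then
  v + g0 ab + g0 cd - g0 bc else g0 k.
have Lg0 k : L (g0 k) by apply: LD => //; apply: LZ => //; apply: ellL.
have eg0 k : (ell *m g0 k) 0 0 = 0.
  rewrite mulmxDr -scalemxAr; move: ell1; move: (ell *m D1) (ell *m beta k) => x y e1.
  by rewrite !mxE e1 mulrN1 subrr.
have gE : [/\ gamma ac = - D1, gamma ad = v + g0 ab + g0 cd - g0 bc,
    gamma ab = g0 ab, gamma cd = g0 cd & gamma bc = g0 bc].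
  by split; rewrite /gamma ?eqxx.
have [gac gad gab gcd gbc] := gE.
have vE : v = - gamma ab - gamma cd + gamma ad + gamma bc.
  by rewrite gad gab gcd gbc; apply/colP => r; rewrite !mxE; ring.
exists gamma; split=> // [k|x Lx|k].
- rewrite /gamma; case: ifP => _; first exact: LN.
  case: ifP => _; last exact: Lg0.
  apply: LB; last exact: Lg0.
  by do 2 (apply: LD; last exact: Lg0); apply: LB.
- apply: lattice_hull_ind (genL Lx) => [|y y' Hy Hy'|y].
  + exact: lattice_hull0.
  + exact: lattice_hullB.
  have Hg k : lattice_hull [set gamma k | k in setT] (gamma k).
    by apply: lattice_hull_mem; exists k.
  have HD1 : lattice_hull [set gamma k | k in setT] D1.
    by rewrite -[D1]opprK -gac; apply: lattice_hullN.
  rewrite /= !inE => /or3P[/eqP->//|/eqP->|/betas[k /andP[kac kad] <-]].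
    have -> : D2 = D1 - v by rewrite opprB addrC subrK.
    apply: lattice_hullB => //; rewrite vE; apply: lattice_hullD => //.
    by apply: lattice_hullD => //; apply: lattice_hullB => //; apply: lattice_hullN.
  have gk : gamma k = g0 k by rewrite /gamma (negPf kac) (negPf kad).
  have -> : beta k = gamma k - (ell *m beta k) 0 0 *: D1 by rewrite gk addrK.
  have /intrP[c ->] := ellL (Lbeta k).
  apply: lattice_hullB => //; rewrite scaler_int; case: c => c; rewrite ?NegzE ?mulrNz.
    by elim: c => [|c IHc]; [exact: lattice_hull0|rewrite -pmulrn mulrS; apply: lattice_hullD].
  apply: lattice_hullN.
  by elim: (c.+1) => [|c' IHc]; [exact: lattice_hull0|rewrite -pmulrn mulrS; apply: lattice_hullD].
- have mulE x y : (ell *m (x + y)) 0 0 = (ell *m x) 0 0 + (ell *m y) 0 0 by rewrite mulmxDr mxE.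
  have mulN x : (ell *m - x) 0 0 = - (ell *m x) 0 0 by rewrite mulmxN mxE.
  rewrite /gamma; case: ifP => _; first by rewrite mulN ell1 opprK.
  case: ifP => _; rewrite ?eg0//; have [[e1 e2] e3] := ((eg0 ab, eg0 cd), eg0 bc).
  move: (g0 ab) (g0 cd) (g0 bc) e1 e2 e3 => x y t e1 e2 e3.
  by rewrite !mulE !mulN e1 e2 e3 ell1 ell2 subrr oppr0 !addr0.
Qed.

Lemma fan_coordinates : exists (A : 'M[R]_(#|{: K}|, d)) (G : 'M[R]_(d, #|{: K}|)),
  [/\ A *m G = 1%:M /\ G *m A = 1%:M,
    forall x, arc_map A x ac = (ell *m x) 0 0,
    arc_map A v = - basis_vec R (fan n) (val (val ab)).1 (val (val ab)).2
      - basis_vec R (fan n) (val (val cd)).1 (val (val cd)).2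
      + basis_vec R (fan n) (val (val ad)).1 (val (val ad)).2
      + basis_vec R (fan n) (val (val bc)).1 (val (val bc)).2 &
    forall x, L x <-> int_lattice R (fan n) (arc_map A x)].
Proof.
have [gamma [Lg gL vE eg]] := fan_basis.
pose G : 'M[R]_(d, #|{: K}|) := \matrix_(i, r) gamma (enum_val r) i 0.
have colG r : col r G = gamma (enum_val r) by apply/colP => i; rewrite !mxE.
have Gint x : L x -> exists a : 'cV[int]_#|{: K}|, x = G *m map_mx intr a.
  move=> /gL; elim/lattice_hull_ind => [|_ _ [a ->] [b ->]|_ [k _ <-]].
  - by exists 0; rewrite map_mx0 mulmx0.
  - by exists (a - b); rewrite map_mxB mulmxBr.
  exists (delta_mx (enum_rank k) 0); rewrite map_delta_mx -colE colG.
  by rewrite enum_rankK.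
have rG : \rank G = d.
  apply/eqP; rewrite eqn_leq rank_leq_row -{1}rM.
  have /choice[a aE] e := Gint _ (ML e).
  have -> : M = G *m (\matrix_(r, e) (a e r 0)%:~R).
    apply/matrixP => i e; have /(congr1 (fun x : 'cV_d => x i 0)) := aE e.
    by rewrite !mxE => ->; apply: eq_bigr => r _; rewrite !mxE.
  exact: mxrankM_maxl.
have Gfree : row_free G by rewrite /row_free rG.
have Gfull : row_full G by rewrite /row_full rG -dK.
have [A AG GA] : exists2 A, A *m G = 1%:M & G *m A = 1%:M.
  by exists (pinvmx G); [apply: mulVpmx|apply: mulmxVp].
have Ag k : A *m gamma k = delta_mx (enum_rank k) 0.
  by rewrite -{1}(enum_rankK k) -colG colE mulmxA AG mul1mx.
have arcg k : arc_map A (gamma k) = [ffun e => (e == k)%:R].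
  apply/ffunP => e; rewrite !ffunE Ag mxE eqxx andbT.
  by rewrite (inj_eq enum_rank_inj).
exists A, G; split=> // [x||x].
- rewrite ffunE -[x in RHS]mul1mx -GA !mulmxA.
  have -> : ell *m G = delta_mx 0 (enum_rank ac).
    apply/rowP => r; have := eg (enum_val r); rewrite -colG colE mulmxA -colE !mxE eqxx /= => ->.
    by rewrite -(inj_eq enum_rank_inj) enum_valK.
  by rewrite -rowE -row_mul [RHS]mxE.
- have bE k := basis_vecE R (erefl : ends (val k) = [set (val (val k)).1; (val (val k)).2]%SET).
  have aD x y : arc_map A (x + y) = arc_map A x + arc_map A y by rewrite linearD.
  have aN x : arc_map A (- x) = - arc_map A x by rewrite linearN.
  by rewrite {1}vE !aD !aN !arcg !bE.
split=> [/Gint[a ->] e|int].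
  by rewrite ffunE mulmxA AG mul1mx mxE intr_int.
have -> : x = \sum_r (A *m x) r 0 *: gamma (enum_val r).
  rewrite -[LHS]mul1mx -GA -mulmxA; apply/colP => i; rewrite !mxE summxE.
  by apply: eq_bigr => r _; rewrite !mxE mulrC.
elim/big_ind: _ => // r _.
by apply: LZ => //; have := int (enum_val r); rewrite ffunE enum_valK.
Qed.

End LatticeCoordinates.

(** * Points of the cone over the Grassmannian with a prescribed valuation *)

Section UltrametricPolynomials.
Variables (F : numFieldType) (n : nat) (o : 'I_n) (H : 'I_n -> 'I_n -> nat).
Hypothesis HC : forall i j, H i j = H j i.
Hypothesis Hmin : forall i j k, triple o i j k -> (minn (H i j) (H j k) <= H i k)%N.

Definition in_ball (g : nat) (i k : 'I_n) := (k != o) && ((k == i) || (g < H i k)%N).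

(** A number for the ball around [i], namely the position of its first element. *)
Definition ball_index g i := find (in_ball g i) (enum 'I_n).

Lemma ball_index_eq g i j : i != o -> j != o -> i != j -> (g < H i j)%N ->
  ball_index g i = ball_index g j.
Proof.
move=> io jo ij gij; apply: eq_find => k; rewrite /in_ball; have [//|ko] := eqVneq k o.
have sub a b : a != o -> b != o -> a != b -> (g < H a b)%N ->
    (k == a) || (g < H a k)%N -> (k == b) || (g < H b k)%N.
  move=> ao bo ab gab /predU1P[->|gak]; first by rewrite HC gab orbT.
  have [//|kb] := eqVneq k b; have [ka|ka] := eqVneq k a; first by rewrite ka HC gab.
  apply: leq_trans (Hmin (_ : triple o b a k)); first by rewrite leq_min HC gab.
  by rewrite /triple bo ao ko eq_sym ab eq_sym kb eq_sym ka.
by apply/idP/idP; apply: sub => //; rewrite 1?eq_sym// HC.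
Qed.

Lemma ball_index_neq i j : i != o -> j != o -> i != j ->
  ball_index (H i j) i != ball_index (H i j) j.
Proof.
move=> io jo ij; apply/eqP => E.
have hi : has (in_ball (H i j) i) (enum 'I_n).
  by apply/hasP; exists i; rewrite ?mem_enum// /in_ball io eqxx.
have hj : has (in_ball (H i j) j) (enum 'I_n).
  by apply/hasP; exists j; rewrite ?mem_enum// /in_ball jo eqxx.
have := nth_find i hi; have := nth_find i hj.
rewrite -/(ball_index _ _) -E; set k := nth _ _ _.
move=> /andP[ko kj] /andP[_ ki].
have kni : k != i.
  by apply/eqP => ke; move: kj; rewrite ke (negPf ij) HC ltnn.
have knj : k != j.
  by apply/eqP => ke; move: ki; rewrite ke eq_sym (negPf ij) ltnn.
move: ki kj; rewrite (negPf kni) (negPf knj) /= => ki kj.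
have /Hmin : triple o i k j by rewrite /triple io jo ko ij knj eq_sym kni.
by rewrite leqNgt leq_min ki (HC k j) kj.
Qed.

Definition radius_bound := (\max_(p : 'I_n * 'I_n) H p.1 p.2).+1.

(** The coefficients of two leaves agree up to the height at which they separate. *)
Definition ball_poly i : {poly F} := \poly_(g < radius_bound) (ball_index g i)%:R.

Lemma ball_poly_valuation i j : i != o -> j != o -> i != j ->
  exists2 r : {poly F}, ball_poly i - ball_poly j = 'X^(H i j) * r & r`_0 != 0.
Proof.
move=> io jo ij; have Hlt : (H i j < radius_bound)%N.
  by rewrite ltnS (leq_bigmax (i, j)).
exists (drop_poly (H i j) (ball_poly i - ball_poly j)).
  rewrite -[LHS](poly_take_drop (H i j)) mulrC -[RHS]add0r; congr (_ + _).
  apply/polyP => g; rewrite coef_take_poly coef0 coefB !coef_poly.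
  case: ifP => // glt; rewrite (ltn_trans glt Hlt).
  by rewrite (ball_index_eq io jo ij glt) subrr.
rewrite coef_drop_poly add0n coefB !coef_poly Hlt subr_eq0 eqr_nat.
exact: ball_index_neq.
Qed.

End UltrametricPolynomials.

Section Realization.
Variables (R : realType) (n : nat) (o : 'I_n) (H : 'I_n -> 'I_n -> nat).
Hypothesis o0 : o = 0%N :> nat.
Hypothesis HC : forall i j, H i j = H j i.
Hypothesis Hmin : forall i j k, triple o i j k -> (minn (H i j) (H j k) <= H i k)%N.
Variables (b : 'I_n -> nat) (g0 : nat).
Local Notation N := #|ngon_arc n|.
Local Notation C := R[i].
Local Notation x := (ball_poly C o H).

(** The columns of a 2 by [n] matrix of polynomials. The points on the projective
    line are the polynomials of the leaves, and infinity for the root; the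
    powers of the variable rescale them. *)
Definition hcoord i : {poly C} := if i == o then 'X^g0 else x i * 'X^(b i).
Definition vcoord i : {poly C} := if i == o then 0 else 'X^(b i).
Definition minor i j := hcoord i * vcoord j - hcoord j * vcoord i.

Definition minor_at (e : 'I_N) := minor (val (enum_val e)).1 (val (enum_val e)).2.

Definition minor_weight (i j : 'I_n) : nat :=
  if i == o then (g0 + b j)%N else (b i + b j + H i j)%N.

Variable V : 'I_N -> nat.
Hypothesis VE : forall e, V e = minor_weight (val (enum_val e)).1 (val (enum_val e)).2.

Lemma minor_valuation e : exists2 r, minor_at e = 'X^(V e) * r & r`_0 != 0.
Proof.
rewrite VE /minor_at; case: (enum_val e) => -[i j] /= ij.
have jo : j != o by apply: contraTneq ij => ->; rewrite o0.
rewrite /minor /hcoord /vcoord /minor_weight (negPf jo).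
have [io|io] := eqVneq i o.
  by exists 1; rewrite ?coef1 ?oner_neq0// mulr0 subr0 mulr1 exprD.
have nij : i != j by apply: contraTneq ij => ->; rewrite ltnn.
have [r rE r0] := ball_poly_valuation C HC Hmin io jo nij.
exists r => //; rewrite !exprD -!mulrA -rE; ring.
Qed.

Local Notation Phi := (mmap (@polyC C) minor_at).

Lemma minor_monomial_valuation m :
  exists r, mmap1 minor_at m = 'X^(\sum_e V e * m e)%N * r.
Proof.
have /choice[r rE] e : exists r, minor_at e = 'X^(V e) * r.
  by have [r] := minor_valuation e; exists r.
exists (\prod_e r e ^+ m e); rewrite /mmap1.
under [LHS]eq_bigr do rewrite rE exprMn -exprM.
by rewrite big_split /= prodrXr.
Qed.

Lemma minor_relations f : I2 R n f -> Phi f = 0.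
Proof.
have pvarE (i j : 'I_n) : (i < j)%N -> Phi (pvar R i j) = minor i j.
  by move=> ij; rewrite pvar_pair// pair_mnm_lt mmapX mmap1U /minor_at enum_rankK.
move=> [k [a [g [Ig ->]]]]; rewrite raddf_sum big1// => i _.
have [p [q [r [s [/andP[pq qr] [rs ->]]]]]] := Ig i.
rewrite /= rmorphM /=; apply/eqP; rewrite mulf_eq0; apply/orP; right.
have [pr qs] := (ltn_trans pq qr, ltn_trans qr rs); have ps := ltn_trans pr rs.
have PhiM f1 f2 : Phi (f1 * f2) = Phi f1 * Phi f2 by exact: rmorphM.
rewrite mmapD mmapB !PhiM !pvarE// /minor; apply/eqP.
move: (hcoord p) (hcoord q) (hcoord r) (hcoord s) (vcoord p) (vcoord q) (vcoord r) (vcoord s).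
by move=> *; ring.
Qed.

(** The minors satisfy the Pluecker relations, so that [f] and the variable have
    the same image. Its coefficient at the exponent [V e] is nonzero, and it must
    come from a term of [f]. *)
Lemma congruent_term e f : I2 R n (f - mpolyX _ (mnm1 e)) ->
  exists2 m, m \in msupp f & (\sum_i V i * m i <= V e)%N.
Proof.
move=> /minor_relations; rewrite rmorphB /= mmapX mmap1U => /eqP; rewrite subr_eq0 => /eqP fe.
apply: contrapT => no; have [r re r0] := minor_valuation e.
have : (Phi f)`_(V e) = r`_0.
  by rewrite fe re coefXnM ltnn subnn.
suff -> : (Phi f)`_(V e) = 0 by move=> /esym/eqP; rewrite (negPf r0).
rewrite /mmap coef_sum big1_seq// => m /andP[_ mf].
have [r' ->] := minor_monomial_valuation m.
rewrite coefCM coefXnM; case: ltnP => [_|le]; first by rewrite mulr0.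
by case: no; exists m.
Qed.

End Realization.

(** * The value semigroup *)

(** Writing numbers in base [K], with digits above [- K], the first nonzero digit
    decides the sign. *)
Lemma positional_gt0 (K : int) (v : nat -> int) (k m : nat) :
  0 <= K -> (forall i, - K < v i) -> (forall i, (i < k)%N -> v i = 0) -> 0 < v k -> (k <= m)%N ->
  0 < \sum_(i < m.+1) K ^+ (m - i) * v i.
Proof.
move=> K0 vK v0 vk; elim: m => [|m IHm] km.
  by move: km vk; rewrite leqn0 => /eqP->; rewrite big_ord1 subnn mul1r.
rewrite big_ord_recr /= subnn mul1r.
have -> : \sum_(i < m.+1) K ^+ (m.+1 - i) * v i = K * \sum_(i < m.+1) K ^+ (m - i) * v i.
  by rewrite mulr_sumr; apply: eq_bigr => i _; rewrite subSn 1?exprS ?mulrA -1?ltnS.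
move: km; rewrite leq_eqVlt => /predU1P[<-|km].
  by rewrite big1 ?mulr0 ?add0r// => i _; rewrite v0 ?mulr0//.
have := vK m.+1; have := IHm km.
by move: (\sum_(i < _) _) (v _) K0 => S y; clear; nia.
Qed.

Definition lex_positive d (v : 'cV[int]_d) :=
  exists2 k : 'I_d, forall i : 'I_d, (i < k)%N -> v i 0 = 0 & 0 < v k 0.

(** The powers of a base that exceeds all entries decide finitely many
    lexicographic comparisons at once. *)
Lemma lex_weight d (l : seq 'cV[int]_d) : (forall v, v \in l -> lex_positive v) ->
  exists2 c : 'rV[int]_d, forall k, 0 <= c 0 k & forall v, v \in l -> 0 < (c *m v) 0 0.
Proof.
case: d l => [|d] l lpos.
  by exists 0 => [|v /lpos[[]]]; [case|].
pose K : int := 1 + \sum_(v <- l) \sum_i `|v i 0|.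
have K0 : 0 <= K by rewrite addr_ge0// sumr_ge0// => v _; rewrite sumr_ge0.
exists (\row_k K ^+ (d - k)) => [k|v vl]; first by rewrite mxE exprn_ge0.
have [k v0 vk] := lpos v vl.
have vK (j : 'I_d.+1) : - K < v j 0.
  have le : `|v j 0| <= \sum_(v <- l) \sum_i `|v i 0|.
    rewrite (big_rem v)//= (bigD1 j)//= -addrA lerDl addr_ge0 ?sumr_ge0// => v' _.
    by rewrite sumr_ge0.
  have := ler_norm (- v j 0); rewrite normrN => le'.
  by rewrite ltrNl; apply: (le_lt_trans le'); apply: (le_lt_trans le); rewrite /K ltrDr.
have H : 0 < \sum_(i < d.+1) K ^+ (d - i) * v (inord i) 0.
  apply: (@positional_gt0 K (fun i => v (inord i) 0) k) => // [i ik||].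
  - by apply: v0; rewrite inordK// (ltn_trans ik).
  - by rewrite inord_val.
  - by rewrite -ltnS.
rewrite mxE (eq_bigr (fun i : 'I_d.+1 => K ^+ (d - i) * v (inord i) 0))// => i _.
by rewrite mxE inord_val.
Qed.

Section Values.
Variables (R : realType) (n : nat) (o : 'I_n).
Hypothesis o0 : o = 0%N :> nat.
Local Notation N := #|ngon_arc n|.
Local Notation pm := (@pair_mnm n).
Variables (w : 'rV[R]_N) (M : 'M[int]_(rk n, N)).
Local Notation MR := (map_mx intr M : 'M[R]_(rk n, N)).
Hypotheses (uw : ultrametric o w) (wM : forall k, tree_cone o w (row k MR)).
Hypothesis M0 : row ord0 M = const_mx 1.

Lemma lex_le_total (a b : 'cV[int]_(rk n)) : lex_le b a \/ lex_positive (b - a).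
Proof.
rewrite /lex_le; have [le|lt] := leP ([tuple b i 0 | i < rk n] : (rk n).-tuplelexi int)
  ([tuple a i 0 | i < rk n] : (rk n).-tuplelexi int); [by left|right].
have /ltxi_tuplePlt[k eqk ltk] := lt; exists k => [i /eqk|]; rewrite !mxE.
  by rewrite !tnth_mktuple => ->; rewrite subrr.
by move: ltk; rewrite !tnth_mktuple subr_gt0.
Qed.

Lemma map_mon_value m : map_mx intr (mon_value M m) = mval MR m.
Proof. by rewrite map_mxM; congr (_ *m _); apply/colP => i; rewrite !mxE. Qed.

Section Weight.
Variable c : 'rV[int]_(rk n).
Hypothesis c0 : forall k, 0 <= c 0 k.

Let u m : int := (c *m mon_value M m) 0 0.
Let du i j := u (pm i j) - u (pm o i) - u (pm o j).
Let uR : 'rV[R]_N := \sum_k (c 0 k)%:~R *: row k MR.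

Let uRE m : weight uR m = (u m)%:~R.
Proof.
rewrite weight_lin /u mxE raddf_sum /=; apply: eq_bigr => k _.
by rewrite intrM -mvalE -map_mon_value mxE.
Qed.

Let duE i j : delta o uR i j = (du i j)%:~R.
Proof. by rewrite /delta !uRE /du !rmorphB. Qed.

Let du_ultrametric i j k : triple o i j k -> Num.min (du i j) (du j k) <= du i k.
Proof.
move=> t; have uu : ultrametric o uR.
  apply: (tree_cone_ultrametric uw) => i' j' k' t' ch; rewrite /cherry !delta_lin; split.
    by apply: eq_bigr => r _; have [->] := wM r t' ch.
  by apply: ler_sum => r _; apply: ler_wpM2l; [rewrite ler0z|have [] := wM r t' ch].
by have := ultrametric_min uu t; rewrite !duE !ge_min !ler_int.
Qed.

Let uE m : u m = \sum_e u (mnm1 e) * (m e)%:Z.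
Proof.
have cM m' : u m' = ((c *m M) *m \col_i (m' i)%:Z) 0 0 by rewrite -mulmxA.
have u1 e : u (mnm1 e) = (c *m M) 0 e.
  rewrite cM mxE (bigD1 e)//= big1 => [|k /negPf ke]; last by rewrite mxE mnm1E eq_sym ke mulr0.
  by rewrite mxE mnm1E eqxx mulr1 addr0.
by rewrite cM mxE; apply: eq_bigr => e _; rewrite u1 [X in _ * X = _]mxE.
Qed.

Let B : int := \sum_e `|u (mnm1 e)|.

Let uB i j : i != j -> - B <= u (pm i j) <= B.
Proof.
move=> ij; have [e -> _] := pair_mnmE ij; rewrite -ler_norml /B (bigD1 e)//= lerDl.
by rewrite sumr_ge0.
Qed.

(** A combination [u] of the rows with nonnegative coefficients is a metric of the
    tree. Adding a large multiple of the degree turns it into exponents of a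
    point of the Grassmannian; the term found there has weight at most that of
    the variable when its degree is positive. *)
Lemma weight_congruent_term e f : I2 R n (f - mpolyX _ (mnm1 e)) ->
  exists2 m, m \in msupp f &
    (0 < mdeg m)%N -> (c *m mon_value M m) 0 0 <= (c *m mon_value M (mnm1 e)) 0 0.
Proof.
move=> If; have B0 : 0 <= B by rewrite sumr_ge0.
pose H i j := if (i == o) || (j == o) || (i == j) then 0%N else absz (du i j + 3 * B).
have HC i j : H i j = H j i.
  have duC : du i j = du j i by rewrite /du pair_mnmC addrAC.
  by rewrite /H (orbC (i == o)) (eq_sym i j) duC.
have HE i j : i != o -> j != o -> i != j -> (H i j)%:Z = du i j + 3 * B.
  move=> io jo ij; rewrite /H (negPf io) (negPf jo) (negPf ij) /= gez0_abs// /du.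
  have := uB ij; have oi : o != i by rewrite eq_sym.
  have oj : o != j by rewrite eq_sym.
  have := uB oi; have := uB oj; move: (u _) (u _) (u _) (B); clear; lia.
have Hmin i j k : triple o i j k -> (minn (H i j) (H j k) <= H i k)%N.
  move=> t; have [[io jo ko] ij ik jk] := tripleP t; have := du_ultrametric t.
  have := HE _ _ io jo ij; have := HE _ _ jo ko jk; have := HE _ _ io ko ik.
  move: (H _ _) (H _ _) (H _ _) (du _ _) (du _ _) (du _ _) (B); clear; lia.
(* The shifts of the factors of a minor add up to [5 * B] in both cases: [B] for
   each of two leaves and [3 * B] for their height, or [4 * B] and [B] at the
   root. *)
pose b j := absz (u (pm o j) + B); pose g0 := absz (4 * B).
pose V e := absz (u (mnm1 e) + 5 * B).
have VE e' : V e' = minor_weight o H b g0 (val (enum_val e')).1 (val (enum_val e')).2.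
  rewrite /V; have [i [j [-> -> lt ->]]] : exists i j : 'I_n, [/\ (val (enum_val e')).1 = i,
      (val (enum_val e')).2 = j, (i < j)%N & mnm1 e' = pm i j].
    case E : (enum_val e') => [[i j] /= lt]; exists i, j; split=> //.
    by rewrite pair_mnm_lt -E enum_valK.
  have ij : i != j by move: lt; apply: contraTneq => ->; rewrite ltnn.
  have jo : j != o by move: lt; apply: contraTneq => ->; rewrite o0.
  have oj : o != j by rewrite eq_sym.
  have Bij := uB ij; have Boj := uB oj; rewrite /minor_weight /g0 /b.
  have [->|io] := eqVneq i o.
    by move: (u _) (B) Boj B0; clear; lia.
  have oi : o != i by rewrite eq_sym.
  have Boi := uB oi; have := HE i j io jo ij; rewrite /du.
  by move: (u _) (u _) (u _) (H i j) (B) Bij Boj Boi B0; clear; lia.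
have [m mf le] := congruent_term o0 HC Hmin VE If.
exists m => // deg_m; have VZ e' : (V e')%:Z = u (mnm1 e') + 5 * B.
  have [i [j [ij E]]] := mnm1_pair e'; have := uB ij; rewrite /V E.
  by move: (u _) (B) B0; clear; lia.
have : (\sum_i V i * m i)%N%:Z <= (V e)%:Z by rewrite lez_nat.
rewrite -/(u m) -/(u (mnm1 e)); suff : u m + 5 * B * (mdeg m)%:Z <= (\sum_i V i * m i)%N%:Z.
  rewrite VZ; move: (u m) (u _) (\sum_i _)%N (B) B0 (mdeg m) deg_m; clear; nia.
rewrite uE mdegE !(big_morph Posz PoszD (erefl 0)) mulr_sumr.
rewrite -big_split /= ler_sum// => i _.
by rewrite PoszM VZ [leRHS]mulrDl lexx.
Qed.

End Weight.

(** If all terms were lexicographically larger than the variable, one nonnegative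
    weight vector would make all of them heavier. The first entry of a value is
    the degree, so that no term could be constant. *)
Lemma congruent_lex_term e f : I2 R n (f - mpolyX _ (mnm1 e)) ->
  exists2 m, m \in msupp f & lex_le (mon_value M m) (mon_value M (mnm1 e)).
Proof.
move=> If; apply: contrapT => no.
have pos m : m \in msupp f -> lex_positive (mon_value M m - mon_value M (mnm1 e)).
  by move=> mf; have [le|//] := lex_le_total (mon_value M (mnm1 e)) (mon_value M m); case: no; exists m.
have [|c c0 cpos] := @lex_weight _ [seq mon_value M m - mon_value M (mnm1 e) | m <- msupp f].
  by move=> v /mapP[m /pos mp ->].
have [m mf le] := weight_congruent_term c0 If.
have mon0 m' : mon_value M m' ord0 0 = (mdeg m')%:Z.
  rewrite mxE mdegE (big_morph Posz PoszD (erefl 0)); apply: eq_bigr => i _.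
  by have /rowP/(_ i) := M0; rewrite !mxE => ->; rewrite mul1r.
have deg_m : (0 < mdeg m)%N.
  have : 0 <= (mon_value M m - mon_value M (mnm1 e)) ord0 0.
    have [k v0 vk] := pos m mf; have [k0|k0] := posnP k; last by rewrite v0.
    by rewrite (_ : ord0 = k) ?ltW//; apply: val_inj.
  by rewrite mxE [X in _ + X]mxE !mon0 mdeg1; move: (mdeg m); clear; lia.
have := cpos _ (map_f _ mf); rewrite mulmxBr mxE [X in _ + X]mxE subr_gt0.
by rewrite ltNge le.
Qed.

(** The value of a variable is the maximum over all representatives of its class;
    the variable itself attains it. *)
Lemma column_value e : values R M (mval MR (mnm1 e)).
Proof.
rewrite -map_mon_value; exists (mon_value M (mnm1 e)) => //.
exists (mpolyX _ (mnm1 e)).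
  move=> IX; have [] := @congruent_lex_term e 0; last by move=> m; rewrite msupp0.
  by rewrite sub0r -mulN1r; apply: ideal_genM.
split; first exists (mpolyX _ (mnm1 e)).
- by rewrite subrr; apply: ideal_gen0.
- split; first by exists (mnm1 e); rewrite // msuppX mem_head.
  by move=> m; rewrite msuppX inE => /eqP->; rewrite /lex_le lexx.
move=> F b IF [_ bmin]; have [m mF le] := congruent_lex_term IF.
exact: le_trans (bmin m mF) le.
Qed.

Lemma value_monomial x : values R M x -> exists m, x = mval MR m.
Proof.
by move=> [a [f _ [[F _ [[m _ ->] _]] _]] <-]; exists m; rewrite map_mon_value.
Qed.

Lemma in_cone_values x :
  cone_hull (values R M) x <-> in_cone (fun e => mval MR (mnm1 e)) x.
Proof.
split=> [[k [c [a [ca ->]]]]|[c c0 ->]].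
  apply: in_cone_sum => i _; have [ci /value_monomial[m ->]] := ca i.
  apply: in_coneZ => //; rewrite mval_sum; apply: in_cone_sum => e _.
  by rewrite -scaler_nat; apply: in_coneZ => //; apply: in_cone_mem.
exists #|ngon_arc n|, c, (fun e => mval MR (mnm1 e)); split=> // e.
by split; [exact: c0|exact: column_value].
Qed.

Lemma lattice_hull_values x : lattice_hull (values R M) x <->
  lattice_hull [set mval MR (mnm1 e) | e in setT] x.
Proof.
split; apply: lattice_hull_ind => [|y z|a]; try exact: lattice_hull0; try exact: lattice_hullB.
  move=> /value_monomial[m ->]; rewrite mval_sum; elim/big_ind: _ => [|y z|e _].
  - exact: lattice_hull0.
  - exact: lattice_hullD.
  elim: (m e) => [|k IHk]; first exact: lattice_hull0.
  by rewrite mulrS; apply: lattice_hullD IHk; apply: lattice_hull_mem; exists e.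
by move=> [e _ <-]; apply: lattice_hull_mem; apply: column_value.
Qed.

Lemma NO_bodyE x : NO_body R M x <-> in_cone (fun e => mval MR (mnm1 e)) x /\ x ord0 0 = 1.
Proof. by split=> -[/in_cone_values]. Qed.

Lemma column_ord0 e : mval MR (mnm1 e) ord0 0 = 1.
Proof.
by rewrite mval_mnm1 !mxE; have /rowP/(_ e) := M0; rewrite !mxE => ->.
Qed.

Lemma lattice_hull_pair i j : i != j -> lattice_hull (values R M) (mval MR (pm i j)).
Proof.
by move=> /pair_mnmE[c -> _]; apply: lattice_hull_mem; apply: column_value.
Qed.

Lemma lattice_hull_Delta i j : i != o -> j != o -> i != j ->
  lattice_hull (values R M) (Delta o MR i j).
Proof.
by move=> io jo ij; rewrite /Delta; apply: lattice_hullB; [apply: lattice_hullB|];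
  apply: lattice_hull_pair; rewrite // eq_sym.
Qed.

End Values.

(** * A prime initial ideal is determined by its tree *)

Section LinkedMonomials.
Variables (R : realType) (n : nat) (o : 'I_n).
Local Notation N := #|ngon_arc n|.
Local Notation pm := (@pair_mnm n).
Local Notation S := (mpoly N R[i]).
Local Notation X m := (mpolyX R[i] m : S).
Variables (d : nat) (w : 'rV[R]_N) (M : 'M[R]_(d, N)) (Q : set S).
Hypotheses (uw : ultrametric o w) (ad : rows_adapted o M w).
Hypotheses (rM : \rank M = d) (dn : d = (n.-1 + n.-2)%N) (n1 : (1 < n)%N).
Hypotheses (Q0 : Q 0) (QB : forall f g, Q f -> Q g -> Q (f - g)).
Hypothesis QM : forall f g, Q g -> Q (f * g).
Hypothesis Qcherry : forall i j k, triple o i j k -> cherry o w i j k ->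
  exists2 s, s != 0 &
    Q (X (mnm_add (pm o j) (pm i k)) - s *: X (mnm_add (pm o i) (pm j k))).

(** Proportionality of two monomials in the localization at all variables of
    the quotient by [Q]; the columns of [M] grade this quotient. *)
Definition linked m m' := mval M m = mval M m' /\
  exists mu s, s != 0 /\ Q (X (mu +m m) - s *: X (mu +m m')).

Lemma linked_refl m : linked m m.
Proof.
by split=> //; exists mnm0, 1; rewrite oner_neq0 scale1r subrr.
Qed.

Lemma QZ c g : Q g -> Q (c *: g).
Proof. by move=> Qg; rewrite -mul_mpolyC; apply: QM. Qed.

Lemma linked_sym m m' : linked m m' -> linked m' m.
Proof.
move=> [e [mu [s [s0 H]]]]; split; first by rewrite e.
exists mu, s^-1; split; first by rewrite invr_neq0.
have := QZ (- s^-1) H; rewrite scalerBr scalerA mulNr mulVf// scaleN1r opprK scaleNr.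
by rewrite addrC.
Qed.

Lemma linked_trans m' m m'' : linked m m' -> linked m' m'' -> linked m m''.
Proof.
move=> [e [mu [s [s0 H]]]] [e' [nu [t [t0 H']]]]; split; first by rewrite e.
exists (mu +m nu), (s * t); split; first by rewrite mulf_neq0.
have := QB (QM (X nu) H) (QM (- s *: X mu) H').
rewrite !mulrBr -!scalerAr -!scalerAl -!mpolyXD scalerA.
have -> : (nu +m (mu +m m) = mu +m nu +m m) by rewrite addmA (addmC nu).
have -> : (nu +m (mu +m m') = mu +m (nu +m m')) by rewrite !addmA (addmC nu).
rewrite -[mu +m nu +m m'']addmA; move: (X _) (X _) (X _) => x y v.
by rewrite opprB mulrN !scaleNr opprK addrA addrAC subrK (mulrC s).
Qed.

Lemma linked_addr k m m' : linked m m' <-> linked (m +m k) (m' +m k).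
Proof.
split=> -[e [mu [s [s0 H]]]]; split.
- by rewrite !mvalD e.
- exists mu, s; split=> //; have := QM (X k) H.
  by rewrite mulrBr -scalerAr -!mpolyXD !(addmC k) -!addmA.
- by move: e; rewrite !mvalD => /addIr.
by exists (mu +m k), s; rewrite -!addmA !(addmC k).
Qed.

Lemma linked_add m m' k k' : linked m m' -> linked k k' -> linked (m +m k) (m' +m k').
Proof.
move=> H H'; apply: (@linked_trans (m' +m k)); first exact: (linked_addr k m m').1.
by rewrite (addmC m' k) (addmC m' k'); apply: (linked_addr m' k k').1.
Qed.

Lemma cherry_linked i j k : triple o i j k -> cherry o w i j k ->
  linked (mnm_add (pm o j) (pm i k)) (mnm_add (pm o i) (pm j k)).
Proof.
move=> t c; split; last first.
  by have [s s0 H] := Qcherry t c; exists mnm0, s; rewrite !add0m.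
have := cherry_Delta ad t c; rewrite /Delta !mvalD => /eqP.
rewrite (inj_eq (addIr _)) subr_eq addrAC eq_sym subr_eq => /eqP e.
by rewrite addrC -e addrC.
Qed.

Definition fan_mnm (t : seq (multinom N)) (a : nat -> nat) : multinom N :=
  \big[@mnm_add N/@mnm0 N]_(0 <= r < size t) mnm_muln (nth (@mnm0 N) t r) (a r).

Lemma fan_mnmD t a a' : fan_mnm t a +m fan_mnm t a' = fan_mnm t (fun r => a r + a' r)%N.
Proof.
rewrite /fan_mnm -big_split /=; apply: eq_bigr => r _.
by apply/mnmP => i; rewrite mnmDE !mulmnE mulnDr.
Qed.

Lemma mvalMn m k : mval M (mnm_muln m k) = mval M m *+ k.
Proof.
elim: k => [|k IHk]; last by rewrite mulmS mvalD IHk mulrS.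
by apply/colP => i; rewrite mvalE !mxE /weight big1// => e _; rewrite mulm0n mnm0E mulr0.
Qed.

Lemma mval_fan t a : mval M (fan_mnm t a) =
  seq_mx [seq mval M m | m <- t] *m \col_r (a r)%:R.
Proof.
have mval0 : mval M mnm0 = 0 by rewrite -(mulm0n (@mnm0 N)) mvalMn mulr0n.
rewrite seq_mx_mul /fan_mnm (big_morph (mval M) (mvalD M) mval0).
rewrite -{1}(size_map (mval M) t) big_mkord; apply: eq_bigr => r _.
rewrite mvalMn mxE scaler_nat; congr (_ *+ _).
by rewrite (nth_map mnm0)// -(size_map (mval M)).
Qed.

Lemma fan_mnm_mem t m : m \in t -> exists a, m = fan_mnm t a.
Proof.
move=> mt; exists (fun r => (r == index m t)); rewrite /fan_mnm big_mkord.
have lt : (index m t < size t)%N by rewrite index_mem.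
rewrite (bigD1 (Ordinal lt))//= eqxx mulm1n nth_index// big1 ?addm0// => r rm.
suff -> : (r == index m t :> nat) = false by rewrite mulm0n.
by apply: contraNF rm => /eqP ri; apply/eqP/val_inj.
Qed.

(** The class of the ratio of p_ij and p_oi p_oj depends only on the point where
    [i] and [j] branch. By [kruskal], [n-2] such variables and the [n-1] variables
    at the root therefore generate all monomials up to [linked]. *)
Lemma fan_normal_form : exists t : seq (multinom N), size t = d /\
  forall m, exists a b, linked (m +m fan_mnm t a) (fan_mnm t b).
Proof.
pose E (x y : 'I_n * 'I_n) := linked (pm x.1 x.2 +m pm o y.1 +m pm o y.2) (pm y.1 y.2 +m pm o x.1 +m pm o x.2).
have [l lo] : exists l : 'I_n, l != o.
  have : (0 < #|[set~ o]%SET|)%N by rewrite cardsC1 card_ord; move: n1; clear; lia.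
  by rewrite card_gt0 => /finset.set0Pn[l]; rewrite !inE; exists l.
have [||||||||s [ss s_o sX]] := @kruskal _ _ o w E uw _ _ _ _ _ [set l]%SET [::].
- by move=> x; apply: linked_refl.
- by move=> x y; apply: linked_sym.
- move=> y x z; rewrite /E => xy yz.
  apply: (linked_addr (pm o y.1 +m pm o y.2) _ _).2.
  have A := linked_add xy (linked_refl (pm o z.1 +m pm o z.2)).
  have B := linked_add yz (linked_refl (pm o x.1 +m pm o x.2)).
  have comm a b c e f : a +m b +m c +m (e +m f) = a +m e +m f +m (b +m c).
    apply/mnmP => i; rewrite !mnmDE.
    by move: (a i) (b i) (c i) (e i) (f i); clear; lia.
  rewrite [Z in linked Z _]comm in A.
  rewrite [Z in linked Z _]comm [Z in linked _ Z]comm in B.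
  exact: linked_trans A B.
- move=> i j; rewrite /E /= pair_mnmC.
  have -> : pm j i +m pm o j +m pm o i = pm j i +m pm o i +m pm o j by rewrite -!addmA (addmC (pm o j)).
  exact: linked_refl.
- move=> i j k t c; rewrite /E /=; have := linked_add (cherry_linked t c) (linked_refl (pm o k)).
  have comm a b e : a +m b +m e = b +m a +m e by rewrite (addmC a).
  by rewrite [Z in linked Z _]comm [Z in linked _ Z]comm.
- by rewrite inE eq_sym.
- by apply/finset.set0Pn; exists l; rewrite inE.
- by move=> i j; rewrite !inE => /eqP-> /eqP->; rewrite eqxx.
rewrite cards1 in ss.
pose t := [seq pm o i | i <- enum [set~ o]%SET] ++ [seq pm x.1 x.2 | x <- s].
have troot i : i != o -> exists a, pm o i = fan_mnm t a.
  move=> io; apply: fan_mnm_mem; rewrite mem_cat; apply/orP; left.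
  by apply: map_f; rewrite mem_enum !inE.
exists t; split.
  by rewrite size_cat !size_map -cardE cardsC1 card_ord ss dn; move: n1; clear; lia.
have nf0 : exists a, mnm0 = fan_mnm t a.
  by exists (fun=> 0%N); rewrite /fan_mnm big1.
have nfD m m' : (exists a b, linked (m +m fan_mnm t a) (fan_mnm t b)) ->
    (exists a b, linked (m' +m fan_mnm t a) (fan_mnm t b)) ->
    exists a b, linked (m +m m' +m fan_mnm t a) (fan_mnm t b).
  move=> [a [b H]] [a' [b' H']]; exists (fun r => a r + a' r)%N, (fun r => b r + b' r)%N.
  rewrite -!fan_mnmD; have := linked_add H H'.
  have comm x y z u : x +m y +m (z +m u) = x +m z +m (y +m u).
    apply/mnmP => i; rewrite !mnmDE.
    by move: (x i) (y i) (z i) (u i); clear; lia.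
  by rewrite [Z in linked Z _]comm.
have nfan m : (exists a, m = fan_mnm t a) -> exists a b, linked (m +m fan_mnm t a) (fan_mnm t b).
  move=> [b ->]; have [a a0] := nf0; exists a, b; rewrite -a0 addm0.
  exact: linked_refl.
have nfpair i j : i != j -> exists a b, linked (pm i j +m fan_mnm t a) (fan_mnm t b).
  move=> ij; have [io|io] := eqVneq i o; first by apply/nfan; rewrite io; apply: troot; rewrite -io eq_sym.
  have [jo|jo] := eqVneq j o; first by apply/nfan; rewrite jo pair_mnmC; apply: troot.
  have [||y ys] := sX i j _ _ ij; rewrite ?inE//.
  have [y1 y2 _] := s_o y ys; rewrite /E /= => H.
  have [a1 E1] := troot _ y1; have [a2 E2] := troot _ y2.
  have [a3 E3] := troot _ io; have [a4 E4] := troot _ jo.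
  have [a5 E5] : exists a, pm y.1 y.2 = fan_mnm t a.
    apply: fan_mnm_mem; rewrite mem_cat; apply/orP; right.
    by apply/mapP; exists y.
  exists (fun r => a1 r + a2 r)%N, (fun r => a5 r + a3 r + a4 r)%N.
  by rewrite -!fan_mnmD -E1 -E2 -E3 -E4 -E5 addmA.
move=> m; rewrite (multinomUE_id m).
elim/big_ind: _ => [|m1 m2|i _]; [exact: nfan|exact: nfD|].
elim: (m i) => [|k IHk]; first by rewrite mulm0n; apply: nfan.
rewrite mulmS; apply: nfD IHk; have [x [y [xy ->]]] := mnm1_pair i.
exact: nfpair.
Qed.

(** The values of the [d] generating monomials span the columns of [M], which has
    rank [d]; they are independent, and normal forms of equal value coincide. *)
Lemma same_mval_linked m m' : mval M m = mval M m' -> linked m m'.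
Proof.
move=> e; have [t [st nf]] := fan_normal_form.
have [a [b H]] := nf m; have [a' [b' H']] := nf m'.
have hull : forall m, lattice_hull [set y | y \in [seq mval M m | m <- t]] (mval M m).
  move=> m0; have [a0 [b0 [H0 _]]] := nf m0.
  have -> : mval M m0 = mval M (fan_mnm t b0) - mval M (fan_mnm t a0).
    by rewrite -H0 mvalD addrK.
  have fan_hull c : lattice_hull [set y | y \in [seq mval M m | m <- t]] (mval M (fan_mnm t c)).
    rewrite /fan_mnm big_mkord; elim/big_ind: _ => [|x y hx hy|r _].
    - have -> : mval M mnm0 = 0 by rewrite -(mulm0n (@mnm0 N)) mvalMn mulr0n.
      exact: lattice_hull0.
    - by rewrite mvalD; apply: lattice_hullD.
    rewrite mvalMn; elim: (c r) => [|k IHk]; first by rewrite mulr0n; apply: lattice_hull0.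
    rewrite mulrS; apply: lattice_hullD IHk; apply: lattice_hull_mem.
    by apply: map_f; apply: mem_nth.
  exact: lattice_hullB.
have [A MA] := seq_mx_factor hull.
have full : row_full (seq_mx [seq mval M m | m <- t]).
  rewrite /row_full eqn_leq rank_leq_col /= [Z in (Z <= _)%N]size_map st.
  by have := mxrankM_maxl (seq_mx [seq mval M m | m <- t]) A; rewrite -MA rM.
have inj c c' : mval M (fan_mnm t c) = mval M (fan_mnm t c') -> fan_mnm t c = fan_mnm t c'.
  rewrite !mval_fan => /(congr1 (mulmx (pinvmx (seq_mx [seq mval M m | m <- t])))).
  rewrite !mulmxA !mulVpmx// !mul1mx => /colP ecc; apply: eq_big_nat => r /andP[_ rt].
  have rt' : (r < size [seq mval M m | m <- t])%N by rewrite size_map.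
  by have := ecc (Ordinal rt'); rewrite !mxE => /eqP; rewrite eqr_nat => /eqP ->.
have eq1 : fan_mnm t b +m fan_mnm t a' = fan_mnm t b' +m fan_mnm t a.
  rewrite !fan_mnmD; apply: inj; rewrite -!fan_mnmD !mvalD -H.1 -H'.1 !mvalD e.
  by rewrite addrAC.
apply: (linked_addr (fan_mnm t a +m fan_mnm t a') m m').2.
have := linked_add H (linked_refl (fan_mnm t a')); rewrite eq1 -addmA => K.
apply: linked_trans K _; apply: linked_sym.
have := linked_add H' (linked_refl (fan_mnm t a)).
by rewrite -addmA (addmC (fan_mnm t a')).
Qed.

End LinkedMonomials.

Section SameTree.
Variables (R : realType) (n : nat) (o : 'I_n).
Hypothesis o0 : o = 0%N :> nat.
Local Notation N := #|ngon_arc n|.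
Local Notation pm := (@pair_mnm n).
Local Notation I := (I2 R n).
Local Notation X m := (mpolyX R[i] m).

Lemma resolved_strict d (w : 'rV[R]_N) (M : 'M[R]_(d, N)) i j k : ultrametric o w ->
  rows_adapted o M w -> \rank M = (n.-1 + n.-2)%N -> triple o i j k ->
  cherry o w i j k -> delta o w i k < delta o w i j.
Proof.
move=> uw ad rM t c; have [e le] := c; rewrite lt_neqAle le andbT; apply/eqP => e2.
apply: (Delta_resolved uw ad rM t); last exact: (cherry_Delta ad t c).
have t' : triple o k j i by rewrite tripleC12 tripleC23 tripleC12.
rewrite DeltaC [RHS]DeltaC; apply/esym; apply: (cherry_Delta ad t').
split; first by rewrite (deltaC o w k) (deltaC o w j).
by rewrite (deltaC o w k i) (deltaC o w k j) e.
Qed.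

Lemma strict_min (v : 'rV[R]_N) i j k (f : mpoly N R[i]) : triple o i j k -> cherry o v i j k ->
  delta o v i k < delta o v i j -> msupp f =i triple_mnms o i j k ->
  forall m, m \in msupp f -> all (fun m' => weight v m <= weight v m') (msupp f) =
    (m \in [:: mnm_add (pm o j) (pm i k); mnm_add (pm o i) (pm j k)]).
Proof.
move=> t [e _] lt fE m; have [[v1 v2] v3] := delta_sum o v i j k.
have := triple_mnms_uniq t; rewrite /= !inE negb_or => /and3P[/andP[m12 m13] _ _].
rewrite (eq_all_r fE) fE /= andbT !inE => /or3P[] /eqP->; rewrite v1 v2 v3;
  move: (weight v (pm o i) + _ + _) => c; rewrite !(lerD2r c) ?eqxx ?orbT.
- by rewrite (negPf m12) (negPf m13) [delta o v i j <= delta o v i k]leNgt lt andbF.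
- by rewrite lexx -e lexx (ltW lt).
- by rewrite -e lexx (ltW lt).
Qed.

Variables (d : nat) (w1 w2 : 'rV[R]_N) (M1 M2 : 'M[R]_(d, N)).
Hypotheses (T1 : Trop I w1) (T2 : Trop I w2).
Hypotheses (p1 : prime_ideal (init_ideal w1 I)) (p2 : prime_ideal (init_ideal w2 I)).
Hypotheses (cM1 : forall r, groebner_cone I w1 (row r M1)).
Hypotheses (cM2 : forall r, groebner_cone I w2 (row r M2)).
Hypotheses (rM1 : \rank M1 = d) (rM2 : \rank M2 = d).
Hypotheses (dn : d = (n.-1 + n.-2)%N) (n1 : (1 < n)%N).
Hypothesis agree : forall i j k, triple o i j k -> cherry o w1 i j k -> cherry o w2 i j k.

Let uw1 := Trop_ultrametric o0 T1.
Let uw2 := Trop_ultrametric o0 T2.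
Let ad1 : rows_adapted o M1 w1.
Proof. by move=> r; apply: tree_cone_adapted; apply: groebner_cone_tree_cone. Qed.
Let ad2 : rows_adapted o M2 w2.
Proof. by move=> r; apply: tree_cone_adapted; apply: groebner_cone_tree_cone. Qed.

Let Q := init_ideal w1 I `&` init_ideal w2 I.

(** The initial form of a Pluecker relation at a resolved triple is a binomial,
    and it is the same for both trees. *)
Let Qcherry i j k : triple o i j k -> cherry o w1 i j k ->
  exists2 s, s != 0 &
    Q (X (mnm_add (pm o j) (pm i k)) - s *: X (mnm_add (pm o i) (pm j k))).
Proof.
move=> t c1; have c2 := agree t c1.
have l1 := resolved_strict uw1 ad1 (etrans rM1 dn) t c1.
have l2 := resolved_strict uw2 ad2 (etrans rM2 dn) t c2.
have [f If fE] := pluecker_trinomial R o0 t.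
set A := mnm_add (pm o j) (pm i k); set B := mnm_add (pm o i) (pm j k).
have gE v : (v = w1 \/ v = w2) -> forall m, mcoeff m (init_form v f) =
    if m \in [:: A; B] then mcoeff m f else 0.
  move=> vw m; rewrite init_form_restrict mcoeff_restrict.
  have [mf|mf] := boolP (m \in msupp f); last by rewrite (memN_msupp_eq0 mf) !if_same.
  by case: vw => ->; rewrite (strict_min t _ _ fE).
have Qg : Q (init_form w1 f).
  split; first by apply: ideal_gen_mem; exists f.
  have -> : init_form w1 f = init_form w2 f.
    by apply/mpolyP => m; rewrite !gE//; [right|left].
  by apply: ideal_gen_mem; exists f.
have fA : mcoeff A f != 0 by rewrite -mcoeff_msupp fE !inE eqxx orbT.
have fB : mcoeff B f != 0 by rewrite -mcoeff_msupp fE !inE eqxx !orbT.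
exists (- (mcoeff A f)^-1 * mcoeff B f).
  by rewrite mulf_neq0// oppr_eq0 invr_neq0.
have AB : A != B.
  by have := triple_mnms_uniq t; rewrite /= !inE => /and3P[].
have -> : X A - (- (mcoeff A f)^-1 * mcoeff B f) *: X B =
    mpolyC N (mcoeff A f)^-1 * init_form w1 f.
  apply/mpolyP => m; rewrite mul_mpolyC mcoeffB !mcoeffZ !mcoeffX gE; last by left.
  rewrite !inE ![m == _]eq_sym; have [<-|_] := eqVneq A m.
    by rewrite eq_sym (negPf AB) mulr0 subr0 mulVf.
  have [<-|_] := eqVneq B m; last by rewrite !mulr0 subrr.
  by rewrite mulr1 sub0r mulNr opprK.
by case: Qg => g1 g2; split; apply: ideal_genM.
Qed.

Lemma prime_cancel_monomial w mu g : Trop I w -> prime_ideal (init_ideal w I) ->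
  init_ideal w I (X mu * g) -> init_ideal w I g.
Proof. by move=> Tw [_ pr] /pr[/Tw|]. Qed.

Lemma same_mval_binomial m m' : mval M1 m = mval M1 m' ->
  exists s, Q (X m - s *: X m').
Proof.
move=> e; have [] : linked M1 Q m m'.
  apply: (@same_mval_linked R n o d w1 M1 Q uw1 ad1 rM1 dn n1) => //.
  - by split; apply: ideal_gen0.
  - by move=> f g [f1 f2] [g1 g2]; split; apply: ideal_genB.
  - by move=> f g [g1 g2]; split; apply: ideal_genM.
move=> _ [mu [s [_ H]]]; exists s; move: H; rewrite !mpolyXD scalerAr -mulrBr => -[H1 H2].
by split; [apply: prime_cancel_monomial H1|apply: prime_cancel_monomial H2].
Qed.

(** A term has a partner of the same weight for all weights with the same initial
    ideal, in particular for the rows of [M1]. The binomial of the two lies in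
    both ideals, and subtracting it removes the term. *)
Lemma same_tree_sub f : init_ideal w1 I f -> init_ideal w2 I f.
Proof.
have [k] := ubnP (size (msupp f)); elim: k f => // k IHk f; rewrite ltnS => sk J1f.
have [f0|fN0] := eqVneq f 0; first by rewrite f0; apply: ideal_gen0.
have [m0 m0f] : exists m0, m0 \in msupp f.
  move: fN0; rewrite -msupp_eq0; case: (msupp f) => // m0 s _; exists m0; exact: mem_head.
pose U := [set u | init_ideal u I = init_ideal w1 I].
have [||m1 [m1f m10 eqU]] := @monomial_partner _ _ (init_ideal w1 I) U f m0 _ T1 _ J1f m0f.
- by move=> u uU; exists I.
- by eexists.
have mv : mval M1 m0 = mval M1 m1.
  apply/colP => r; rewrite !mvalE; have cw := @weight_continuous R n.
  exact: (closure_eq (cw m0) (cw m1) (fun u Uu => esym (eqU u Uu)) (@cM1 r)).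
have [s [Q1 Q2]] := same_mval_binomial mv.
pose c := mcoeff m0 f; pose g := f - mpolyC N c * (X m0 - s *: X m1).
have -> : f = g + mpolyC N c * (X m0 - s *: X m1) by rewrite subrK.
apply: ideal_genD; last exact: ideal_genM.
apply: IHk; last by apply: ideal_genB => //; apply: ideal_genM.
have gE m : mcoeff m g = mcoeff m f - c * ((m0 == m)%:R - s * (m1 == m)%:R).
  by rewrite mcoeffB mul_mpolyC mcoeffZ mcoeffB mcoeffZ !mcoeffX.
have sub : {subset msupp g <= rem m0 (msupp f)}.
  move=> m; rewrite mcoeff_msupp gE mem_rem_uniq ?msupp_uniq// inE mcoeff_msupp.
  have [->|mm0] := eqVneq m m0; first by rewrite (negPf m10) mulr0 subr0 mulr1 subrr eqxx.
  rewrite /=; have [<-|_] := eqVneq m1 m; first by rewrite -mcoeff_msupp m1f.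
  by rewrite mulr0 subrr mulr0 subr0.
apply: leq_trans sk; rewrite -(ltn_predK (_ : 0 < size (msupp f))%N); last by case: (msupp f) m0f.
by rewrite ltnS -(size_rem m0f); apply: uniq_leq_size (msupp_uniq g) sub.
Qed.

End SameTree.

(** * The two Newton-Okounkov bodies *)

Definition row_form (R : realType) d (ell : 'rV[R]_d) (x : 'cV[R]_d) : R^o := (ell *m x) 0 0.

Lemma row_form_is_linear (R : realType) d (ell : 'rV[R]_d) : linear (row_form ell).
Proof. by move=> a x y; rewrite /row_form mulmxDr -scalemxAr !mxE. Qed.

HB.instance Definition _ (R : realType) d (ell : 'rV[R]_d) :=
  GRing.isLinear.Build R 'cV[R]_d R^o _ (row_form ell) (row_form_is_linear ell).

Section Bodies.
Variables (R : realType) (n : nat) (o : 'I_n).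
Hypothesis o0 : o = 0%N :> nat.
Local Notation N := #|ngon_arc n|.
Local Notation pm := (@pair_mnm n).
Variables (w1 w2 : 'rV[R]_N) (M1 M2 : 'M[int]_(rk n, N)) (e : nat) (B : 'M[R]_(e, N)).
Local Notation MR1 := (map_mx intr M1 : 'M[R]_(rk n, N)).
Local Notation MR2 := (map_mx intr M2 : 'M[R]_(rk n, N)).
Hypotheses (uw1 : ultrametric o w1) (uw2 : ultrametric o w2).
Hypotheses (tM1 : forall r, tree_cone o w1 (row r MR1)) (tM2 : forall r, tree_cone o w2 (row r MR2)).
Hypotheses (M10 : row ord0 M1 = const_mx 1) (M20 : row ord0 M2 = const_mx 1).
Hypotheses (fM1 : row_free MR1) (fM2 : row_free MR2).
Hypotheses (BM1 : (B <= MR1)%MS) (rB : (\rank B).+1 = rk n).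
Hypotheses (w1B : forall r, tree_cone o w1 (row r B)) (w2B : forall r, tree_cone o w2 (row r B)).
Variables (p q s : 'I_n).
Hypotheses (tpqs : triple o p q s) (ch1 : cherry o w1 p q s) (ch2 : cherry o w2 q s p).

Let n3 : (3 < n)%N. Proof. exact: triple_card tpqs. Qed.
Let dn : rk n = (n.-1 + n.-2)%N. Proof. by move: n3; clear; lia. Qed.

Let ad1 : rows_adapted o MR1 w1. Proof. by move=> r; apply: tree_cone_adapted. Qed.
Let ad2 : rows_adapted o MR2 w2. Proof. by move=> r; apply: tree_cone_adapted. Qed.
Let rM1 : \rank MR1 = (n.-1 + n.-2)%N. Proof. by rewrite -dn; apply/eqP. Qed.
Let rM2 : \rank MR2 = (n.-1 + n.-2)%N. Proof. by rewrite -dn; apply/eqP. Qed.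
Let rB' : (\rank B).+1 = (n.-1 + n.-2)%N. Proof. by rewrite rB dn. Qed.

Let lab := label o (row_sum B) p q s.
Let v := flip_vec o p q s MR2.
Let opp2 (i : 'I_N) := opp02 (lab (val (enum_val i)).1) (lab (val (enum_val i)).2).
Let opp3 (i : 'I_N) := opp13 (lab (val (enum_val i)).1) (lab (val (enum_val i)).2).
Let col2 i := mval MR2 (mnm1 i).

Let opp_disjoint i : ~~ (opp2 i && opp3 i).
Proof.
rewrite /opp2 /opp3 /opp02 /opp13; case: (lab _) => [|[|[|l]]]; case: (lab _) => [|[|[|[|l']]]] //=.
Qed.

Let pair_ends (i : 'I_N) (P : rel nat) : (forall l m, P l m = P m l) ->
  forall a b, mnm1 i = pm a b -> a != b ->
  P (lab (val (enum_val i)).1) (lab (val (enum_val i)).2) = P (lab a) (lab b).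
Proof.
move=> PC a b; case: (ltngtP a b) => [ab|ba|/val_inj->]; last by rewrite eqxx.
  rewrite pair_mnm_lt => /eqP; rewrite eq_mnm1 => /eqP-> _.
  by rewrite enum_rankK.
rewrite pair_mnmC pair_mnm_lt => /eqP; rewrite eq_mnm1 => /eqP-> _.
by rewrite enum_rankK PC.
Qed.

Let opp_pair (i : 'I_N) a b :
  (lab (val (enum_val i)).1 == a) && (lab (val (enum_val i)).2 == b) ||
  (lab (val (enum_val i)).1 == b) && (lab (val (enum_val i)).2 == a) ->
  exists j k, [/\ lab j = a, lab k = b & mnm1 i = pm j k].
Proof.
case E : (enum_val i) => [[j k] /= jk].
have iE : mnm1 i = pm j k by rewrite pair_mnm_lt -E enum_valK.
case/orP => /andP[/eqP ja /eqP kb]; first by exists j, k.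
by exists k, j; rewrite pair_mnmC.
Qed.

Section Functional.
Variable ell : 'rV[R]_(rk n).
Hypothesis ellE : forall i j, i != j -> (ell *m mval MR2 (pm i j)) 0 0 =
  (opp02 (lab i) (lab j))%:R - (opp13 (lab i) (lab j))%:R.

Let Delta_lab i j : i != o -> j != o -> i != j -> (ell *m Delta o MR2 i j) 0 0 =
  ((opp02 (lab i) (lab j))%:R - (opp13 (lab i) (lab j))%:R)
  - ((opp02 (lab o) (lab i))%:R - (opp13 (lab o) (lab i))%:R)
  - ((opp02 (lab o) (lab j))%:R - (opp13 (lab o) (lab j))%:R).
Proof.
move=> io jo ij; have mulB x y : (ell *m (x - y)) 0 0 = (ell *m x) 0 0 - (ell *m y) 0 0.
  by rewrite mulmxBr mxE [X in _ + X]mxE.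
by rewrite /Delta !mulB !ellE// eq_sym.
Qed.

Let lab_o : lab o = 0%N. Proof. exact: label_o. Qed.

Lemma ell_Delta : (ell *m Delta o MR2 p q) 0 0 = - 1 /\ (ell *m Delta o MR2 q s) 0 0 = - 1.
Proof.
have [[po qo so] pq ps qs] := tripleP tpqs; have [lp lq ls] := label_reps w1B w2B tpqs ch1 ch2.
have lo := lab_o.
by rewrite !Delta_lab// lo /lab lp lq ls /opp02 /opp13 /= !subr0 ?sub0r ?subr0.
Qed.

(** The columns at the root and one difference vector for each branching point
    generate the lattice; two of the latter are the ends [D1], [D2] of the edge
    of the second tree. Their number is the rank. *)
Lemma body_coordinates : exists (A : 'M[R]_(#|{: edge (fan n)}|, rk n)) G,
  [/\ A *m G = 1%:M /\ G *m A = 1%:M,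
    forall x, arc_map A x (arc02 n3) = row_form ell x,
    forall x, shear (arc02 n3) (vertex (@ltn_trans 3 0 n isT n3)) (vertex (@ltn_trans 3 1 n isT n3))
      (vertex (@ltn_trans 3 2 n isT n3)) (vertex n3) (arc_map A x) = arc_map A (pl_shear v (row_form ell) x) &
    forall x, lattice_hull (values R M2) x <-> int_lattice R (fan n) (arc_map A x)].
Proof.
have [[po qo so] pq ps qs] := tripleP tpqs; have [e1 e2] := ell_Delta.
pose L := lattice_hull (values R M2); pose D1 := Delta o MR2 p q; pose D2 := Delta o MR2 q s.
have Lmem i j : i != j -> L (mval MR2 (pm i j)) by apply: (lattice_hull_pair o0 uw2 tM2 M20).
have LDelta i j : i != o -> j != o -> i != j -> L (Delta o MR2 i j).
  exact: (lattice_hull_Delta o0 uw2 tM2 M20).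
have D3 : Delta o MR2 p s = D1.
  have tqsp : triple o q s p by rewrite tripleC23 -tripleC12.
  have := cherry_Delta ad2 tqsp ch2; rewrite (DeltaC o MR2 q) (DeltaC o MR2 s) => <-; exact: erefl.
pose Y := [set x in [:: p; q; s]]%SET.
have cY : #|Y| = 3%N by rewrite card_set_seq//= !inE negb_or pq ps qs.
have [||| t' [st' t'P t'D]] := @Delta_cover R n o _ MR2 w2 Y [:: D1; D2] uw2 ad2.
- by rewrite !inE !negb_or !(eq_sym o) po qo so.
- by rewrite -card_gt0 cY.
- move=> i j; rewrite !inE => /or3P[]/eqP-> /or3P[]/eqP->; rewrite ?eqxx// => _;
  by rewrite ?D3 ?[Delta _ _ q p]DeltaC ?[Delta _ _ s _]DeltaC ?D3 ?eqxx ?orbT.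
pose t := t' ++ root_cols o MR2.
have sz : ((size t).+2 <= rk n)%N.
  rewrite size_cat size_root_cols st' cY dn; move: n3; clear; lia.
have cardT : #|{: edge (fan n)}| = rk n.
  by rewrite dn; case: (n) n3 => [|[|n']]// _; rewrite card_fan.
have ellL x : L x -> (ell *m x) 0 0 \is a Num.int.
  move=> /(lattice_hull_values o0 uw2 tM2 M20); elim/lattice_hull_ind => [|y z|_ [c _ <-]].
  - by rewrite mulmx0 mxE.
  - by rewrite -!/(row_form ell _) linearB; apply: rpredB.
  - by have [i [j [ij ->]]] := mnm1_pair c; rewrite ellE// rpredB ?rpred_nat.
have genL x : L x -> lattice_hull [set y | y \in D1 :: D2 :: t] x.
  move=> /(lattice_hull_values o0 uw2 tM2 M20); elim/lattice_hull_ind => [|y z|_ [c _ <-]].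
  - exact: lattice_hull0.
  - exact: lattice_hullB.
  - exact: (mval_lattice t'D).
have Lt (x : 'cV[R]_(rk n)) : x \in t -> L x.
  rewrite mem_cat => /orP[/t'P[i [j [io jo ij ->]]]|/root_colsP[i io ->]].
    exact: LDelta.
  by apply: Lmem; rewrite eq_sym.
have ML c : L (col c MR2).
  by rewrite -mval_mnm1; have [i [j [ij ->]]] := mnm1_pair c; apply: Lmem.
have [A [G [AG Aac Av Aint]]] := fan_coordinates n3 cardT (etrans rM2 (esym dn)) ML
  (@lattice_hull0 _ _) (@lattice_hullB _ _) (LDelta _ _ po qo pq) (LDelta _ _ qo so qs)
  Lt genL sz ellL e1 e2.
exists A, G; split=> // x; have aD y z : arc_map A (y + z) = arc_map A y + arc_map A z by rewrite linearD.
have aZ c y : arc_map A (c *: y) = c *: arc_map A y by rewrite linearZ.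
rewrite /shear Aac /pl_shear aD aZ Av -/(row_form ell x).
by case: lerP => [le0|/ltW ge0]; rewrite ?scale0r ?addr0.
Qed.
End Functional.

Section Matrix.
Variable Psi : 'M[R]_(rk n).
Local Notation c := (flip_vec o p q s MR1).
Hypothesis Psic : Psi *m c = v.
Hypothesis PsiE : forall i j, i != j -> mval MR2 (pm i j) =
  Psi *m mval MR1 (pm i j) + (opp02 (lab i) (lab j))%:R *: v.

Lemma flip_column i : col2 i = Psi *m mval MR1 (mnm1 i) + (opp2 i)%:R *: v.
Proof.
by have [j [k [jk iE]]] := mnm1_pair i; rewrite /col2 iE PsiE// /opp2 (pair_ends opp02C iE jk).
Qed.

Lemma flip_column_factor i : col2 i = Psi *m (mval MR1 (mnm1 i) + (opp2 i)%:R *: c).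
Proof. by rewrite flip_column mulmxDr -scalemxAr Psic. Qed.

(** All columns of [M2] lie in the image of [Psi]. *)
Lemma flip_unit : Psi \in unitmx.
Proof.
rewrite -row_full_unit /row_full eqn_leq rank_leq_col /= -{1}(eqP fM2 : \rank MR2 = _).
have -> : MR2 = Psi *m (MR1 + c *m \row_i (opp2 i)%:R).
  apply/matrixP => r i; have /colP/(_ r) := flip_column_factor i.
  rewrite /col2 mval_mnm1 mxE => ->; rewrite mval_mnm1 !mxE; apply: eq_bigr => k _.
  by move: (flip_vec _ _ _ _ _) => x; rewrite !mxE big_ord1 !mxE [ord0 in RHS]ord1 [x k 0 * _]mulrC.
exact: mxrankM_maxl.
Qed.

Let ends3 : [/\ p != o, q != o, s != o, p != q & q != s].
Proof. by have [[-> -> ->] -> _ ->] := tripleP tpqs. Qed.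

Lemma flip_lattice x :
  lattice_hull (values R M1) x <-> lattice_hull (values R M2) (Psi *m x).
Proof.
have [po qo so pq qs] := ends3.
have L1c : lattice_hull (values R M1) c.
  by rewrite /flip_vec; apply: lattice_hullB; apply: (lattice_hull_Delta o0 uw1 tM1 M10).
have L2v : lattice_hull (values R M2) v.
  by rewrite /v /flip_vec; apply: lattice_hullB; apply: (lattice_hull_Delta o0 uw2 tM2 M20).
split=> [/(lattice_hull_values o0 uw1 tM1 M10)|].
  elim/lattice_hull_ind => [|y z|_ [i _ <-]].
  - by rewrite mulmx0; apply: lattice_hull0.
  - by rewrite mulmxBr; apply: lattice_hullB.
  have -> : Psi *m mval MR1 (mnm1 i) = col2 i - (opp2 i)%:R *: v by rewrite flip_column addrK.
  apply: lattice_hullB; first by apply: lattice_hull_mem; apply: (column_value o0 uw2 tM2 M20).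
  by case: (opp2 i); rewrite ?scale1r// scale0r; apply: lattice_hull0.
suff H y : lattice_hull (values R M2) y -> exists2 x', lattice_hull (values R M1) x' & y = Psi *m x'.
  by move=> /H[x' Lx' /(congr1 (mulmx (invmx Psi)))]; rewrite !mulKmx ?flip_unit// => ->.
move=> /(lattice_hull_values o0 uw2 tM2 M20); elim/lattice_hull_ind => [|_ _ [x1 Lx1 ->] [x2 Lx2 ->]|_ [i _ <-]].
- by exists 0; [apply: lattice_hull0|rewrite mulmx0].
- by exists (x1 - x2); [apply: lattice_hullB|rewrite mulmxBr].
rewrite -/(col2 i) flip_column_factor; eexists; last by reflexivity.
apply: lattice_hullD; first by apply: lattice_hull_mem; apply: (column_value o0 uw1 tM1 M10).
by case: (opp2 i); rewrite ?scale1r// scale0r; apply: lattice_hull0.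
Qed.

Section Shear.
Variable ell : 'rV[R]_(rk n).
Hypothesis ellE : forall i j, i != j -> (ell *m mval MR2 (pm i j)) 0 0 =
  (opp02 (lab i) (lab j))%:R - (opp13 (lab i) (lab j))%:R.

Let neq_lab i j : lab i != lab j -> i != j.
Proof. by apply: contraNneq => ->. Qed.

Let ell_column i : row_form ell (col2 i) = (opp2 i)%:R - (opp3 i)%:R.
Proof.
have [j [k [jk iE]]] := mnm1_pair i; rewrite /row_form /col2 iE ellE//.
by rewrite /opp2 /opp3 (pair_ends opp02C iE jk) (pair_ends opp13C iE jk).
Qed.

Let ell_v : row_form ell v = 0.
Proof. by have [e1 e2] := ell_Delta ellE; rewrite /v /flip_vec linearB /= /row_form e1 e2 subrr. Qed.

Let flip_exchange2 i j : opp2 i -> opp3 j -> exists k l, col2 i + col2 j - v = col2 k + col2 l.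
Proof.
move=> /opp_pair[a [b [la lb iE]]] /opp_pair[a' [b' [la' lb' jE]]].
have /pair_mnmE[k kE _] : a != a' by apply: neq_lab; rewrite la la'.
have /pair_mnmE[l lE _] : b != b' by apply: neq_lab; rewrite lb lb'.
exists k, l; rewrite /col2 iE jE -kE -lE.
have [_ ->] := flip_exchange uw1 uw2 ad2 rB' w1B w2B tpqs ch1 ch2 la lb la' lb'.
by rewrite addrK.
Qed.

Let col1' i := Psi *m mval MR1 (mnm1 i).

Let flip_exchange1 i j : opp2 i -> opp3 j ->
  exists k l, col1' i + col1' j + v = col1' k + col1' l.
Proof.
move=> Pi Qj; have Pj : opp2 j = false by have := opp_disjoint j; rewrite Qj andbT => /negPf.
have c1 k : col1' k = col2 k - (opp2 k)%:R *: v by rewrite flip_column addrK.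
move: (Pi) (Qj) => /opp_pair[a [b [la lb iE]]] /opp_pair[a' [b' [la' lb' jE]]].
have ab' : a != b' by apply: neq_lab; rewrite la lb'.
have ba' : b != a' by apply: neq_lab; rewrite lb la'.
have [k kE _] := pair_mnmE ab'; have [l lE _] := pair_mnmE ba'.
have Pk : opp2 k = false by rewrite /opp2 (pair_ends opp02C (esym kE) ab') la lb'.
have Pl : opp2 l = false by rewrite /opp2 (pair_ends opp02C (esym lE) ba') lb la'.
exists k, l; rewrite !c1 Pi Pj Pk Pl scale1r scale0r !subr0 addrAC subrK.
rewrite /col2 iE jE -kE -lE.
by have [-> _] := flip_exchange uw1 uw2 ad2 rB' w1B w2B tpqs ch1 ch2 la lb la' lb'.
Qed.

Let ord0_pair i j : i != j -> mval MR2 (pm i j) ord0 0 = 1.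
Proof. by move=> /pair_mnmE[k -> _]; apply: column_ord0. Qed.

(* [v] is a combination of columns with total coefficient 0. *)
Let ord0_v : v ord0 0 = 0.
Proof.
have [po qo so pq qs] := ends3.
have D0 i j : i != o -> j != o -> i != j -> Delta o MR2 i j ord0 0 = - 1.
  move=> io jo ij; rewrite /Delta.
  have := (ord0_pair ij, @ord0_pair o i, @ord0_pair o j).
  move: (mval _ _) (mval _ _) (mval _ _) => x y z [[ex ey] ez].
  by rewrite !mxE ex ey 1?eq_sym// ez 1?eq_sym// subrr sub0r.
rewrite /v /flip_vec; have := (D0 _ _ po qo pq, D0 _ _ qo so qs).
by move: (Delta _ _ _ _) (Delta _ _ _ _) => x y [ex ey]; rewrite !mxE ex ey subrr.
Qed.

Let ord0_Psi x : in_cone (fun i => mval MR1 (mnm1 i)) x -> (Psi *m x) ord0 0 = x ord0 0.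
Proof.
move=> [a _ ->]; rewrite mulmx_sumr !summxE; apply: eq_bigr => i _.
have /colP/(_ ord0) := flip_column i; have := column_ord0 R M20 i; rewrite -/(col2 i).
have := ord0_v; move: v => v' v0; rewrite -scalemxAr.
have := column_ord0 R M10 i; move: (mval _ _) => x1 x10; move: (col2 i) (Psi *m x1) => x2 x3 x20.
by rewrite !mxE v0 x20 mulr0 addr0 x10 => ->.
Qed.

Lemma flip_body y : NO_body R M2 y <->
  exists2 x, NO_body R M1 x & y = pl_shear v (row_form ell) (Psi *m x).
Proof.
have ord0_shear z a : (z + a *: v) ord0 0 = z ord0 0.
  by have := ord0_v; move: v => v' v0; rewrite !mxE v0 mulr0 addr0.
split=> [/(NO_bodyE o0 uw2 tM2 M20)[cy y0]|[x /(NO_bodyE o0 uw1 tM1 M10)[cx x0] ->]].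
  have [a a0 xE] := pl_unshear_cone opp_disjoint flip_column ell_column flip_exchange1 cy.
  pose x := \sum_i a i *: mval MR1 (mnm1 i).
  have xP : Psi *m x = y - Num.max (row_form ell y : R) 0 *: v.
    by rewrite xE mulmx_sumr; apply: eq_bigr => i _; rewrite -scalemxAr.
  have cx : in_cone (fun i => mval MR1 (mnm1 i)) x by exists a.
  exists x.
    apply/(NO_bodyE o0 uw1 tM1 M10); split=> //.
    by rewrite -ord0_Psi// xP -scaleNr ord0_shear.
  have ell_shift a' : row_form ell (y - a' *: v) = row_form ell y.
    by rewrite linearB linearZ /= ell_v scaler0 subr0.
  by rewrite xP /pl_shear /= ell_shift subrK.
apply/(NO_bodyE o0 uw2 tM2 M20); split; last by rewrite ord0_shear ord0_Psi.
apply: (pl_shear_cone opp_disjoint flip_column ell_column ell_v flip_exchange2).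
have [a a0 ->] := cx; exists a => //; rewrite mulmx_sumr; apply: eq_bigr => i _.
by rewrite -scalemxAr.
Qed.
End Shear.
End Matrix.

(** The second equivalence is given by the coordinates of [body_coordinates], the
    first one by these coordinates after [Psi]. *)
Theorem adjacent_bodies : exists (T : {set ngon_arc n}) (ac : edge T) (a b c d : 'I_n)
         (phi1 phi2 : {linear 'cV[R]_(rk n) -> arc_space R T}),
    [/\ triangulation T, quadrilateral ac a b c d,
        unimodular M1 phi1, unimodular M2 phi2 &
        shear ac a b c d @` (phi1 @` NO_body R M1) = phi2 @` NO_body R M2].
Proof.
have [Psi [Psic PsiE]] := flip_matrix uw1 uw2 ad1 ad2 rM1 BM1 rB' w1B w2B tpqs ch1 ch2.
have [ell ellE] := flip_functional uw1 uw2 ad1 ad2 rM1 rM2 BM1 rB' w1B w2B tpqs ch1 ch2.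
have [A [G [[AG GA] _ Ashear Alat]]] := body_coordinates ellE.
have uPsi : Psi \in unitmx := flip_unit Psic PsiE.
have mapM x : arc_map (A *m Psi) x = arc_map A (Psi *m x).
  by apply/ffunP => k; rewrite !ffunE mulmxA.
have uni (M : 'M[int]_(rk n, N)) f : bijective (arc_map f) ->
    (forall x, lattice_hull (values R M) x <-> int_lattice R (fan n) (arc_map f x)) ->
    unimodular M (arc_map f).
  move=> bf fL; split=> //; apply/predeqP => y; split=> [[x Lx <-]|Ly]; first exact: (fL x).1.
  by have [g _ fK] := bf; exists (g y); [apply: (fL (g y)).2; rewrite fK|apply: fK].
have bij2 := arc_map_bij AG GA.
have bij1 : bijective (arc_map (A *m Psi)).
  apply: (@arc_map_bij _ _ _ _ (invmx Psi *m G)).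
    by rewrite mulmxA mulmxK.
  by rewrite -mulmxA (mulmxA G) GA mul1mx mulVmx.
exists (fan n), (arc02 n3); do 4 eexists; exists (arc_map (A *m Psi)), (arc_map A); split.
- exact: fan_triangulation n3.
- exact: fan_quadrilateral.
- by apply: uni => // x; rewrite mapM -Alat; apply: (flip_lattice Psic PsiE).
- exact: uni.
apply/predeqP => y; split=> [[_ [x Nx <-] <-]|[z /(flip_body PsiE ellE)[x Nx ->] <-]].
  rewrite /= mapM Ashear; eexists; last by reflexivity.
  by apply/(flip_body PsiE ellE); exists x.
by exists (arc_map (A *m Psi) x); [exists x|rewrite mapM Ashear].
Qed.

End Bodies.

Lemma span_basis_dim (R : realType) N (A : set 'rV[R]_N) d d' (B : 'M[R]_(d, N))
    (B' : 'M[R]_(d', N)) : Defs.span_basis A B -> Defs.span_basis A B' -> d = d'.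
Proof.
move=> [/eqP fB AB BA] [/eqP fB' AB' BA'].
have : (B == B')%MS by apply/andP; split; apply/row_subP => r; [apply: BA'|apply: BA].
by move=> /eqmx_rank; rewrite fB fB'.
Qed.

Theorem corollary1p5 (R : realType) (n : nat)
    (sigma1 sigma2 : set 'rV[R]_#|ngon_arc n|)
    (M1 M2 : 'M[int]_(rk n, #|ngon_arc n|)) :
  maximal_prime_cone (I2 R n) sigma1 ->
  maximal_prime_cone (I2 R n) sigma2 ->
  facet (sigma1 `&` sigma2) sigma1 ->
  facet (sigma1 `&` sigma2) sigma2 ->
  cone_matrix sigma1 M1 ->
  cone_matrix sigma2 M2 ->
  exists (T : {set ngon_arc n}) (ac : edge T) (a b c d : 'I_n)
         (phi1 phi2 : {linear 'cV[R]_(rk n) -> arc_space R T}),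
    [/\ triangulation T,
        quadrilateral ac a b c d,
        unimodular M1 phi1,
        unimodular M2 phi2 &
        shear ac a b c d @` (phi1 @` NO_body R M1) = phi2 @` NO_body R M2].
Proof.
move=> [_ [w1 T1 [s1 _ p1]]] [_ [w2 T2 [s2 _ p2]]] [_ [d [[B1 B1P] [B BP]]]] _ [M10 M1P] [M20 M2P].
have n1 : (1 < n)%N.
  have [/eqP rM _ _] := M1P; have := rank_leq_col (map_mx (intr : int -> R) M1).
  rewrite rM => /(leq_trans (ltn0Sn _))/card_gt0P[[[i j] /= ij] _].
  by apply: leq_ltn_trans (ltn_ord j); apply: leq_ltn_trans ij.
have dn : rk n = (n.-1 + n.-2)%N by move: n1; clear; lia.
pose o := Ordinal (ltnW n1); have o0 : o = 0%N :> nat by [].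
have uw1 := Trop_ultrametric o0 T1; have uw2 := Trop_ultrametric o0 T2.
have dB : d.+1 = rk n := span_basis_dim B1P M1P.
have [fM1 cM1 M1s] := M1P; have [fM2 cM2 M2s] := M2P; have [fB cB _] := BP.
rewrite s1 in cM1; rewrite s2 in cM2.
have [[p [q [s [tpqs ch1 ch2]]]]|agree] :=
    pselect (exists p q s, [/\ triple o p q s, cherry o w1 p q s & cherry o w2 q s p]).
  apply: (@adjacent_bodies R n o o0 w1 w2 M1 M2 d B) tpqs ch1 ch2 => //.
  - by move=> r; apply: (groebner_cone_tree_cone o0 T1).
  - by move=> r; apply: (groebner_cone_tree_cone o0 T2).
  - by apply/row_subP => r; apply: M1s; have [] := cB r.
  - by rewrite (eqP fB).
  - by move=> r; apply: (groebner_cone_tree_cone o0 T1); have [] := cB r; rewrite s1.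
  - by move=> r; apply: (groebner_cone_tree_cone o0 T2); have [_] := cB r; rewrite s2.
(* The two trees agree on every triple. *)
exfalso; have J12 : init_ideal w1 (I2 R n) = init_ideal w2 (I2 R n).
  apply/predeqP => f; split.
    apply: (same_tree_sub o0 T1 T2 p1 p2 cM1 cM2 (eqP fM1) (eqP fM2) dn n1) => i j k t c.
    have [//|c'|c'] := uw2 _ _ _ t; case: agree.
      by exists j, i, k; split=> //; [rewrite tripleC12|apply: cherryC].
    by exists i, j, k.
  apply: (same_tree_sub o0 T2 T1 p2 p1 cM2 cM1 (eqP fM2) (eqP fM1) dn n1) => i j k t c.
  have [//|c'|c'] := uw1 _ _ _ t; case: agree.
    by exists k, i, j; split=> //; [rewrite tripleC12 tripleC23|apply: cherryC].
  by exists k, j, i; split; [rewrite tripleC12 tripleC23 tripleC12|apply: cherryC..].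
have s12 : sigma1 = sigma2 by rewrite s1 s2 /groebner_cone J12.
move: BP; rewrite -s12 setIid => /(span_basis_dim B1P) dd.
by move: dd => /eqP; rewrite eqn_leq ltnn.
Qed.
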